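(* Let $d=1$, $\epsilon\in[0,1/4]$, $L>0$, let $f\in\Lambda(\beta,L)$ with $\beta\in(1,\infty)$, and let $c\in(0,1/2)$ be a small constant. Let $K$ be a kernel as in the context. Let $z_1,\dots,z_m$ be the local binning medians with $m$ bins and let $\check f(x)=\sum_{j=1}^m K_j^h(x)\,z_j$ be the kernel smoothing estimator applied to them, where $m\asymp\sqrt n/\sqrt[4]{\log n}$ and $h\asymp(nL^2)^{-\frac{1}{2\beta+1}}$. Then there exist an absolute constant $C>0$ and a constant $C_L>0$ depending on $L$ such that, with probability at least $0.9$, $$\int_c^{1-c}|\check f(x)-f(x)|^2\,dx\le C\left(C_L\,n^{-\frac{2\beta}{2\beta+1}}+\epsilon^2\right).$$
   Context: Write $[k]=\{1,\dots,k\}$. Fixed design on $[0,1]$: $x_i=i/n$, $i\in[n]$. Huber's $\epsilon$-contamination model: for an unknown $f:[0,1]\to\mathbb R$ one observes independent $y_i$, $i\in[n]$, with $y_i\sim(1-\epsilon)N(f(x_i),1)+\epsilon\,Q(x_i)$, where each $Q(x_i)$ is an arbitrary (adversarial, unknown) probability distribution on $\mathbb R$. Local binning medians: for a positive integer $m$, bin $j\in[m]$ is the interval $(\frac{j-1}{m},\frac jm]$; it is assumed that $m$ and $s=n/m$ are integers, so each bin contains exactly $s$ design points. $z_j=\mathrm{median}\{y_i:x_i\in\text{bin }j\}$ (usual sample median). Kernel: with $\ell=\lfloor\beta\rfloor$, $K:\mathbb R\to\mathbb R$ is a fixed function supported on $[-1,1]$ with $\int_{-1}^1K(x)dx=1$,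 $\int_{-1}^1K(x)x^k\,dx=0$ for $k=1,\dots,\ell$, and $\int_{-1}^1K^2(x)dx=\kappa<\infty$. For $0<h<1/2$ and a query point $x\in(h,1-h)$, $$K_j^h(x)=\int_{(j-1)/m}^{j/m}\frac1h K\!\left(\frac{x-u}{h}\right)du,\qquad j=1,\dots,m.$$ Hölder class $\Lambda(\beta,L)$ (for $d=1$): with $\ell=\lfloor\beta\rfloor$, the functions $f:[0,1]\to\mathbb R$ such that for all $x\neq x'$ in $[0,1]$, $\sum_{j=0}^{\ell}|f^{(j)}(x)|+\frac{|f^{(\ell)}(x)-f^{(\ell)}(x')|}{|x-x'|^{\beta-\ell}}\le L$. $a\asymp b$ means $a$ and $b$ agree up to absolute multiplicative constants.
   Formalization: The bound is proved for n at least some n_0 depending only on K and the constants in ≍; for small n it fails (n=m=4, ε=1/4, far-away Dirac contamination). C may depend on K and the ≍ constants, and C_L on these as well as L. *)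

(* Defs.v *)
From HB Require Import structures.
From mathcomp Require Import all_boot all_order all_algebra.
From mathcomp Require Import all_classical all_reals all_analysis.
Import Order.TTheory GRing.Theory Num.Theory.
Import numFieldNormedType.Exports.

Set Implicit Arguments.
Unset Strict Implicit.
Unset Printing Implicit Defensive.

Local Open Scope classical_set_scope.
Local Open Scope ring_scope.

Definition asymp_up_to (R : realType) (A a b : R) : Prop :=
  A^-1 * b <= a /\ a <= A * b.

(* Functions on [0, 1] are total functions R -> R; only their values on [0, 1]
   matter. Derivatives are taken within [0, 1], hence one-sided at 0 and 1. *)
Definition diff_quotient01 (R : realType) (f : R -> R) (x : R) : set_system R :=
  (f y - f x) / (y - x) @[y --> within `[0, 1] x^'].

Definition derivable01 (R : realType) (f : R -> R) (x : R) : Prop :=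
  cvg (diff_quotient01 f x).

Definition derive01 (R : realType) (f : R -> R) (x : R) : R :=
  lim (diff_quotient01 f x).

Definition derive01n (R : realType) (k : nat) (f : R -> R) : R -> R :=
  iter k (@derive01 R) f.

(* For integer beta the exponent beta - l is 0 and the denominator is 1. *)
Definition hoelder_class (R : realType) (beta L : R) (f : R -> R) : Prop :=
  let l := Num.truncn beta in
  (forall k x, (k < l)%N -> x \in `[0, 1] -> derivable01 (derive01n k f) x) /\
  (forall x x', x \in `[0, 1] -> x' \in `[0, 1] -> x != x' ->
     \sum_(0 <= j < l.+1) `|derive01n j f x|
     + `|derive01n l f x - derive01n l f x'| / (`|x - x'| `^ (beta - l%:R))
     <= L).

(* Kernels of order l. Square integrability on [-1, 1] makes all the integrals
   below genuine Lebesgue integrals. *)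
Definition is_kernel (R : realType) (l : nat) (K : R -> R) : Prop :=
  [/\ measurable_fun [set: R] K,
      forall u, u \notin `[-1, 1] -> K u = 0,
      \int[lebesgue_measure]_(u in `[-1, 1]) K u = 1,
      forall k, (1 <= k <= l)%N ->
        \int[lebesgue_measure]_(u in `[-1, 1]) (K u * u ^+ k) = 0 &
      (\int[lebesgue_measure]_(u in `[(-1)%R, 1%R]) ((K u) ^+ 2)%:E < +oo)%E].

(* Index i : 'I_n, which starts at 0, stands for i + 1; likewise for bins. *)
Definition design (R : realType) (n : nat) (i : 'I_n) : R := i.+1%:R / n%:R.

Definition in_bin (R : realType) (m : nat) (j : 'I_m) (x : R) : bool :=
  j%:R / m%:R < x <= j.+1%:R / m%:R.

(* The average of the two middle order statistics; they coincide when the size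
   is odd. *)
Definition median (R : realType) (s : seq R) : R :=
  let t := sort <=%R s in
  (t`_((size s).-1./2) + t`_((size s)./2)) / 2.

Definition bin_median (R : realType) (n m : nat) (y : 'I_n -> R) (j : 'I_m) : R :=
  median [seq y i | i <- enum 'I_n & in_bin j (design R i)].

Definition kernel_weight (R : realType) (K : R -> R) (m : nat) (h : R)
    (j : 'I_m) (x : R) : R :=
  \int[lebesgue_measure]_(u in `[j%:R / m%:R, j.+1%:R / m%:R])
    (h^-1 * K ((x - u) / h)).

Definition smoothed_median (R : realType) (K : R -> R) (n m : nat) (h : R)
    (y : 'I_n -> R) (x : R) : R :=
  \sum_(j < m) kernel_weight K h j x * bin_median y j.

Definition mutually_independent (R : realType) (d : measure_display)
    (T : measurableType d) (P : probability T R) (n : nat)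
    (Y : 'I_n -> {RV P >-> R}) : Prop :=
  forall (J : {set 'I_n}) (A : 'I_n -> set R),
    (forall i, measurable (A i)) ->
    P (\bigcap_(i in [set i | i \in J]) (Y i @^-1` A i)) =
    (\prod_(i in J) P (Y i @^-1` A i))%E.

Definition huber_model (R : realType) (d : measure_display)
    (T : measurableType d) (P : probability T R) (n : nat) (eps : R)
    (f : R -> R) (Q : 'I_n -> probability R R)
    (Y : 'I_n -> {RV P >-> R}) : Prop :=
  mutually_independent Y /\
  forall (i : 'I_n) (A : set R), measurable A ->
    distribution P (Y i) A =
    ((1 - eps)%:E * normal_prob (f (design R i)) 1 A + eps%:E * Q i A)%E.

(* Main.v *)
(** The order statistics of a bin are read off counts of observations above or
    below a level, which are sums of independent indicators. Let [mu j] be the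
    value of [f] at the right end of bin [j], [delta = L / m], [s = n / m], and
    round both middle order statistics to a fine grid centred at [mu j]; unless
    some bin median is more than [1 + delta] away from [mu j], which is
    exponentially unlikely in [s], the rounded deviation [D j] of the median is
    a signed sum of finitely many indicators. By the symmetry of the Gaussian
    law the probabilities of the two opposite deviations of size [t] differ by
    [O((eps + delta) * sqrt s * exp (- c * s * t^2))] once [t] exceeds a multiple
    of [eps + delta]; summing over the grid, [D j] has mean [O(eps + delta)]
    (no [1 / sqrt s] term) and second moment [O((eps + delta)^2 + 1 / s)]. The
    [D j] are uncorrelated and the squares of the kernel weights sum to
    [O(1 / (m h))], so the integrated square of the smoothed fluctuation has
    mean [O(((eps + delta)^2 + 1 / s) / (m h))], and Markov's inequality applies.
    The bias is the mean of [D j] plus the Taylor error [L * h^beta] plus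
    [delta]. *)

Require Import Defs.
From HB Require Import structures.
From mathcomp Require Import all_boot all_order all_algebra.
From mathcomp Require Import all_classical all_reals all_analysis.
From mathcomp Require Import measurable_realfun.
From mathcomp Require Import ring lra.
From mathcomp Require polyrcf.
From mathcomp Require Import zify.
Import Order.TTheory GRing.Theory Num.Theory.
Import numFieldNormedType.Exports.

Set Implicit Arguments.
Unset Strict Implicit.
Unset Printing Implicit Defensive.

Local Open Scope classical_set_scope.
Local Open Scope ring_scope.

(** A bin median fluctuates by about [1 / sqrt s], roughly [n^(-1/4)], whose square exceeds the
    target rate. Concentration of single medians therefore cannot bound the bias: the means must be
    shown to be free of this term, by comparing opposite deviations. Contamination may have such
    heavy tails that a median has no mean; rounding it and capping it at [1 + delta] gives a
    variable with finitely many values, all of whose moments are finite sums. The constants [C] and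
    [n0] are fixed before [L], so [delta = L / m] cannot be assumed small. This is why levels below
    [25 * (eps + delta)] receive the trivial bound 1, and why [1 / (m * h)] is bounded by 1 plus a
    multiple of [1 / n]: constants depending on [L] then multiply the rate only, never [eps^2]. The
    condition [beta > 1] makes [m * h] grow like a power of [n], and the logarithm in the choice of
    [m] leaves [delta^2] of order [sqrt (log n) / n], still within the rate. *)

(* Probability of at least [r] successes in independent trials with success
   probabilities [ps]; truncation of [r.-1] is harmless as the value at 0 is 1. *)
Fixpoint poisson_binomial_tail (R : pzRingType) (r : nat) (ps : seq R) : R :=
  if ps is p :: ps' then
    p * poisson_binomial_tail r.-1 ps' + (1 - p) * poisson_binomial_tail r ps'
  else (r == 0%N)%:R.

(** The common success probability is the indeterminate, so that the tail can be differentiated and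
    the mean value theorem applied to it. *)
Fixpoint binomial_tail (R : nzRingType) (n r : nat) : {poly R} :=
  if n is n'.+1 then
    'X * binomial_tail R n' r.-1 + (1 - 'X) * binomial_tail R n' r
  else (r == 0%N)%:R.

(** * Tails of sums of independent indicators *)

Section PoissonBinomial.
Variable R : realFieldType.
Implicit Types (p q x : R) (r : nat).

Lemma poisson_binomial_tail_anti (ps : seq R) r :
  (forall p, p \in ps -> 0 <= p <= 1) ->
  [/\ poisson_binomial_tail r.+1 ps <= poisson_binomial_tail r ps,
      0 <= poisson_binomial_tail r ps & poisson_binomial_tail r ps <= 1].
Proof.
elim: ps r => [|p ps IH] r ps01 /=; first by case: eqP; split.
have /andP[p0 p1] : 0 <= p <= 1 by apply: ps01; rewrite mem_head.
have {}IH k := IH k (fun q qs => ps01 q (mem_behead (s := p :: ps) qs)).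
have [a0 b0 c0] := IH r; have [a1 b1 c1] := IH r.-1.
have a2 : poisson_binomial_tail r ps <= poisson_binomial_tail r.-1 ps by case: (r) a1.
by split; nra.
Qed.

(** Each tail is affine in a single success probability, with slope the difference of the tails at
    [r.-1] and [r], which is nonnegative. Observations in a bin have different laws; this comparison
    replaces them by equal ones. *)
Lemma poisson_binomial_tail_homo (I : eqType) (s : seq I) (p q : I -> R) r :
  (forall i, i \in s -> [/\ 0 <= p i, p i <= q i & q i <= 1]) ->
  poisson_binomial_tail r (map p s) <= poisson_binomial_tail r (map q s).
Proof.
elim: s r => [|i s IH] r pq //=.
have [p0 p_q q1] : [/\ 0 <= p i, p i <= q i & q i <= 1].
  by apply: pq; rewrite mem_head.
have {}IH k := IH k (fun j js => pq j (mem_behead (s := i :: s) js)).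
have ps01 x : x \in map p s -> 0 <= x <= 1.
  move=> /mapP[j js ->]; have [] := pq j (mem_behead (s := i :: s) js).
  by move=> -> /= pj; exact: le_trans.
have [_ a0 _] := poisson_binomial_tail_anti r ps01.
have [_ a1 _] := poisson_binomial_tail_anti r.-1 ps01.
have a2 : poisson_binomial_tail r (map p s) <= poisson_binomial_tail r.-1 (map p s).
  by case: (r) => // k; have [] := poisson_binomial_tail_anti k ps01.
have b0 := IH r; have b1 := IH r.-1.
by nra.
Qed.

Lemma poisson_binomial_tail_nseq n r p :
  poisson_binomial_tail r (nseq n p) = (binomial_tail R n r).[p].
Proof.
elim: n r => [|n IH] r /=; first by case: eqP => _; rewrite ?hornerC ?horner0.
by rewrite !hornerE !IH.
Qed.

Lemma binomial_tail_range n r p : 0 <= p <= 1 ->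
  0 <= (binomial_tail R n r).[p] <= 1.
Proof.
move=> p01; rewrite -poisson_binomial_tail_nseq.
have [] := @poisson_binomial_tail_anti (nseq n p) r.
  by move=> q /nseqP[-> _].
by move=> _ -> ->.
Qed.

Lemma poisson_binomial_tail_le (I : eqType) (s : seq I) (p : I -> R) r q :
  (forall i, i \in s -> 0 <= p i <= q) -> q <= 1 ->
  poisson_binomial_tail r (map p s) <= (binomial_tail R (size s) r).[q].
Proof.
move=> pq q1; rewrite -poisson_binomial_tail_nseq.
have -> : nseq (size s) q = map (fun=> q) s by elim: (s) => //= a l ->.
by apply: poisson_binomial_tail_homo => i /pq/andP[].
Qed.

Lemma poisson_binomial_tail_ge (I : eqType) (s : seq I) (p : I -> R) r q :
  (forall i, i \in s -> q <= p i <= 1) -> 0 <= q ->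
  (binomial_tail R (size s) r).[q] <= poisson_binomial_tail r (map p s).
Proof.
move=> pq q0; rewrite -poisson_binomial_tail_nseq.
have -> : nseq (size s) q = map (fun=> q) s by elim: (s) => //= a l ->.
by apply: poisson_binomial_tail_homo => i /pq/andP[].
Qed.

Lemma binomial_tailB n r :
  binomial_tail R n r - binomial_tail R n r.+1 =
  'C(n, r)%:R * 'X^r * (1 - 'X) ^+ (n - r).
Proof.
have step (a b c d : {poly R}) :
  'X * a + (1 - 'X) * b - ('X * c + (1 - 'X) * d) =
  'X * (a - c) + (1 - 'X) * (b - d) by ring.
elim: n r => [|n IH] [|r] /=.
- by rewrite subr0 bin0 expr0 !mulr1.
- by rewrite subrr bin0n mulr0n !mul0r.
- by rewrite step subrr mulr0 add0r IH !bin0 !subn0 exprS; ring.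
- rewrite step !IH binS subSS natrD !exprS.
  have [rn|rn] := ltnP r n.
    by rewrite -(subnSK rn) exprS; ring.
  by rewrite (bin_small (_ : n < r.+1)%N) ?ltnS //; ring.
Qed.

(** With [binomial_tailB] the derivative is [n] times the mass of [n.-1] trials at [r]: the Beta
    density of an order statistic of uniform variables. *)
Lemma deriv_binomial_tail n r :
  (binomial_tail R n r.+1)^`() =
  n%:R * (binomial_tail R n.-1 r - binomial_tail R n.-1 r.+1).
Proof.
have tail0 k : binomial_tail R k 0 = 1.
  by elim: k => //= k ->; rewrite !mulr1 addrC subrK.
have deriv1 : (1 : {poly R})^`() = 0 by exact: derivC.
elim: n r => [|n IH] r; first by rewrite /= deriv0 mul0r.
rewrite /= derivD !derivM derivB derivX deriv1 sub0r IH.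
case: r => [|r].
  rewrite tail0 deriv1.
  case: n {IH} => [|n] /=; first by ring.
  by rewrite tail0; ring.
rewrite IH; case: n {IH} => [|n] /=; first by ring.
by rewrite -[n.+2]addn1 natrD; ring.
Qed.

(** Markov's inequality for [x ^ S] with [S] binomial; the right-hand side is the generating
    function of [S]. *)
Lemma binomial_tail_chernoff n r p x : 0 <= p <= 1 -> 1 <= x ->
  (binomial_tail R n r).[p] * x ^+ r <= (1 - p + p * x) ^+ n.
Proof.
move=> /andP[p0 p1] x1; elim: n r => [|n IH] r /=.
  by case: eqP => [->|_]; rewrite ?hornerC ?horner0 ?expr0 ?mulr1 ?mul0r ?expr0 ?ler01.
rewrite !hornerE exprS.
have x0 : 0 <= x by lra.
have H1 : (binomial_tail R n r.-1).[p] * x ^+ r <= x * (1 - p + p * x) ^+ n.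
  case: r => [|r] /=.
    rewrite expr0 mulr1; apply: (le_trans (y := (1 - p + p * x) ^+ n)).
      by have := IH 0%N; rewrite expr0 mulr1.
    by rewrite ler_peMl // exprn_ge0 //; nra.
  by rewrite exprS mulrCA ler_wpM2l.
by have H2 := IH r; nra.
Qed.

(* Chernoff's bound at the optimal tilt [x = (1 - p) / p]. *)
Lemma binomial_tail_sqr_le n r p : 0 <= p -> p <= 1 / 2 -> (n <= r.*2)%N ->
  (0 < n)%N -> (binomial_tail R n r).[p] ^+ 2 <= (4 * p * (1 - p)) ^+ n.
Proof.
move=> p0 p12 nr n0.
have [->|pn0] := eqVneq p 0.
  have r0 : (0 < r)%N by case: (r) nr => //; case: (n) n0.
  suff -> : (binomial_tail R n r).[0] = 0.
    by rewrite mulr0 mul0r !expr0n /=; case: (n) n0.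
  elim: n r r0 {nr n0} => [|n IH] [|r] //= _; first by rewrite horner0.
  by rewrite !hornerE IH // mulr0.
have pp : 0 < p by rewrite lt_def pn0.
have x1 : 1 <= (1 - p) / p by rewrite ler_pdivlMr // mul1r; lra.
have := @binomial_tail_chernoff n r p ((1 - p) / p).
rewrite mulrCA divff // mulr1 => H.
have {}H := H _ x1; have /H{}H : 0 <= p <= 1 by rewrite p0; lra.
have /andP[G0 _] : 0 <= (binomial_tail R n r).[p] <= 1.
  by apply: binomial_tail_range; rewrite p0; lra.
have H2 : ((binomial_tail R n r).[p] * ((1 - p) / p) ^+ r) ^+ 2 <=
   ((1 - p + (1 - p)) ^+ n) ^+ 2.
  rewrite lerXn2r // nnegrE ?mulr_ge0 ?exprn_ge0 //; try lra.
rewrite exprMn -!exprM !muln2 in H2.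
(* Squaring doubles the exponent to [r.*2 >= n]. The tilt is at least 1, so the exponent may be
   lowered to [n], and [4 * p * (1 - p)] appears without a square root. *)
have H3 : ((1 - p) / p) ^+ n <= ((1 - p) / p) ^+ r.*2 by rewrite ler_weXn2l.
have H4 : (binomial_tail R n r).[p] ^+ 2 * ((1 - p) / p) ^+ n <= (1 - p + (1 - p)) ^+ n.*2.
  by apply: le_trans H2; rewrite ler_wpM2l // sqr_ge0.
have q0 : 0 < ((1 - p) / p) ^+ n by rewrite exprn_gt0 // (lt_le_trans _ x1).
rewrite -ler_pdivlMr // in H4; apply: le_trans H4 _.
rewrite -addnn exprD -exprMn -expr_div_n le_eqVlt; apply/orP; left.
apply/eqP; congr (_ ^+ n); field.
by rewrite pn0 /=; apply/eqP; lra.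
Qed.

(** The square of ['C(2k, k) <= 4^k / sqrt (2k + 1)], which keeps the induction in the natural
    numbers. Consecutive coefficients have ratio [2 (2k + 1) / (k + 1)], and
    [(2k + 1) (2k + 3) <= 4 (k + 1)^2]. *)
Lemma central_bin_sqr_le k : ('C(k.*2, k) ^ 2 * k.*2.+1 <= 16 ^ k)%N.
Proof.
elim: k => // k IH.
have E : (k.+1 * 'C(k.+1.*2, k.+1) = 2 * k.*2.+1 * 'C(k.*2, k))%N.
  rewrite doubleS -mul_bin_diag.
  have : (k.+1 * 'C(k.*2.+1, k) = k.*2.+1 * 'C(k.*2, k))%N.
    have := mul_bin_down k.*2.+1 k.
    by rewrite subSn -?addnn ?leq_addr // addnK => <-.
  have := mul_bin_diag k.+1.*2 k; rewrite doubleS /=.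
  by lia.
rewrite -(@leq_pmul2l (k.+1 ^ 2)) //.
apply: (@leq_trans (4 * k.*2.+1 * k.*2.+3 * 16 ^ k)); last first.
  by rewrite [(16 ^ k.+1)%N]expnS [leqRHS]mulnA leq_mul2r; apply/orP; right; nia.
rewrite mulnA -expnMn E doubleS.
apply: (@leq_trans (4 * k.*2.+1 * k.*2.+3 * ('C(k.*2, k) ^ 2 * k.*2.+1))); first by nia.
by rewrite leq_mul2l IH orbT.
Qed.

End PoissonBinomial.

(** Origin of the requirement of three points per bin: it fails for [s] equal to 1 or 2. *)
Lemma leq_half_mul4 s : (3 <= s)%N -> (s <= s.-1./2 * 4)%N.
Proof. by have := odd_double_half s.-1; lia. Qed.

(** * Exponential and Lipschitz bounds for binomial tails *)

Section BinomialTailReal.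
Variable R : realType.
Implicit Types (p q : R) (s r : nat).

Lemma central_bin_le k : 'C(k.*2, k)%:R * Num.sqrt k.*2.+1%:R <= 4 ^+ k :> R.
Proof.
rewrite -(@ler_pXn2r _ 2) // ?nnegrE ?mulr_ge0 ?sqrtr_ge0 ?exprn_ge0 //.
rewrite exprMn sqr_sqrtr // -exprM mulnC exprM -!natrX -natrM ler_nat.
exact: central_bin_sqr_le.
Qed.

(** By symmetry both middle ranks have the same coefficient, and for odd [n] it is half of the next
    central one. *)
Lemma middle_bin_le n r : (r == n./2) || (r == uphalf n) ->
  'C(n, r)%:R * Num.sqrt n.+1%:R <= 2 * 4 ^+ n./2 :> R.
Proof.
move=> rn; have {rn} -> : 'C(n, r) = 'C(n, n./2).
  case/orP: rn => /eqP -> //; rewrite -[in RHS]bin_sub ?leq_half_double.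
    by congr 'C(_, _); have := odd_double_half n; rewrite uphalf_half; lia.
  by have := odd_double_half n; lia.
have := odd_double_half n; set k := n./2; clearbody k.
case: (odd n) => /= <-; last first.
  rewrite add0n (le_trans (central_bin_le _)) // ler_peMl ?exprn_ge0 //; lra.
have E : (2 * 'C(k.*2.+1, k) = 'C(k.+1.*2, k.+1))%N.
  rewrite doubleS binS mul2n -addnn; congr (_ + _)%N.
  have kk : (k <= k.*2.+1)%N by lia.
  by rewrite -(bin_sub kk); congr 'C(_, _); lia.
have H := central_bin_le k.+1; rewrite -E natrM exprS in H.
have S : Num.sqrt k.*2.+2%:R <= Num.sqrt k.+1.*2.+1%:R :> R.
  by rewrite ler_sqrt // ler_nat; lia.
rewrite add1n.
have : 'C(k.*2.+1, k)%:R * Num.sqrt k.*2.+2%:R <=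
  'C(k.*2.+1, k)%:R * Num.sqrt k.+1.*2.+1%:R :> R by rewrite ler_wpM2l.
by lra.
Qed.

(** [4 * x * (1 - x)] equals [1 - (1 - 2 * x) ^+ 2]. *)
Lemma one_sub_sqr_expr_le (x : R) n : 0 <= x <= 1 ->
  (4 * x * (1 - x)) ^+ n <= expR (- (1 - 2 * x) ^+ 2 * n%:R).
Proof.
move=> /andP[x0 x1]; rewrite expRM_natr lerXn2r ?nnegrE ?expR_ge0 //.
  by nra.
by apply: le_trans (expR_ge1Dx _); lra.
Qed.

(** The derivative is [s] times a middle point mass, and a middle binomial coefficient is
    [O(2^s / sqrt s)]; what remains is [sqrt s] and an exponential factor, since [x <= q <= 1 / 2]
    keeps [4 * x * (1 - x)] away from 1. The exponential factor makes the bound summable over the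
    grid. *)
Lemma binomial_tail_lipschitz s r p q : (3 <= s)%N ->
  (r == (s.-1)./2) || (r == uphalf s.-1) ->
  0 <= p -> p <= q -> q <= 1 / 2 ->
  (binomial_tail R s r.+1).[q] - (binomial_tail R s r.+1).[p] <=
  (q - p) * (2 * Num.sqrt s%:R * expR (- (1 - 2 * q) ^+ 2 * s%:R / 4)).
Proof.
move=> s3 rs p0; rewrite le_eqVlt => /predU1P[->|pq] q12.
  by rewrite !subrr mul0r.
have [x] := polyrcf.poly_mvt (binomial_tail R s r.+1) pq.
rewrite in_itv /= => /andP[px xq] ->.
rewrite mulrC ler_wpM2l ?subr_ge0 ?(ltW pq) // deriv_binomial_tail binomial_tailB.
have x01 : 0 <= x <= 1 by apply/andP; split; lra.
set k := (s.-1)./2.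
have xk : x ^+ r * (1 - x) ^+ (s.-1 - r) <= (x * (1 - x)) ^+ k.
  (* For either middle rank at least [k] factors [x] and [k] factors [1 - x] are present; the
     surplus ones are at most 1. *)
  have [u [v [ru ru']]] : exists u v, r = (k + u)%N /\ (s.-1 - r = k + v)%N.
    case/orP: rs => /eqP ->.
      by exists 0%N, (s.-1 - k - k)%N; rewrite /k; split; have := half_leq (leqnn s.-1); lia.
    by exists (uphalf s.-1 - k)%N, 0%N; rewrite /k; lia.
  rewrite ru' ru !exprD exprMn.
  have a1 : x ^+ u <= 1 by rewrite exprn_ile1 //; lra.
  have a0 : 0 <= x ^+ u by rewrite exprn_ge0 //; lra.
  have b1 : (1 - x) ^+ v <= 1 by rewrite exprn_ile1 //; lra.
  have b0 : 0 <= (1 - x) ^+ v by rewrite exprn_ge0 //; lra.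
  rewrite mulrACA ler_piMr // ?mulr_ge0 ?exprn_ge0 //; try lra.
  by rewrite mulr_ile1.
rewrite !hornerM !hornerMn !hornerE /=.
have C0 := middle_bin_le rs; rewrite prednK in C0; last by lia.
have := one_sub_sqr_expr_le k x01.
rewrite -mulrA exprMn -/k => E1.
have E2 : expR (- (1 - 2 * x) ^+ 2 * k%:R) <= expR (- (1 - 2 * q) ^+ 2 * s%:R / 4).
  rewrite ler_expR !mulNr lerN2 -mulrA ler_pM ?sqr_ge0 ?mulr_ge0 ?invr_ge0 //.
    by rewrite lerXn2r // ?nnegrE; lra.
  by rewrite ler_pdivrMr // -natrM ler_nat leq_half_mul4.
(* One factor [sqrt s] is spent on the middle binomial coefficient, the other stays in the Lipschitz
   constant. *)
have sE : s%:R = Num.sqrt s%:R * Num.sqrt s%:R :> R by rewrite -expr2 sqr_sqrtr.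
rewrite {1}sE {sE}.
set S := Num.sqrt s%:R in C0 *.
have S0 : 0 <= S by rewrite sqrtr_ge0.
apply: (le_trans (y := S * ('C(s.-1, r)%:R * S * (x * (1 - x)) ^+ k))).
  rewrite -!mulrA ler_wpM2l // mulrCA ler_wpM2l // ler_wpM2l //.
apply: (le_trans (y := S * (2 * (4 ^+ k * (x * (1 - x)) ^+ k)))); last first.
  by rewrite (mulrC 2 S) -(mulrA S 2) ler_wpM2l // ler_wpM2l // (le_trans E1).
by rewrite ler_wpM2l // mulrA ler_wpM2r // exprn_ge0 // mulr_ge0; lra.
Qed.

Lemma binomial_tail_tail s r q : (0 < s)%N -> (s <= r.*2)%N ->
  0 <= q -> q <= 1 / 2 ->
  (binomial_tail R s r).[q] <= expR (- (1 - 2 * q) ^+ 2 * s%:R / 2).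
Proof.
move=> s0 sr q0 q12.
have q01 : 0 <= q <= 1 by apply/andP; split; lra.
rewrite -(@ler_pXn2r _ 2) // ?nnegrE ?expR_ge0 //; last first.
  by have /andP[] := binomial_tail_range s r q01.
apply: le_trans (binomial_tail_sqr_le q0 q12 sr s0) _.
apply: le_trans (one_sub_sqr_expr_le s q01) _.
by rewrite -expRM_natr ler_expR divfK.
Qed.

End BinomialTailReal.

(** * Gaussian tails *)

Section AffineSubstitution.
Variable R : realType.
Local Notation mu := (@lebesgue_measure R).
Local Open Scope ereal_scope.

Let phi (a b : R) (u : measurableTypeR R) : measurableTypeR R := (a * u + b)%R.

Let measurable_phi a b : measurable_fun setT (phi a b).
Proof. by apply: measurable_funD => //; exact: measurable_funM. Qed.

(** By uniqueness of Lebesgue measure it suffices to test half-open intervals. For [a < 0] the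
    preimage is open at the other end, which does not change its measure. *)
Lemma lebesgue_measure_affine (a b : R) (A : set R) : a != 0%R -> measurable A ->
  mu A = `|a|%:E * mu ((fun u : R => a * u + b)%R @^-1` A).
Proof.
move=> a0 mA.
pose nu : {measure set (measurableTypeR R) -> \bar R} :=
  mscale (NngNum (normr_ge0 a)) (pushforward mu (phi a b)).
rewrite (@lebesgue_measure_unique R (nu (measurable_phi a b))) // => _ [[c d]] _ <-.
rewrite /nu /= /mscale /= /pushforward.
have [a_gt0|a_le0] := ltP 0%R a.
  have -> : phi a b @^-1` `]c, d]%classic = `]((c - b) / a)%R, ((d - b) / a)%R]%classic.
    apply/seteqP; split => u /=; rewrite !in_itv /= /phi ltr_pdivrMr // ler_pdivlMr //.
      by rewrite mulrC; move=> /andP[? ?]; apply/andP; split; lra.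
    by rewrite mulrC; move=> /andP[? ?]; apply/andP; split; lra.
  rewrite !lebesgue_measure_itv /= !lte_fin ltr_pM2r ?invr_gt0 // ltrD2r.
  case: ifP => _; last by rewrite mule0.
  by rewrite -!EFinB -EFinM gtr0_norm //; congr EFin; field.
have a_lt0 : (a < 0)%R by rewrite lt_def eq_sym a0.
have -> : phi a b @^-1` `]c, d]%classic = `[((d - b) / a)%R, ((c - b) / a)%R[%classic.
  apply/seteqP; split => u /=; rewrite !in_itv /= /phi ltr_ndivlMr // ler_ndivrMr //.
    by rewrite mulrC; move=> /andP[? ?]; apply/andP; split; lra.
  by rewrite mulrC; move=> /andP[? ?]; apply/andP; split; lra.
rewrite !lebesgue_measure_itv /= !lte_fin ltr_nM2r ?invr_lt0 // ltrD2r.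
case: ifP => _; last by rewrite mule0.
by rewrite -!EFinB -EFinM ltr0_norm //; congr EFin; field.
Qed.

Lemma ge0_integral_affine (a b : R) (f : R -> \bar R) : a != 0%R ->
  measurable_fun setT f -> (forall x, 0 <= f x) ->
  \int[mu]_u f (a * u + b)%R = `|a|^-1%:E * \int[mu]_u f u.
Proof.
move=> a0 mf f0.
pose k := NngNum (normr_ge0 a).
have muE : \int[mu]_u f u = \int[mscale k (pushforward mu (phi a b))]_u f u.
  by move=> mphi; apply: eq_measure_integral => A mA _; exact: lebesgue_measure_affine.
rewrite (muE (measurable_phi a b)) ge0_integral_mscale // ge0_integral_pushforward // preimage_setT.
rewrite muleA -EFinM mulVf ?normr_eq0 // mul1e.
by [].
Qed.

Lemma integral_affine (a b : R) (f : R -> R) : a != 0%R ->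
  mu.-integrable setT (EFin \o f) ->
  \int[mu]_u (f (a * u + b)%R)%:E = `|a|^-1%:E * \int[mu]_u (f u)%:E.
Proof.
move=> a0 intf; have mf := measurable_int _ intf.
rewrite [in RHS]integralE muleBr //; last first.
  by apply: fin_num_adde_defl; rewrite fin_numN; apply: integrable_neg_fin_num.
rewrite -(@ge0_integral_affine a b (EFin \o f)^\+) // -?(@ge0_integral_affine a b (EFin \o f)^\-) //.
- rewrite [LHS]integralE; congr (_ - _); apply: eq_integral => u _.
    by rewrite !funeposE.
  by rewrite !funenegE.
- exact: measurable_funeneg.
- exact: measurable_funepos.
Qed.

Lemma integrable_affine (a b : R) (f : R -> R) : a != 0%R ->
  mu.-integrable setT (EFin \o f) ->
  mu.-integrable setT (fun u => (f (a * u + b)%R)%:E).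
Proof.
move=> a0 /integrableP[mf fi]; apply/integrableP; split.
  exact: (measurableT_comp mf (measurable_phi a b)).
rewrite (@ge0_integral_affine a b (fun u => `|(f u)%:E|)) //; last first.
  exact: measurableT_comp.
by rewrite lte_mul_pinfty // lee_fin invr_ge0.
Qed.

End AffineSubstitution.

Section Gaussian.
Variable R : realType.
Local Notation mu := (@lebesgue_measure R).
Implicit Types (t x y v m : R).

Definition gauss_tail t : R := fine (normal_prob (0 : R) 1 `]t, +oo[%classic).

Lemma normal_pdf_center m x : normal_pdf m 1 x = normal_pdf 0 1 (x - m).
Proof. by rewrite !normal_pdfE // /normal_fun subr0. Qed.

Lemma normal_pdf_sym x : normal_pdf (0 : R) 1 (- x) = normal_pdf 0 1 x.
Proof. by rewrite !normal_pdfE // /normal_fun !subr0 sqrrN. Qed.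

Lemma gauss_tailE t :
  (\int[mu]_(x in `]t, +oo[) (normal_pdf 0 1 x)%:E)%E = (gauss_tail t)%:E.
Proof. by rewrite -/(normal_prob 0 1 _) fineK // fin_num_measure. Qed.

(** [a ^+ 2 = 1] covers translations and reflections at once, so that upper and lower tails both
    reduce to [gauss_tail]. *)
Lemma normal_prob_affine (m a b : R) (A B : set R) : a ^+ 2 = 1 ->
  measurable A -> (forall u, B u <-> A (a * u + b)) ->
  (forall u, normal_pdf m 1 (a * u + b) = normal_pdf 0 1 u) ->
  normal_prob m 1 A = normal_prob 0 1 B.
Proof.
move=> a1 mA AB pdf.
have a0 : a != 0 by rewrite -sqrf_eq0 a1 oner_eq0.
have na : `|a| = 1 by apply/eqP; rewrite -sqrp_eq1 // real_normK ?num_real // a1.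
rewrite /normal_prob [LHS]integral_mkcond [RHS]integral_mkcond.
have := @ge0_integral_affine R a b ((fun x => (normal_pdf m 1 x)%:E) \_ A) a0.
rewrite na invr1 mul1e => <-; first last.
- by move=> x; rewrite patchE; case: ifP => // _; rewrite lee_fin normal_pdf_ge0.
- apply/(measurable_restrictT _ _).1 => //.
  by apply/measurable_EFinP; apply: measurable_funTS; exact: measurable_normal_pdf.
apply: eq_integral => u _; rewrite !patchE pdf.
by congr (if _ then _ else _); apply/idP/idP; rewrite !inE => /AB.
Qed.

Lemma normal_prob_gt m v : normal_prob m 1 `]v, +oo[%classic = (gauss_tail (v - m))%:E.
Proof.
rewrite -gauss_tailE; apply: (@normal_prob_affine m 1 m) => //.
- by rewrite expr1n.
- by move=> u /=; rewrite !in_itv /= !andbT mul1r ltrBlDr.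
- by move=> u; rewrite normal_pdf_center mul1r addrK.
Qed.

Lemma normal_prob_lt m v : normal_prob m 1 `]-oo, v[%classic = (gauss_tail (m - v))%:E.
Proof.
rewrite -gauss_tailE; apply: (@normal_prob_affine m (-1) m) => //.
- by rewrite sqrrN expr1n.
- by move=> u /=; rewrite !in_itv /= !andbT mulN1r; split; lra.
- by move=> u; rewrite normal_pdf_center mulN1r addrK normal_pdf_sym.
Qed.

Lemma gauss_tailB x y : x <= y ->
  (\int[mu]_(u in `]x, y]) (normal_pdf 0 1 u)%:E)%E = (gauss_tail x - gauss_tail y)%:E.
Proof.
move=> xy.
have : normal_prob 0 1 (`]x, y]%classic `|` `]y, +oo[%classic) =
   (normal_prob 0 1 `]x, y]%classic + normal_prob 0 1 `]y, +oo[%classic)%E.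
  rewrite measureU //; apply/seteqP; split => u //=; rewrite !in_itv /= andbT.
  by move=> [/andP[_ uy] yu]; have := le_lt_trans uy yu; rewrite ltxx.
rewrite -itv_bndbnd_setU ?bnd_simp // !normal_prob_gt !subr0.
rewrite -/(normal_prob 0 1 `]x, y]%classic) EFinB => ->.
by rewrite addeK.
Qed.

Lemma gauss_tail_ge0 t : 0 <= gauss_tail t.
Proof. exact: fine_ge0. Qed.

Lemma gauss_tail_anti x y : x <= y -> gauss_tail y <= gauss_tail x.
Proof.
move=> xy; rewrite -subr_ge0 -lee_fin -gauss_tailB //.
by apply: integral_ge0 => u _; rewrite lee_fin normal_pdf_ge0.
Qed.

Lemma normal_peak1E : normal_peak (1 : R) = (Num.sqrt (2 * (pi : R)))^-1.
Proof. by rewrite /normal_peak expr1n mul1r mulr_natl. Qed.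

Lemma normal_peak1_le1 : normal_peak (1 : R) <= 1.
Proof.
rewrite normal_peak1E; have := @pihalf_ge1 R; move: (pi : R) => q q1.
rewrite invf_le1 ?sqrtr_gt0; last by lra.
by rewrite -[leLHS]sqrtr1 ler_sqrt; lra.
Qed.

Lemma gauss_tailB_le x y : x <= y -> gauss_tail x - gauss_tail y <= y - x.
Proof.
move=> xy; rewrite -lee_fin -gauss_tailB //.
have -> : ((y - x)%:E = \int[mu]_(u in `]x, y]) (cst 1%:E u))%E.
  rewrite integral_cst //= mul1e lebesgue_measure_itv /= lte_fin.
  by case: ltP => //; rewrite le_eqVlt ltNge xy orbF => /eqP ->; rewrite subrr.
apply: ge0_le_integral => //.
- by move=> u _; rewrite lee_fin normal_pdf_ge0.
- by apply/measurable_EFinP; apply: measurable_funTS; exact: measurable_normal_pdf.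
- move=> u _; rewrite lee_fin (le_trans (normal_pdf_ub _ _ _)) //.
  exact: normal_peak1_le1.
Qed.

Lemma gauss_tail_lipschitz x y : `|gauss_tail x - gauss_tail y| <= `|x - y|.
Proof.
wlog xy : x y / x <= y.
  by move=> H; have [/H//|/ltW/H] := leP x y; rewrite distrC [leRHS]distrC.
rewrite ger0_norm ?subr_ge0 ?gauss_tail_anti // distrC ger0_norm ?subr_ge0 //.
exact: gauss_tailB_le.
Qed.

Lemma gauss_tail0_le : gauss_tail 0 <= 1 / 2.
Proof.
have H : (normal_prob (0 : R) 1 `]0%R, +oo[%classic + normal_prob 0%R 1%R `]-oo, 0%R[%classic <= 1)%E.
  rewrite -measureU //; first by apply: probability_le1; exact: measurableU.
  apply/seteqP; split => u //=; rewrite !in_itv /= andbT => -[a b].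
  by have := lt_trans a b; rewrite ltxx.
by move: H; rewrite normal_prob_gt normal_prob_lt subrr -EFinD lee_fin; lra.
Qed.

(** [17 / 100] is [34 / 100 * 1 / 2]: [pi < 4] puts the peak above [1 / sqrt 8 > 34 / 100], and the
    exponential is at least [1 - x^2 / 2 >= 1 / 2]. *)
Lemma normal_pdf_ge x : 0 <= x <= 1 -> 17 / 100 <= normal_pdf 0 1 x.
Proof.
move=> /andP[x0 x1]; rewrite normal_pdfE // /normal_fun subr0 expr1n.
have pk : 34 / 100 <= normal_peak (1 : R).
  have := @pihalf_lt2 R; have := @pi_gt0 R.
  rewrite normal_peak1E; move: (pi : R) => q q0 q1.
  rewrite -[leLHS]invrK lef_pV2 ?posrE ?sqrtr_gt0 //; last by lra.
  have -> : (34 / 100 : R)^-1 = Num.sqrt ((34 / 100)^-1 ^+ 2).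
    by rewrite sqrtr_sqr ger0_norm //; lra.
  by rewrite ler_sqrt; lra.
have ex : 1 / 2 <= expR (- x ^+ 2 / (1 *+ 2)).
  have x2 : x ^+ 2 <= 1 by rewrite expr_le1.
  by apply: le_trans (expR_ge1Dx _); lra.
by apply: le_trans (ler_pM _ _ pk ex); lra.
Qed.

Lemma gauss_tailB_ge x y : 0 <= x -> x <= y -> y <= 1 ->
  17 / 100 * (y - x) <= gauss_tail x - gauss_tail y.
Proof.
move=> x0 xy y1; rewrite -lee_fin -gauss_tailB //.
have -> : ((17 / 100 * (y - x))%:E = \int[mu]_(u in `]x, y]) (cst (17 / 100)%:E u))%E.
  rewrite integral_cst //= lebesgue_measure_itv /= lte_fin.
  case: ltP; first by rewrite -EFinB -EFinM.
  by rewrite le_eqVlt ltNge xy orbF => /eqP ->; rewrite subrr mulr0 mule0.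
apply: ge0_le_integral => //.
- by move=> u _; rewrite lee_fin; lra.
- by apply/measurable_EFinP; apply: measurable_funTS; exact: measurable_normal_pdf.
- move=> u /=; rewrite in_itv /= => /andP[xu uy]; rewrite lee_fin normal_pdf_ge //.
  by apply/andP; split; lra.
Qed.

Lemma gauss_tail1_le t : 1 <= t -> gauss_tail t <= 33 / 100.
Proof.
move=> t1; have := gauss_tail_anti t1; have := gauss_tail0_le.
by have := @gauss_tailB_ge 0 1; lra.
Qed.

(** Up to 1 the slope [17 / 100] is available; beyond 1 the constant bound [33 / 100] takes over,
    and a line of slope [- 2 / 25] from [1 / 2] is still at [34 / 100] when [t = 2]. *)
Lemma gauss_tail_le t : 0 <= t <= 2 -> gauss_tail t <= 1 / 2 - 2 / 25 * t.
Proof.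
move=> /andP[t0 t2]; have [t1|t1] := leP t 1.
  by have := gauss_tail0_le; have := @gauss_tailB_ge 0 t; lra.
by have := gauss_tail1_le (ltW t1); lra.
Qed.

End Gaussian.

(** * Order statistics and independent counts *)

Section OrderStatistics.
Variable R : realType.
Implicit Types (s : seq R) (v x : R).

Lemma lt_nth_sort s i v : (i < size s)%N ->
  (v < (sort <=%R s)`_i) = (size s - i <= count (fun y => (v < y)%R) s)%N.
Proof.
move=> si; have ss : sorted <=%R (sort <=%R s) by exact: sort_le_sorted.
have cE (a : pred R) : count a (sort <=%R s) = count a s.
  exact/seq.permP/permEl/perm_sort.
apply/idP/idP => [|H].
  apply: contraTT; rewrite -ltnNge -leNgt => H; apply: nth_count_le => //.
  by rewrite count_le_gt cE size_sort ltn_subRL addnC -ltn_subRL.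
apply: nth_count_gt => //.
by rewrite count_le_gt cE size_sort si andbT leq_subCl.
Qed.

Lemma nth_sort_lt s i v : (i < size s)%N ->
  ((sort <=%R s)`_i < v) = (i.+1 <= count (fun y => (y < v)%R) s)%N.
Proof.
move=> si; have ss : sorted <=%R (sort <=%R s) by exact: sort_le_sorted.
have cE (a : pred R) : count a (sort <=%R s) = count a s.
  exact/seq.permP/permEl/perm_sort.
apply/idP/idP => [|H].
  apply: contraTT; rewrite -ltnNge -leNgt ltnS => H; apply: nth_count_ge => //.
  by rewrite cE size_sort H.
by apply: nth_count_lt => //; rewrite cE.
Qed.

End OrderStatistics.

Section Counting.
Context (R : realType) (d : measure_display) (T : measurableType d).
Variables (P : probability T R) (n : nat) (Y : 'I_n -> {RV P >-> R}).
Implicit Types (F E : set T) (A : 'I_n -> set R) (B : seq 'I_n) (D : {set 'I_n}).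

Definition prob E : R := fine (P E).

Lemma probE E : measurable E -> P E = (prob E)%:E.
Proof. by move=> mE; rewrite fineK // fin_num_measure. Qed.

Lemma prob_ge0 E : 0 <= prob E.
Proof. exact: fine_ge0. Qed.

Lemma prob_le1 E : measurable E -> prob E <= 1.
Proof. by move=> mE; rewrite -lee_fin -probE // probability_le1. Qed.

Lemma le_prob E F : measurable E -> measurable F -> E `<=` F -> prob E <= prob F.
Proof.
by move=> mE mF EF; rewrite -lee_fin -!probE //; apply: le_measure => //; rewrite inE.
Qed.

Lemma probU E F : measurable E -> measurable F -> E `&` F = set0 ->
  prob (E `|` F) = prob E + prob F.
Proof.
move=> mE mF EF; apply: EFin_inj; rewrite EFinD -!probE //; last exact: measurableU.
by rewrite measureU.
Qed.

Lemma probC E : measurable E -> prob (~` E) = 1 - prob E.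
Proof.
move=> mE; apply/eqP; rewrite eq_sym subr_eq addrC -probU // ?setICr ?setUv //.
  by rewrite /prob probability_setT.
exact: measurableC.
Qed.

Lemma probU_le E F : measurable E -> measurable F ->
  prob (E `|` F) <= prob E + prob F.
Proof.
move=> mE mF; have mFE : measurable (F `\` E) by exact: measurableD.
have -> : E `|` F = E `|` (F `\` E) by rewrite setUDr setDv setD0.
rewrite probU //; first by rewrite lerD2l le_prob // => w [].
by apply/seteqP; split => // w [? []].
Qed.

(* [F] is independent of the events generated by the [Y i], [i \in D], provided
   these are themselves independent. *)
Definition independent_of F D := forall (J : {set 'I_n}) A, J \subset D ->
  (forall i, measurable (A i)) ->
  prob (F `&` \bigcap_(i in [set i | i \in J]) (Y i @^-1` A i)) =
  prob F * \prod_(i in J) prob (Y i @^-1` A i).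

Definition count_ge A B (r : nat) : set T :=
  [set w | (r <= count (fun i => Y i w \in A i) B)%N].

Lemma measurable_RV_preimage i (A : set R) : measurable A -> measurable (Y i @^-1` A).
Proof. by move=> mA; rewrite -[X in measurable X]setTI; exact: measurable_funP. Qed.

(** Conditioning on the first observation, parallel to the recursion of [poisson_binomial_tail]; the
    truncated [r.-1] is right because [count_ge] at 0 is the whole space. *)
Lemma count_ge_cons A i B r : count_ge A (i :: B) r =
  (Y i @^-1` A i `&` count_ge A B r.-1) `|` (~` (Y i @^-1` A i) `&` count_ge A B r).
Proof.
apply/seteqP; split => w; rewrite /count_ge /=.
  have [/set_mem YA|/negP YA] := boolP (Y i w \in A i).
    by move=> H; left; split => //; lia.
  by move=> H; right; split => // /mem_set.
by move=> [[/mem_set -> H]|[YA H]]; [lia|rewrite memNset].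
Qed.

Lemma count_ge_nil A r : count_ge A [::] r = if r == 0%N then setT else set0.
Proof. by case: r => [|r]; apply/seteqP; split. Qed.

Lemma measurable_count_ge A B r : (forall i, measurable (A i)) ->
  measurable (count_ge A B r).
Proof.
move=> mA; elim: B r => [|i B IH] r; first by rewrite count_ge_nil; case: ifP.
rewrite count_ge_cons; have mY := measurable_RV_preimage i (mA i).
by apply: measurableU; apply: measurableI => //; exact: measurableC.
Qed.

(** Lets an induction absorb observations one by one: [F] accumulates their outcomes while [D]
    shrinks to those not yet seen. *)
Lemma independent_ofI F D i (A : set R) : measurable F -> measurable A -> i \in D ->
  independent_of F D ->
  independent_of (F `&` Y i @^-1` A) (D :\ i) /\
  prob (F `&` Y i @^-1` A) = prob F * prob (Y i @^-1` A).
Proof.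
move=> mF mA iD FD.
have one : prob (F `&` Y i @^-1` A) = prob F * prob (Y i @^-1` A).
  have := FD [set i]%SET (fun=> A); rewrite finset.sub1set iD big_set1 => <- //.
  congr (prob (_ `&` _)); apply/seteqP; split => [w Aw k|w Aw].
    by rewrite /= inE => /eqP ->.
  by apply: (Aw i); rewrite /= inE.
split=> // J A' JD mA'.
have iJ : i \notin J by apply: contraTN JD => iJ; apply/negP => /fintype.subsetP/(_ _ iJ); rewrite !inE eqxx.
have := FD (i |: J)%SET (fun k => if k == i then A else A' k).
rewrite big_setU1 //= eqxx => H.
rewrite one -mulrA (_ : \prod_(k in J) prob (Y k @^-1` A' k) =
   \prod_(k in J) prob (Y k @^-1` (if k == i then A else A' k))); last first.
  by apply: eq_bigr => k kJ; case: eqP => // ki; rewrite -ki kJ in iJ.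
rewrite -H; first last.
- by move=> k; case: ifP.
- by rewrite finset.subUset finset.sub1set iD (fintype.subset_trans JD) // finset.subsetDl.
congr prob; rewrite -setIA; congr (_ `&` _); apply/seteqP; split => [w [Aw Jw] k|w H'].
  rewrite /= !inE => /predU1P[->|kJ]; first by rewrite eqxx.
  by case: eqP => // [->//|_]; exact: Jw.
split; first by have := H' i; rewrite /= !inE eqxx; apply.
move=> k /= kJ; have := H' k; rewrite /= !inE kJ orbT => /(_ isT).
by case: eqP => // ki; rewrite -ki kJ in iJ.
Qed.

Lemma independent_ofIC F D i (A : set R) : measurable F -> measurable A -> i \in D ->
  independent_of F D ->
  independent_of (F `&` ~` (Y i @^-1` A)) (D :\ i) /\
  prob (F `&` ~` (Y i @^-1` A)) = prob F * (1 - prob (Y i @^-1` A)).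
Proof.
move=> mF mA iD FD.
have [] := independent_ofI mF (measurableC mA) iD FD.
by rewrite -preimage_setC => + ->; rewrite probC //; exact: measurable_RV_preimage.
Qed.

(** A general [F] is what the induction on [B] needs; it also allows [F] to be a count over another
    bin, which yields independence across bins. *)
Lemma prob_count_ge F D A B r : measurable F -> (forall i, measurable (A i)) ->
  independent_of F D -> uniq B -> {subset B <= D} ->
  prob (F `&` count_ge A B r) =
  prob F * poisson_binomial_tail r [seq prob (Y i @^-1` A i) | i <- B].
Proof.
move=> + mA; elim: B F D r => [|i B IH] F D r mF FD /=.
  by case: r => [|r] _ _; rewrite count_ge_nil /= ?setIT ?mulr1 // setI0 mulr0 /prob measure0.
move=> /andP[iB uB] BD.
have iD : i \in D by apply: BD; rewrite mem_head.
have BD' : {subset B <= D :\ i}.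
  move=> k kB; rewrite !inE BD ?inE ?kB ?orbT // andbT.
  by apply: contraNneq iB => <-.
have [F1 E1] := independent_ofI mF (mA i) iD FD.
have [F2 E2] := independent_ofIC mF (mA i) iD FD.
have mY := measurable_RV_preimage i (mA i).
have mF1 : measurable (F `&` Y i @^-1` A i) by exact: measurableI.
have mF2 : measurable (F `&` ~` (Y i @^-1` A i)).
  by apply: measurableI => //; exact: measurableC.
rewrite count_ge_cons setIUr !setIA probU.
- by rewrite (IH _ _ _ mF1 F1) // (IH _ _ _ mF2 F2) // E1 E2 -!mulrA -mulrDr.
- by apply: measurableI => //; exact: measurable_count_ge.
- by apply: measurableI => //; exact: measurable_count_ge.
- by apply/seteqP; split => // w [[[_ a] _] [[_ b] _]].
Qed.

(** Disjointness is essential: independence is not inherited by arbitrary unions. *)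
Lemma independent_ofU F F' D : measurable F -> measurable F' -> F `&` F' = set0 ->
  independent_of F D -> independent_of F' D -> independent_of (F `|` F') D.
Proof.
move=> mF mF' FF' FD FD' J A JD mA.
have mJ : measurable (\bigcap_(i in [set i | i \in J]) (Y i @^-1` A i)).
  by apply: fin_bigcap_measurable => // i _; exact: measurable_RV_preimage.
rewrite setIUl !probU // ?FD ?FD' ?mulrDl //; try exact: measurableI.
by rewrite setIACA FF' set0I.
Qed.

Lemma independent_of_count_ge F D A B r : measurable F ->
  (forall i, measurable (A i)) -> independent_of F D -> uniq B -> {subset B <= D} ->
  independent_of (F `&` count_ge A B r) (D :\: [set i in B]%SET).
Proof.
move=> + mA; elim: B F D r => [|i B IH] F D r mF FD /=.
  move=> _ _; have -> : D :\: [set i in [::]]%SET = D.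
    by apply/setP => i; rewrite !inE.
  rewrite count_ge_nil; case: ifP => _; first by rewrite setIT.
  by move=> J A' _ _; rewrite setI0 set0I /prob measure0 mul0r.
move=> /andP[iB uB] BD.
have iD : i \in D by apply: BD; rewrite mem_head.
have BD' : {subset B <= D :\ i}.
  move=> k kB; rewrite !inE BD ?inE ?kB ?orbT // andbT.
  by apply: contraNneq iB => <-.
have [F1 _] := independent_ofI mF (mA i) iD FD.
have [F2 _] := independent_ofIC mF (mA i) iD FD.
have mY := measurable_RV_preimage i (mA i).
have mF1 : measurable (F `&` Y i @^-1` A i) by exact: measurableI.
have mF2 : measurable (F `&` ~` (Y i @^-1` A i)).
  by apply: measurableI => //; exact: measurableC.
have -> : D :\: [set k in i :: B]%SET = D :\ i :\: [set k in B]%SET.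
  by apply/setP => k; rewrite !inE negb_or andbA [_ && (k != i)]andbC.
rewrite count_ge_cons setIUr !setIA; apply: independent_ofU.
- by apply: measurableI => //; exact: measurable_count_ge.
- by apply: measurableI => //; exact: measurable_count_ge.
- by apply/seteqP; split => // w [[[_ a] _] [[_ b] _]].
- exact: IH.
- exact: IH.
Qed.

Hypothesis indY : mutually_independent Y.

Let independent_ofT D : independent_of setT D.
Proof.
move=> J A _ mA; rewrite setTI /prob probability_setT mul1r indY //.
rewrite (eq_bigr (fun i => (prob (Y i @^-1` A i))%:E)) ?prodEFin // => i _.
by rewrite probE //; exact: measurable_RV_preimage.
Qed.

Lemma prob_count_geE A B r : (forall i, measurable (A i)) -> uniq B ->
  prob (count_ge A B r) =
  poisson_binomial_tail r [seq prob (Y i @^-1` A i) | i <- B].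
Proof.
move=> mA uB; rewrite -[count_ge _ _ _]setTI.
rewrite (@prob_count_ge _ [set: 'I_n]) //.
- by rewrite /prob probability_setT mul1r.
- by move=> i _; rewrite inE.
Qed.

Lemma prob_count_geI A A' B B' r r' :
  (forall i, measurable (A i)) -> (forall i, measurable (A' i)) ->
  uniq B -> uniq B' -> (forall i, i \in B -> i \notin B') ->
  prob (count_ge A B r `&` count_ge A' B' r') =
  prob (count_ge A B r) * prob (count_ge A' B' r').
Proof.
move=> mA mA' uB uB' BB'.
have mB := measurable_count_ge B r mA.
have := @independent_of_count_ge setT [set: 'I_n] A B r measurableT mA (@independent_ofT _) uB.
rewrite setTI => /(_ (fun i _ => finset.in_setT i)) H.
rewrite (prob_count_ge _ mB mA' H uB') -?prob_count_geE // => i iB'.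
by rewrite !inE andbT; apply: contraTN iB' => /BB'.
Qed.

End Counting.

(** * Random elements with finitely many values *)

Section FiniteLaw.
Context (R : realType) (d : measure_display) (T : measurableType d).
Variables (P : probability T R) (F : finType) (X : T -> F).
Hypothesis mX : forall x, measurable (X @^-1` [set x]).
Implicit Types (g h : F -> R).

(** The expectation of [g (X w)] as a finite sum over values, which avoids all questions of
    integrability. *)
Definition law_mean g : R := \sum_(x : F) prob P (X @^-1` [set x]) * g x.

Lemma prob_law_seq (s : seq F) : uniq s ->
  measurable [set w | X w \in s] /\
  prob P [set w | X w \in s] = \sum_(x <- s) prob P (X @^-1` [set x]).
Proof.
elim: s => [_|x s IH /= /andP[xs us]].
  rewrite big_nil (_ : [set w | X w \in [::]] = set0); last by apply/seteqP; split.
  by rewrite /prob measure0.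
have [ms sE] := IH us.
have -> : [set w | X w \in x :: s] = X @^-1` [set x] `|` [set w | X w \in s].
  apply/seteqP; split => w /=; rewrite inE; first by move=> /predU1P[]; [left|right].
  by move=> [->|->]; rewrite ?eqxx ?orbT.
split; first exact: measurableU.
rewrite big_cons -sE probU //; apply/seteqP; split => // w [/= -> xs'].
by rewrite xs' in xs.
Qed.

Lemma prob_law (Q : pred F) :
  measurable [set w | Q (X w)] /\
  prob P [set w | Q (X w)] = law_mean (fun x => (Q x)%:R).
Proof.
have [mQ QE] := prob_law_seq (enum_uniq Q).
have E : [set w | X w \in enum Q] = [set w | Q (X w)].
  by apply/seteqP; split => w /=; rewrite mem_enum.
rewrite E in mQ QE; split => //.
rewrite QE big_enum /law_mean [RHS](bigID Q) /= [X in _ + X]big1 ?addr0.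
  by apply: eq_big => // x Qx; rewrite [Q x]Qx mulr1.
by move=> x /negbTE ->; rewrite mulr0.
Qed.

Lemma law_mean_cst c : law_mean (fun=> c) = c.
Proof.
rewrite /law_mean -mulr_suml.
have [_] := prob_law predT; rewrite /law_mean /=.
under [in X in _ = X -> _]eq_bigr do rewrite mulr1.
move=> <-; rewrite (_ : [set _ | _] = setT) ?mul1r; last by apply/seteqP; split.
by rewrite /prob probability_setT mul1r.
Qed.

Lemma law_meanD g h : law_mean (fun x => g x + h x) = law_mean g + law_mean h.
Proof. by rewrite /law_mean -big_split; apply: eq_bigr => x _; rewrite mulrDr. Qed.

Lemma law_meanZ c g : law_mean (fun x => c * g x) = c * law_mean g.
Proof. by rewrite /law_mean mulr_sumr; apply: eq_bigr => x _; rewrite mulrCA. Qed.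

Lemma law_mean_sum (I : finType) (g : I -> F -> R) :
  law_mean (fun x => \sum_i g i x) = \sum_i law_mean (g i).
Proof. by rewrite /law_mean exchange_big; apply: eq_bigr => x _; rewrite mulr_sumr. Qed.

Lemma le_law_mean g h : (forall x, g x <= h x) -> law_mean g <= law_mean h.
Proof. by move=> gh; apply: ler_sum => x _; rewrite ler_wpM2l // prob_ge0. Qed.

Lemma eq_law_mean g h : g =1 h -> law_mean g = law_mean h.
Proof. by move=> gh; apply: eq_bigr => x _; rewrite gh. Qed.

Lemma law_markov g a : (forall x, 0 <= g x) -> 0 < a ->
  prob P [set w | a < g (X w)] <= law_mean g / a.
Proof.
move=> g0 a0; have [_ ->] := prob_law (fun x => a < g x).
rewrite ler_pdivlMr // mulrC -law_meanZ; apply: le_law_mean => x.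
by case: ltP => [/ltW|_]; rewrite ?mulr1 ?mulr0.
Qed.

(** The cross terms of the centred variables vanish, and each variance is at most the second
    moment. *)
Lemma law_variance_sum (I : finType) (D : I -> F -> R) (w : I -> R) :
  (forall i j, i != j ->
     law_mean (fun x => D i x * D j x) = law_mean (D i) * law_mean (D j)) ->
  law_mean (fun x => (\sum_i w i * (D i x - law_mean (D i))) ^+ 2) <=
  \sum_i w i ^+ 2 * law_mean (fun x => D i x ^+ 2).
Proof.
move=> uncorr; pose e i := law_mean (D i).
pose Z i x := D i x - e i.
have cross i j : law_mean (fun x => Z i x * Z j x) =
    law_mean (fun x => D i x * D j x) - e i * e j.
  transitivity (law_mean (fun x => D i x * D j x + ((- e j) * D i x + ((- e i) * D j x + e i * e j)))).
    by apply: eq_law_mean => x; rewrite /Z; ring.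
  by rewrite !law_meanD !law_meanZ law_mean_cst -/(e i) -/(e j); ring.
have -> : law_mean (fun x => (\sum_i w i * (D i x - law_mean (D i))) ^+ 2) =
    \sum_i \sum_j w i * w j * law_mean (fun x => Z i x * Z j x).
  transitivity (law_mean (fun x => \sum_i \sum_j w i * w j * (Z i x * Z j x))).
    apply: eq_law_mean => x; rewrite expr2 big_distrlr /=.
    by apply: eq_bigr => i _; apply: eq_bigr => j _; rewrite /Z /e; ring.
  rewrite law_mean_sum; apply: eq_bigr => i _; rewrite law_mean_sum.
  by apply: eq_bigr => j _; rewrite law_meanZ.
apply: ler_sum => i _; rewrite (bigD1 i) //= big1 ?addr0 => [|j ji].
  rewrite cross -expr2 ler_wpM2l ?sqr_ge0 //.
  by rewrite (eq_law_mean (fun x => esym (expr2 (D i x)))) gerBl -expr2 sqr_ge0.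
by rewrite cross uncorr 1?eq_sym // subrr mulr0.
Qed.

End FiniteLaw.

Section Pattern.
Context (R : realType) (d : measure_display) (T : measurableType d).
Variables (P : probability T R) (I : finType) (E : I -> set T).
Hypothesis mE : forall i, measurable (E i).

(** The joint vector of indicators takes values in a finite type, so every quantity built from the
    events has a finite law. *)
Definition pattern (w : T) : {ffun I -> bool} := [ffun i => w \in E i].

Lemma measurable_pattern x : measurable (pattern @^-1` [set x]).
Proof.
rewrite (_ : _ @^-1` _ = \bigcap_(i in setT) (if x i then E i else ~` E i)).
  apply: fin_bigcap_measurable => [|i _]; first exact: finite_finset.
  by case: (x i) => //; exact: measurableC.
apply/seteqP; split => w /=.
  by move=> <- i _; rewrite ffunE; case: ifP => [/set_mem//|/negbT]; rewrite notin_setE.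
move=> H; apply/ffunP => i; rewrite ffunE; have := H i Logic.I.
by case: (x i) => H'; [exact: mem_set|exact: memNset].
Qed.

Lemma pattern_mean1 i : law_mean P pattern (fun x => (x i)%:R) = prob P (E i).
Proof.
have [_ <-] := prob_law P measurable_pattern (fun x : {ffun I -> bool} => x i).
by congr prob; apply/seteqP; split => w /=; rewrite ffunE ?inE.
Qed.

Lemma pattern_mean2 i j :
  law_mean P pattern (fun x => (x i)%:R * (x j)%:R) = prob P (E i `&` E j).
Proof.
transitivity (law_mean P pattern (fun x => (x i && x j)%:R)).
  by apply: eq_law_mean => x; rewrite -mulnb natrM.
have [_ <-] := prob_law P measurable_pattern (fun x : {ffun I -> bool} => x i && x j).
congr prob; apply/seteqP; split => w /=; rewrite !ffunE.
  by move=> /andP[/set_mem Ei /set_mem Ej].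
by move=> [/mem_set -> /mem_set ->].
Qed.

(* The probability of an intersection is at most the geometric mean of the two
   probabilities. *)
Lemma pattern_second_moment (c : I -> R) (u : I -> R) :
  (forall i, 0 <= u i) -> (forall i, prob P (E i) <= u i ^+ 2) ->
  law_mean P pattern (fun x => (\sum_i c i * (x i)%:R) ^+ 2) <=
  (\sum_i `|c i| * u i) ^+ 2.
Proof.
move=> u0 Eu.
apply: (le_trans (y := \sum_i \sum_j `|c i| * `|c j| *
    law_mean P pattern (fun x => (x i)%:R * (x j)%:R))).
  apply: (le_trans (y := law_mean P pattern
     (fun x => \sum_i \sum_j `|c i| * `|c j| * ((x i)%:R * (x j)%:R)))).
    apply: le_law_mean => x; rewrite expr2 big_distrlr /=.
    apply: ler_sum => i _; apply: ler_sum => j _.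
    by rewrite mulrACA ler_wpM2r ?mulr_ge0 // -normrM ler_norm.
  rewrite law_mean_sum; apply: ler_sum => i _; rewrite law_mean_sum.
  by apply: ler_sum => j _; rewrite law_meanZ.
rewrite expr2 big_distrlr /=; apply: ler_sum => i _; apply: ler_sum => j _.
rewrite [leRHS]mulrACA ler_wpM2l ?mulr_ge0 // pattern_mean2.
have mEE : measurable (E i `&` E j) by exact: measurableI.
have ij_i : prob P (E i `&` E j) <= u i ^+ 2.
  by apply: le_trans (Eu i); apply: le_prob => //; exact: subIsetl.
have ij_j : prob P (E i `&` E j) <= u j ^+ 2.
  by apply: le_trans (Eu j); apply: le_prob => //; exact: subIsetr.
have p0 := prob_ge0 P (E i `&` E j).
rewrite -(@ler_pXn2r _ 2) // ?nnegrE ?mulr_ge0 // exprMn expr2.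
exact: ler_pM.
Qed.

Lemma prob_bigcup_le (c : R) : (forall i, prob P (E i) <= c) ->
  measurable (\bigcup_(i in setT) E i) /\ prob P (\bigcup_(i in setT) E i) <= #|I|%:R * c.
Proof.
move=> Ec.
have -> : \bigcup_(i in setT) E i = [set w | [exists i, pattern w i]].
  apply/seteqP; split => w.
    by move=> [i _ Ei]; apply/existsP; exists i; rewrite ffunE; exact: mem_set.
  by move=> /existsP[i]; rewrite ffunE => /set_mem Ei; exists i.
have [mU ->] := prob_law P measurable_pattern (fun x => [exists i, x i]).
split => //; apply: (le_trans (y := law_mean P pattern (fun x => \sum_i (x i)%:R))).
  apply: le_law_mean => x; case: existsP => [[i xi]|_]; last exact: sumr_ge0.
  by rewrite (bigD1 i) //= xi lerDl sumr_ge0.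
rewrite law_mean_sum mulr_natl -sumr_const; apply: ler_sum => i _.
by rewrite pattern_mean1.
Qed.

End Pattern.

(** * Sums over the rounding grid *)

Section GridSums.
Variable R : realType.
Implicit Types (eta y b : R).

(** For [eta > 0], [g] is the positive part of [y] rounded up to a multiple of [eta] and capped at
    [N * eta]. *)
Lemma grid_count eta y N : 0 <= eta ->
  let g := eta * \sum_(k < N) (k%:R * eta < y)%R%:R in
  [/\ Num.min y (N%:R * eta) <= g, 0 <= g, g <= N%:R * eta & y <= 0 -> g = 0]
  /\ (0 <= y -> g <= y + eta).
Proof.
move=> eta0 /=; elim: N => [|N [[IH1 IH2 IH3 IH4] IH5]].
  rewrite big_ord0 mulr0 mul0r; split; first by split => //; rewrite ge_min lexx orbT.
  by move=> y0; rewrite addr_ge0.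
rewrite big_ord_recr /= mulrDr.
set g := eta * \sum_(k < N) _ in IH1 IH2 IH3 IH4 IH5 *.
have NE : N.+1%:R * eta = N%:R * eta + eta by rewrite -natr1 mulrDl mul1r.
rewrite !NE; case: (ltP (N%:R * eta) y) => Ny; rewrite ?mulr1 ?mulr0 ?addr0.
  have gN : g = N%:R * eta.
    by apply/eqP; rewrite eq_le IH3 /=; rewrite (min_idPr (ltW Ny)) in IH1.
  rewrite gN; split; last by move=> _; rewrite lerD2r ltW.
  split.
  - by rewrite ge_min lexx orbT.
  - by rewrite -gN addr_ge0.
  - by [].
  - by move=> y0; have := lt_le_trans Ny y0; rewrite ltNge mulr_ge0.
split => //; split => //.
- by rewrite ge_min; rewrite (min_idPl Ny) in IH1; rewrite IH1.
- by apply: le_trans IH3 _; rewrite lerDl.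
Qed.

(* [exp (- x^2) <= 1 / (1 + x^2)] is dominated by a telescoping difference. *)
Lemma grid_gauss_sum eta b N : 0 <= eta -> 0 < b ->
  eta * \sum_(k < N) expR (- (b * (k%:R * eta)) ^+ 2) <= eta + 2 / b.
Proof.
move=> eta0 b0.
have step (k : nat) : eta * expR (- (b * (k.+1%:R * eta)) ^+ 2) <=
    2 / b * ((1 + b * (k%:R * eta))^-1 - (1 + b * (k.+1%:R * eta))^-1).
  set x := b * (k%:R * eta); have x0 : 0 <= x by rewrite !mulr_ge0 // ltW.
  have -> : b * (k.+1%:R * eta) = x + b * eta by rewrite -natr1 /x; ring.
  set e := b * eta; have e0 : 0 <= e by rewrite mulr_ge0 // ltW.
  have E1 : expR (- (x + e) ^+ 2) <= (1 + (x + e) ^+ 2)^-1.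
    rewrite expRN lef_pV2 ?posrE ?expR_gt0 ?expR_ge1Dx //.
    by rewrite ltr_pwDl // sqr_ge0.
  (* With [z = x + e] this is [(1 + x) (1 + z) <= (1 + z)^2 <= 2 (1 + z^2)]. *)
  have E2 : (1 + (x + e) ^+ 2)^-1 <= 2 * ((1 + x)^-1 * (1 + (x + e))^-1).
    rewrite -invfM -ler_pdivrMl // -invfM lef_pV2 ?posrE ?mulr_gt0 //; try by lra.
    2: by rewrite ltr_pwDl // sqr_ge0.
    have := sqr_ge0 (1 - (x + e)); have : 0 <= e * (1 + (x + e)) by rewrite mulr_ge0 //; lra.
    by rewrite !expr2; lra.
  have -> : (1 + x)^-1 - (1 + (x + e))^-1 = e * ((1 + x)^-1 * (1 + (x + e))^-1).
    by field; apply/andP; split; apply: lt0r_neq0; lra.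
  apply: (le_trans (y := eta * (2 * ((1 + x)^-1 * (1 + (x + e))^-1)))).
    by rewrite ler_wpM2l // (le_trans E1).
  rewrite le_eqVlt; apply/orP; left; apply/eqP; rewrite /e; field.
  by rewrite -/e; apply/and3P; split; apply: lt0r_neq0 => //; lra.
(* The bound that passes through the induction keeps the remainder of the telescoping sum; the term
   [k = 0] accounts for the isolated [eta]. *)
suff H : eta * \sum_(k < N.+1) expR (- (b * (k%:R * eta)) ^+ 2) <=
    eta + 2 / b * (1 - (1 + b * (N%:R * eta))^-1).
  have : 2 / b * (1 - (1 + b * (N%:R * eta))^-1) <= 2 / b.
    by rewrite ler_piMr ?divr_ge0 ?(ltW b0) // gerBl invr_ge0 addr_ge0 // !mulr_ge0 // ltW.
  rewrite big_ord_recr /= mulrDr in H.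
  by have := mulr_ge0 eta0 (expR_ge0 (- (b * (N%:R * eta)) ^+ 2)); lra.
elim: N => [|N IH].
  by rewrite big_ord1 !mul0r mulr0 expr0n oppr0 expR0 mulr1 addr0 invr1 subrr mulr0 addr0.
rewrite big_ord_recr /= mulrDr.
by have := step N; lra.
Qed.

End GridSums.

(** * Bin medians under contamination *)

Section MedianTail.
Variable R : realType.
Implicit Types (t rho eta : R) (s N r : nat).

(* Rank, counted from 0, of the two order statistics averaged by [median]. *)
Definition middle_rank (s : nat) (b : bool) : nat := if b then (s.-1)./2 else uphalf s.-1.

Lemma middle_rankP s b :
  (middle_rank s b == (s.-1)./2) || (middle_rank s b == uphalf s.-1).
Proof. by case: b; rewrite /= eqxx ?orbT. Qed.

Lemma middle_rank_ge s b : (0 < s)%N -> (s <= (middle_rank s b).+1.*2)%N.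
Proof. by case: s b => // s [] _ /=; have := odd_double_half s; lia. Qed.

Section OneBin.
Variables (I : eqType) (B : seq I) (s : nat) (t rho : R).
Hypotheses (sB : size B = s) (s3 : (3 <= s)%N) (rho0 : 0 <= rho).
Hypotheses (t0 : 0 <= t) (t1 : t <= 1 + rho).

Definition near_gauss (p : I -> R) :=
  forall i, i \in B -> 0 <= p i <= 1 /\ `|p i - gauss_tail t| <= rho.

Let q : R := gauss_tail t + rho.

(** From [25 * rho <= t <= 1 + rho] the level is at most 25/24, within the range of [gauss_tail_le].
    Of the drop [2 / 25 * t] below [1 / 2], at most half is consumed by [rho]; this fixes the
    constant 25. *)
Let q_bounds : 25 * rho <= t -> 0 <= q /\ q <= 1 / 2 - t / 25.
Proof.
have t_ge0 := t0; have t_le := t1; have rho_ge0 := rho0.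
move=> rt; rewrite /q; split; first by rewrite addr_ge0 // gauss_tail_ge0.
have : gauss_tail t <= 1 / 2 - 2 / 25 * t.
  by apply: gauss_tail_le; apply/andP; split; lra.
by lra.
Qed.

Let expo : 25 * rho <= t ->
  (Num.sqrt s%:R / 25 * t) ^+ 2 <= (1 - 2 * q) ^+ 2 * s%:R / 4.
Proof.
have t_ge0 := t0; move=> rt; have [q0 q1] := q_bounds rt.
rewrite !exprMn exprVn sqr_sqrtr // mulrAC -mulrA [leRHS]mulrAC [leRHS]mulrC.
rewrite ler_wpM2l // -expr_div_n.
have -> : (1 - 2 * q) ^+ 2 / 4 = ((1 - 2 * q) / 2) ^+ 2 by field.
by rewrite ler_pXn2r // ?nnegrE; lra.
Qed.

(** Stated as a square because [pattern_second_moment] takes square roots of probabilities. Below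
    [25 * rho] the indicator makes the bound trivial. *)
Lemma median_tail_bound p b : near_gauss p ->
  poisson_binomial_tail (middle_rank s b).+1 (map p B) <=
  ((t < 25 * rho)%R%:R + expR (- (Num.sqrt s%:R / 25 * t) ^+ 2)) ^+ 2.
Proof.
have t_ge0 := t0; move=> pg; case: ltP => [_|rt].
  have p01 x : x \in map p B -> 0 <= x <= 1 by move=> /mapP[i /pg[H _] ->].
  have [_ _ H] := poisson_binomial_tail_anti (middle_rank s b).+1 p01.
  apply: le_trans H _; rewrite -[leLHS](expr1n _ 2) ler_pXn2r ?nnegrE ?addr_ge0 ?expR_ge0 //.
  by rewrite lerDl expR_ge0.
have [q0 q1] := q_bounds rt; rewrite add0r.
have H : poisson_binomial_tail (middle_rank s b).+1 (map p B) <=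
    (binomial_tail R (size B) (middle_rank s b).+1).[q].
  apply: poisson_binomial_tail_le; last by lra.
  by move=> i /pg[/andP[-> _]]; rewrite /q /= ler_norml => /andP[_]; lra.
apply: le_trans H _; rewrite sB.
apply: le_trans (binomial_tail_tail _ _ q0 _) _; [lia|apply: middle_rank_ge; lia|lra|].
by rewrite -expRM_natr ler_expR mulNr; have := expo rt; lra.
Qed.

(** Both families of success probabilities lie in the window from [l] to [q], of length at most
    [2 * rho]. Both tails are thus squeezed between the same two binomial tails, and
    [binomial_tail_lipschitz] bounds the gap. *)
Lemma median_tail_dist p p' b : near_gauss p -> near_gauss p' ->
  `|poisson_binomial_tail (middle_rank s b).+1 (map p B) -
    poisson_binomial_tail (middle_rank s b).+1 (map p' B)| <=
  (t < 25 * rho)%R%:R +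
  4 * rho * Num.sqrt s%:R * expR (- (Num.sqrt s%:R / 25 * t) ^+ 2).
Proof.
have t_ge0 := t0; have rho_ge0 := rho0.
have e0 := expR_ge0 (- (Num.sqrt s%:R / 25 * t) ^+ 2).
have rs : 0 <= 4 * rho * Num.sqrt s%:R by rewrite !mulr_ge0 // sqrtr_ge0.
move=> pg pg'; case: ltP => [_|rt].
  have p01 g : near_gauss g -> forall x, x \in map g B -> 0 <= x <= 1.
    by move=> gg x /mapP[i /gg[H _] ->].
  have [_ a1 a2] := poisson_binomial_tail_anti (middle_rank s b).+1 (p01 _ pg).
  have [_ a3 a4] := poisson_binomial_tail_anti (middle_rank s b).+1 (p01 _ pg').
  have := mulr_ge0 rs e0.
  by rewrite ler_norml /=; move=> ?; apply/andP; split; lra.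
have [q0 q1] := q_bounds rt; rewrite add0r.
pose l := Num.max 0 (gauss_tail t - rho).
have l0 : 0 <= l by rewrite le_max lexx.
have lq : l <= q by rewrite /l ge_max q0 /q; lra.
have ql : q - l <= 2 * rho.
  have : gauss_tail t - rho <= l by rewrite le_max lexx orbT.
  by rewrite /q; lra.
have sandwich g : near_gauss g ->
    (binomial_tail R s (middle_rank s b).+1).[l] <=
    poisson_binomial_tail (middle_rank s b).+1 (map g B) <=
    (binomial_tail R s (middle_rank s b).+1).[q].
  move=> gg; rewrite -sB; apply/andP; split.
    apply: poisson_binomial_tail_ge => // i /gg[/andP[g0 ->]].
    by rewrite ler_norml andbT => /andP[H _]; rewrite /l ge_max g0 /=; lra.
  apply: poisson_binomial_tail_le; last by lra.
  by move=> i /gg[/andP[-> _]]; rewrite /q /= ler_norml => /andP[_]; lra.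
have /andP[a1 a2] := sandwich _ pg; have /andP[a3 a4] := sandwich _ pg'.
have q12 : q <= 1 / 2 by lra.
have H := binomial_tail_lipschitz s3 (middle_rankP s b) l0 lq q12.
have H2 : (q - l) * (2 * Num.sqrt s%:R * expR (- (1 - 2 * q) ^+ 2 * s%:R / 4)) <=
   4 * rho * Num.sqrt s%:R * expR (- (Num.sqrt s%:R / 25 * t) ^+ 2).
  have -> : 4 * rho * Num.sqrt s%:R * expR (- (Num.sqrt s%:R / 25 * t) ^+ 2) =
    (2 * rho) * (2 * Num.sqrt s%:R * expR (- (Num.sqrt s%:R / 25 * t) ^+ 2)) by ring.
  apply: ler_pM => //; first by lra.
  rewrite ler_wpM2l ?mulr_ge0 ?sqrtr_ge0 // ler_expR !mulNr lerN2.
  exact: expo.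
by rewrite ler_norml; apply/andP; split; lra.
Qed.

End OneBin.

(** The indicators overshoot [25 * rho] by at most one mesh; the Gaussian part has
    [b = sqrt s / 25], whence [2 / b = 50 / sqrt s]. *)
Lemma grid_tail_sum rho eta s N : (0 < s)%N -> 0 <= rho -> 0 <= eta ->
  eta * \sum_(k < N) ((k%:R * eta < 25 * rho)%R%:R +
     expR (- (Num.sqrt s%:R / 25 * (k%:R * eta)) ^+ 2)) <=
  25 * rho + 2 * eta + 50 / Num.sqrt s%:R.
Proof.
move=> s0 rho0 eta0; rewrite big_split mulrDr.
have [_ /(_ _)H1] := @grid_count R eta (25 * rho) N eta0.
have {}H1 := H1 (mulr_ge0 (ler0n _ _) rho0).
have b0 : 0 < Num.sqrt s%:R / 25 :> R by rewrite divr_gt0 // sqrtr_gt0 ltr0n.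
have H2 := grid_gauss_sum N eta0 b0.
have E : 2 / (Num.sqrt s%:R / 25) = 50 / Num.sqrt s%:R :> R.
  by field; rewrite gt_eqF // sqrtr_gt0 ltr0n.
by rewrite E in H2; move: H1 H2; rewrite /=; lra.
Qed.

(** The factor [sqrt s] is cancelled by the width [50 / sqrt s] of the Gaussian sum, which removes
    [1 / sqrt s] from the mean. The number 51 adds [eta * sqrt s <= 1], and [229 = 25 + 4 * 51]. *)
Lemma grid_dist_sum rho eta s N : (0 < s)%N -> 0 <= rho -> 0 <= eta ->
  eta * Num.sqrt s%:R <= 1 ->
  eta * \sum_(k < N) ((k%:R * eta < 25 * rho)%R%:R +
     4 * rho * Num.sqrt s%:R * expR (- (Num.sqrt s%:R / 25 * (k%:R * eta)) ^+ 2)) <=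
  229 * rho + eta.
Proof.
move=> s0 rho0 eta0 es; rewrite big_split mulrDr -mulr_sumr.
have [_ /(_ _)H1] := @grid_count R eta (25 * rho) N eta0.
have {}H1 := H1 (mulr_ge0 (ler0n _ _) rho0).
have S0 : 0 < Num.sqrt s%:R :> R by rewrite sqrtr_gt0 ltr0n.
have b0 : 0 < Num.sqrt s%:R / 25 :> R by rewrite divr_gt0.
have H2 := grid_gauss_sum N eta0 b0.
set G := \sum_(k < N) expR _ in H2 *.
have H3 : 4 * rho * Num.sqrt s%:R * (eta * G) <= 4 * rho * 51.
  rewrite -[leLHS]mulrA ler_wpM2l ?mulr_ge0 //.
  apply: (le_trans (y := Num.sqrt s%:R * (eta + 2 / (Num.sqrt s%:R / 25)))).
    by rewrite ler_wpM2l // ltW.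
  have -> : Num.sqrt s%:R * (eta + 2 / (Num.sqrt s%:R / 25)) = eta * Num.sqrt s%:R + 50 :> R.
    by field; rewrite gt_eqF.
  by lra.
by rewrite mulrCA; move: H1 H3; rewrite /=; lra.
Qed.

End MedianTail.

Section Huber.
Context (R : realType) (d : measure_display) (T : measurableType d).
Variables (P : probability T R) (n : nat) (Y : 'I_n -> {RV P >-> R}).
Variables (eps : R) (f : R -> R) (Q : 'I_n -> probability R R).
Hypotheses (eps0 : 0 <= eps) (eps14 : eps <= 1 / 4).
Hypothesis hub : huber_model eps f Q Y.

Definition side (mu t : R) (b : bool) : set R :=
  if b then `]mu + t, +oo[%classic else `]-oo, mu - t[%classic.

Lemma measurable_side mu t b : measurable (side mu t b).
Proof. by case: b; exact: measurable_itv. Qed.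

Let prob_side i mu t b : exists2 v, 0 <= v <= 1 &
  prob P (Y i @^-1` side mu t b) =
  (1 - eps) * gauss_tail (t + (if b then mu - f (design R i) else f (design R i) - mu))
  + eps * v.
Proof.
have [_ H] := hub; have mS := measurable_side mu t b.
exists (fine (Q i (side mu t b))).
  rewrite fine_ge0 //= -lee_fin fineK ?probability_le1 //.
  by rewrite fin_num_measure.
apply: EFin_inj; rewrite -probE; last exact: measurable_RV_preimage.
rewrite -[P _]/(distribution P (Y i) (side mu t b)) H //.
have QE : Q i (side mu t b) = (fine (Q i (side mu t b)))%:E.
  by rewrite fineK // fin_num_measure.
rewrite {1}QE; move: (fine _) => v.
have -> : normal_prob (f (design R i)) 1 (side mu t b) =
    (gauss_tail (t + (if b then mu - f (design R i) else f (design R i) - mu)))%:E.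
  case: b {mS QE} => /=.
    by rewrite normal_prob_gt; congr (gauss_tail _)%:E; ring.
  by rewrite normal_prob_lt; congr (gauss_tail _)%:E; ring.
by rewrite -!EFinM -EFinD.
Qed.

(** By Gaussian symmetry both sides have tail [gauss_tail t] up to a shift of at most [delta] and a
    contamination of at most [eps]. The two sides are compared only through this common value. *)
Lemma prob_side_near i mu delta t b : `|f (design R i) - mu| <= delta ->
  0 <= prob P (Y i @^-1` side mu t b) <= 1 /\
  `|prob P (Y i @^-1` side mu t b) - gauss_tail t| <= eps + delta.
Proof.
move=> fd; split.
  rewrite prob_ge0 prob_le1 //; apply: measurable_RV_preimage; exact: measurable_side.
have e0 := eps0; have e1 := eps14; have [v /andP[v0 v1] ->] := prob_side i mu t b.
set x := (if b then _ else _).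
have xd : `|x| <= delta by rewrite /x; case: (b) => //; rewrite distrC.
have := gauss_tail_lipschitz (t + x) t.
rewrite [t + x]addrC addrK => H.
have g0 := gauss_tail_ge0 (x + t); have g1 : gauss_tail (x + t) <= 1.
  by rewrite -lee_fin -gauss_tailE -/(normal_prob 0 1 _) probability_le1.
have {}H := le_trans H xd.
move: H; rewrite !ler_norml => /andP[H1 H2]; apply/andP; split; nra.
Qed.

(** At threshold [1 + delta] the shifted argument is at least 1, so the clean part has tail at most
    [33 / 100]. The worst contamination gives [3 / 4 * 33 / 100 + 1 / 4 = 199 / 400], still below
    [1 / 2]. *)
Lemma prob_side_far i mu delta b : `|f (design R i) - mu| <= delta ->
  prob P (Y i @^-1` side mu (1 + delta) b) <= 199 / 400.
Proof.
move=> fd; have e0 := eps0; have e1 := eps14; have [v /andP[v0 v1] ->] := prob_side i mu (1 + delta) b.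
set x := (if b then _ else _).
have xd : `|x| <= delta by rewrite /x; case: (b) => //; rewrite distrC.
have : gauss_tail (1 + delta + x) <= 33 / 100.
  by apply: gauss_tail1_le; move: xd; rewrite ler_norml => /andP[]; lra.
by nra.
Qed.

End Huber.

Section Bins.
Variables (R : realType) (n m : nat).
Implicit Types (j : 'I_m) (i : 'I_n).

Definition bin_seq j : seq 'I_n := [seq i <- enum 'I_n | in_bin j (design R i)].

Hypotheses (m0 : (0 < m)%N) (mn : (m %| n)%N) (n0 : (0 < n)%N).
Local Notation s := (n %/ m)%N.

(** The open left end of a bin and the shift [i.+1] in [design] combine: [j * s < i.+1] is
    [j * s <= i]. *)
Lemma in_binE j i : in_bin j (design R i) = (j * s <= i < j.+1 * s)%N.
Proof.
have nE a : (a * n = a * s * m)%N by rewrite -mulnA divnK.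
have mR : 0 < m%:R :> R by rewrite ltr0n.
have nR : 0 < n%:R :> R by rewrite ltr0n.
rewrite /in_bin /design ltr_pdivrMr // mulrAC ltr_pdivlMr //.
rewrite ler_pdivrMr // mulrAC ler_pdivlMr // -!natrM ltr_nat ler_nat.
by rewrite !nE ltn_pmul2r // leq_pmul2r // !ltnS.
Qed.

Lemma size_bin_seq j : size (bin_seq j) = s.
Proof.
rewrite size_filter (eq_count (in_binE j)).
rewrite -(count_map (@nat_of_ord n) (fun k => (j * s <= k < j.+1 * s)%N)) val_enum_ord.
have jn : (j.+1 * s <= n)%N by rewrite -[leqRHS](divnK mn) mulnC leq_mul2l ltn_ord orbT.
have nE : n = (j * s + (s + (n - j.+1 * s)))%N by rewrite addnA -mulSnr subnKC.
rewrite [X in iota 0 X]nE.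
rewrite !iotaD !count_cat add0n.
rewrite (@eq_in_count _ _ pred0 (iota 0 _)) ?count_pred0; last first.
  by move=> k; rewrite mem_iota /= => H; apply/negbTE; lia.
rewrite (@eq_in_count _ _ predT (iota (j * s) s)) ?count_predT ?size_iota; last first.
  by move=> k; rewrite mem_iota /= mulSn => H; lia.
rewrite (@eq_in_count _ _ pred0 (iota _ (n - _))) ?count_pred0; last first.
  by move=> k; rewrite mem_iota /= mulSn => H; apply/negbTE; lia.
by rewrite add0n addn0.
Qed.

Lemma bin_seq_uniq j : uniq (bin_seq j).
Proof. exact/filter_uniq/enum_uniq. Qed.

Lemma bin_seq_disjoint j j' i : j != j' -> i \in bin_seq j -> i \notin bin_seq j'.
Proof.
move=> jj'; rewrite !mem_filter !in_binE => /andP[/andP[a b] _].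
apply/negP => /andP[/andP[c e] _]; move/eqP: jj'; apply; apply: val_inj => /=.
have h1 := leq_ltn_trans a e; have h2 := leq_ltn_trans c b.
by move: h1 h2; rewrite !ltn_mul2r => /andP[_ h1] /andP[_ h2]; lia.
Qed.

Lemma bin_seq_near j i : i \in bin_seq j ->
  [/\ 0 <= design R i, design R i <= 1 &
      j%:R / m%:R <= design R i /\ design R i <= j.+1%:R / m%:R].
Proof.
have mR : 0 < m%:R :> R by rewrite ltr0n.
rewrite mem_filter => /andP[/andP[a b] _]; split.
- by rewrite divr_ge0.
- by rewrite ler_pdivrMr ?ltr0n // mul1r ler_nat.
- by rewrite ltW.
Qed.

End Bins.

Lemma in_side (R : realType) (mu t y : R) b :
  (y \in side mu t b) = if b then mu + t < y else y < mu - t.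
Proof.
by case: b; apply/idP/idP; rewrite inE /= in_itv /= ?andbT.
Qed.

Lemma sum_pairE (V : nmodType) (A B : finType) (G : A * B -> V) :
  \sum_i G i = \sum_a \sum_b G (a, b).
Proof. by rewrite pair_bigA; apply: eq_bigr => -[]. Qed.

Section BinMedians.
Context (R : realType) (d : measure_display) (T : measurableType d).
Variables (P : probability T R) (n m : nat) (Y : 'I_n -> {RV P >-> R}).
Variables (eps : R) (f : R -> R) (Q : 'I_n -> probability R R).
Hypotheses (eps0 : 0 <= eps) (eps14 : eps <= 1 / 4).
Hypothesis hub : huber_model eps f Q Y.
Hypotheses (m0 : (0 < m)%N) (mn : (m %| n)%N).
Local Notation s := (n %/ m)%N.
Hypothesis s3 : (3 <= s)%N.
Variables (mu : 'I_m -> R) (delta eta : R) (N : nat).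
Hypotheses (delta0 : 0 <= delta) (eta0 : 0 <= eta) (Neta : N%:R * eta = 1 + delta).
Hypothesis fmu : forall j i, i \in @bin_seq R n m j -> `|f (design R i) - mu j| <= delta.
Implicit Types (j : 'I_m).

Let n0 : (0 < n)%N.
Proof. by rewrite -(divnK mn) muln_gt0 m0 andbT; have := s3; lia. Qed.

Let indY : mutually_independent Y.
Proof. by case: hub. Qed.

(* The order statistic of rank [middle_rank s rb.1] counted from the outside of
   side [rb.2] (above if true, below if false) is more than [t] away from [mu j]
   on that side. *)
Definition side_event j t (rb : bool * bool) : set T :=
  count_ge Y (fun=> side (mu j) t rb.2) (bin_seq R n j) (middle_rank s rb.1).+1.

Lemma measurable_side_event j t rb : measurable (side_event j t rb).
Proof. by apply: measurable_count_ge => i; exact: measurable_side. Qed.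

Let near_gauss_bin j t b : 0 <= t ->
  near_gauss (bin_seq R n j) t (eps + delta)
    (fun i => prob P (Y i @^-1` side (mu j) t b)).
Proof. by move=> t0 i ij; exact: (prob_side_near eps0 eps14 hub _ _ (fmu ij)). Qed.

Let rho0 : 0 <= eps + delta.
Proof. by rewrite addr_ge0. Qed.

Let prob_side_eventE j t rb : prob P (side_event j t rb) =
  poisson_binomial_tail (middle_rank s rb.1).+1
    [seq prob P (Y i @^-1` side (mu j) t rb.2) | i <- bin_seq R n j].
Proof.
rewrite prob_count_geE //; last exact: bin_seq_uniq.
by move=> i; exact: measurable_side.
Qed.

Let root_bound t : R := (t < 25 * (eps + delta))%R%:R + expR (- (Num.sqrt s%:R / 25 * t) ^+ 2).

Let root_bound_ge0 t : 0 <= root_bound t.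
Proof. by rewrite addr_ge0 ?expR_ge0. Qed.

Let prob_side_event_le j t rb : 0 <= t -> t <= 1 + delta ->
  prob P (side_event j t rb) <= root_bound t ^+ 2.
Proof.
move=> t0 td; rewrite prob_side_eventE; apply: median_tail_bound => //.
- exact: size_bin_seq.
- by have := eps0; lra.
- exact: near_gauss_bin.
Qed.

Let prob_side_event_dist j t b : 0 <= t -> t <= 1 + delta ->
  `|prob P (side_event j t (b, true)) - prob P (side_event j t (b, false))| <=
  (t < 25 * (eps + delta))%R%:R +
  4 * (eps + delta) * Num.sqrt s%:R * expR (- (Num.sqrt s%:R / 25 * t) ^+ 2).
Proof.
move=> t0 td; rewrite !prob_side_eventE; apply: median_tail_dist => //.
- exact: size_bin_seq.
- by have := eps0; lra.
- exact: near_gauss_bin.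
- exact: near_gauss_bin.
Qed.

(** [1 - 2 * (199 / 400)] is [1 / 200], and half its square is [1 / (200 * 400)]. *)
Lemma prob_side_event_far j rb :
  prob P (side_event j (1 + delta) rb) <= expR (- (s%:R / (200 * 400))).
Proof.
rewrite prob_side_eventE.
have sB : size (bin_seq R n j) = s by exact: size_bin_seq.
apply: (le_trans (y := (binomial_tail R s (middle_rank s rb.1).+1).[199 / 400])).
  have := @poisson_binomial_tail_le R _ (bin_seq R n j)
    (fun i => prob P (Y i @^-1` side (mu j) (1 + delta) rb.2)) (middle_rank s rb.1).+1 (199 / 400).
  rewrite sB; apply; last by lra.
  by move=> i ij; rewrite prob_ge0 /=; exact: (prob_side_far eps0 eps14 hub _ (fmu ij)).
apply: le_trans (binomial_tail_tail _ _ _ _) _; [by have := s3; lia| |lra|lra|].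
  by apply: middle_rank_ge; have := s3; lia.
by rewrite ler_expR le_eqVlt; apply/orP; left; apply/eqP; field.
Qed.

Let I : finType := ('I_m * ((bool * bool) * 'I_N))%type.

Let E (i : I) : set T := side_event i.1 (i.2.2%:R * eta) i.2.1.

Let mE i : measurable (E i).
Proof. exact: measurable_side_event. Qed.

(* An index [(j, ((r, b), k))] stands for the event that the order statistic
   [(r, b)] of bin [j] passes grid level [k]. *)
Definition bin_coef j (i : I) : R :=
  (i.1 == j)%:R * ((if i.2.1.2 then 1 else -1) * (eta / 2)).

Definition rounded_deviation j (x : {ffun I -> bool}) : R :=
  \sum_i bin_coef j i * (x i)%:R.

Definition bin_pattern : T -> {ffun I -> bool} := pattern E.

Lemma measurable_bin_pattern x : measurable (bin_pattern @^-1` [set x]).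
Proof. exact: measurable_pattern. Qed.

Let k_le (k : 'I_N) : 0 <= k%:R * eta /\ k%:R * eta <= 1 + delta.
Proof.
split; first by rewrite mulr_ge0.
by rewrite -Neta ler_wpM2r // ler_nat ltnW.
Qed.

Let sum_bin j (F : I -> R) : \sum_i (i.1 == j)%:R * F i =
  \sum_(k < N) \sum_(r : bool) (F (j, ((r, true), k)) + F (j, ((r, false), k))).
Proof.
rewrite sum_pairE (bigD1 j) //= [X in _ + X]big1 ?addr0; last first.
  by move=> a /negbTE aj; apply: big1 => b _; rewrite aj mul0r.
under eq_bigr do rewrite eqxx mul1r.
rewrite sum_pairE exchange_big /=; apply: eq_bigr => k _; rewrite sum_pairE.
by apply: eq_bigr => r _; rewrite big_bool.
Qed.

(** Upward and downward deviations are paired by rank counted from the outside. Both then have the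
    same tail index, and [prob_side_event_dist] applies to each pair. *)
Lemma rounded_deviation_mean j : eta * Num.sqrt s%:R <= 1 ->
  `|law_mean P bin_pattern (rounded_deviation j)| <= 229 * (eps + delta) + eta.
Proof.
move=> es; have s0 : (0 < s)%N by have := s3; lia.
rewrite /rounded_deviation law_mean_sum.
under eq_bigr => i _ do rewrite law_meanZ pattern_mean1 // /bin_coef -mulrA.
rewrite sum_bin /=.
apply: le_trans (grid_dist_sum N s0 rho0 eta0 es).
rewrite mulr_sumr; apply: le_trans (ler_norm_sum _ _ _) _; apply: ler_sum => k _.
have [k0 k1] := k_le k.
rewrite big_bool /=.
have H1 := prob_side_event_dist j true k0 k1.
have H2 := prob_side_event_dist j false k0 k1.
set D := _ + _ * _ in H1 H2 *.
rewrite !mul1r !mulN1r !mulNr -!mulrBr -mulrDr normrM ger0_norm ?divr_ge0 //.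
apply: (le_trans (y := eta / 2 * (D + D))).
  by rewrite ler_wpM2l ?divr_ge0 // (le_trans (ler_normD _ _)) // lerD.
by rewrite le_eqVlt; apply/orP; left; apply/eqP; field.
Qed.

Lemma rounded_deviation_second_moment j :
  law_mean P bin_pattern (fun x => rounded_deviation j x ^+ 2) <=
  (2 * (25 * (eps + delta) + 2 * eta + 50 / Num.sqrt s%:R)) ^+ 2.
Proof.
have s0 : (0 < s)%N by have := s3; lia.
have H := @pattern_second_moment R d T P I E mE (bin_coef j)
  (fun i => root_bound (i.2.2%:R * eta)) (fun i => root_bound_ge0 _).
apply: le_trans (H _) _ => [i|].
  by have [k0 k1] := k_le i.2.2; exact: prob_side_event_le.
have cE i : `|bin_coef j i| * root_bound (i.2.2%:R * eta) =
    (i.1 == j)%:R * (eta / 2 * root_bound (i.2.2%:R * eta)).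
  rewrite /bin_coef normrM normr_nat normrM; have -> : `|if i.2.1.2 then 1 else - 1| = 1 :> R by case: ifP; rewrite ?normrN normr1.
  by rewrite mul1r ger0_norm ?divr_ge0 // -!mulrA.
under eq_bigr do rewrite cE.
rewrite sum_bin /= ler_pXn2r // ?nnegrE; first last.
- by rewrite mulr_ge0 // !addr_ge0 ?mulr_ge0 ?divr_ge0 ?sqrtr_ge0.
- by rewrite sumr_ge0 // => k _; rewrite big_bool /= !addr_ge0 // !mulr_ge0.
(* Four events per level, each with coefficient [eta / 2], give the factor 2. *)
apply: (le_trans (y := 2 * (eta * \sum_(k < N) root_bound (k%:R * eta)))).
  rewrite mulrA mulr_sumr; apply: ler_sum => k _; rewrite big_bool /=.
  by rewrite le_eqVlt; apply/orP; left; apply/eqP; field.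
by rewrite ler_wpM2l //; exact: grid_tail_sum.
Qed.

(** After expansion only pairs of events from the two bins survive, and these depend on disjoint
    sets of observations. *)
Lemma rounded_deviation_uncorrelated j j' : j != j' ->
  law_mean P bin_pattern (fun x => rounded_deviation j x * rounded_deviation j' x) =
  law_mean P bin_pattern (rounded_deviation j) *
  law_mean P bin_pattern (rounded_deviation j').
Proof.
move=> jj'; rewrite /rounded_deviation !law_mean_sum big_distrlr /=.
transitivity (law_mean P bin_pattern (fun x : {ffun I -> bool} => \sum_i \sum_i'
    bin_coef j i * bin_coef j' i' * ((x i)%:R * (x i')%:R))).
  apply: eq_law_mean => x; rewrite big_distrlr /=.
  by apply: eq_bigr => i _; apply: eq_bigr => i' _; rewrite mulrACA.
rewrite law_mean_sum; apply: eq_bigr => i _; rewrite law_mean_sum.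
apply: eq_bigr => i' _; rewrite !law_meanZ !pattern_mean1 // pattern_mean2 //.
rewrite /bin_coef; case: eqP => [ij|_]; last by rewrite !mul0r.
case: eqP => [ij'|_]; last by rewrite !(mul0r, mulr0).
rewrite [RHS]mulrACA; congr (_ * _); apply: prob_count_geI => //; try exact: bin_seq_uniq.
- by move=> k; exact: measurable_side.
- by move=> k; exact: measurable_side.
- by move=> k; rewrite ij ij'; exact: bin_seq_disjoint.
Qed.

Definition outlying_bins : set T :=
  \bigcup_(i in [set: 'I_m * (bool * bool)]) side_event i.1 (1 + delta) i.2.

Lemma prob_outlying_bins : measurable outlying_bins /\
  prob P outlying_bins <= (4 * m)%:R * expR (- (s%:R / (200 * 400))).
Proof.
have [] := @prob_bigcup_le R d T P ('I_m * (bool * bool))%type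
  (fun i => side_event i.1 (1 + delta) i.2) (fun i => measurable_side_event _ _ _)
  _ (fun i => prob_side_event_far i.1 i.2).
by rewrite !card_prod card_ord card_bool mulnC.
Qed.

(** Outside [outlying_bins] both middle order statistics stay within [1 + delta = N * eta] of
    [mu j]. The cap in [grid_count] is then inactive and only rounding, at most [eta], is lost. *)
Lemma bin_median_approx w j : ~ outlying_bins w ->
  `|bin_median (fun i => Y i w) j - mu j - rounded_deviation j (bin_pattern w)| <= eta.
Proof.
move=> nout.
have sB : size (bin_seq R n j) = s by exact: size_bin_seq.
pose ys := [seq Y i w | i <- bin_seq R n j].
have sys : size ys = s by rewrite size_map.
pose z k := (sort <=%R ys)`_k.
have s0 : (0 < s)%N by have := s3; lia.
have rank_lt b : (middle_rank s b < s)%N.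
  by case: b => /=; have := odd_double_half s.-1; rewrite ?uphalf_half; lia.
(* Counting from the other end exchanges the two middle ranks; hence [~~ r] on the upper side and
   [r] on the lower one. *)
have rank_sub b : (s - middle_rank s b)%N = (middle_rank s (~~ b)).+1.
  by case: b => /=; have := odd_double_half s.-1; rewrite ?uphalf_half; lia.
have upE r t : (mu j + t < z (middle_rank s (~~ r))) <-> side_event j t (r, true) w.
  rewrite /z lt_nth_sort ?sys // rank_sub negbK /ys count_map.
  rewrite /side_event /count_ge /=.
  by rewrite (@eq_count _ (fun i => Y i w \in _) (fun i => mu j + t < Y i w)) // => i; exact: (in_side _ _ _ true).
have dnE r t : (z (middle_rank s r) < mu j - t) <-> side_event j t (r, false) w.
  rewrite /z nth_sort_lt ?sys // /ys count_map.
  rewrite /side_event /count_ge /=.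
  by rewrite (@eq_count _ (fun i => Y i w \in _) (fun i => Y i w < mu j - t)) // => i; exact: (in_side _ _ _ false).
pose y r := z (middle_rank s r) - mu j.
pose up r := eta * \sum_(k < N) (k%:R * eta < y r)%R%:R.
pose dn r := eta * \sum_(k < N) (k%:R * eta < - y r)%R%:R.
have approx r : `|y r - (up r - dn r)| <= eta.
  have [[u1 u2 u3 u4] u5] := @grid_count R eta (y r) N eta0.
  have [[v1 v2 v3 v4] v5] := @grid_count R eta (- y r) N eta0.
  rewrite -/(up r) in u1 u2 u3 u4 u5; rewrite -/(dn r) in v1 v2 v3 v4 v5.
  rewrite Neta in u1 v1.
  have yle : y r <= 1 + delta.
    rewrite leNgt; apply/negP => H; apply: nout; exists (j, (~~ r, true)) => //.
    by apply/upE; rewrite negbK -ltrBrDl.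
  have yge : - y r <= 1 + delta.
    rewrite leNgt; apply/negP => H; apply: nout; exists (j, (r, false)) => //.
    by apply/dnE; move: H; rewrite /y; lra.
  have e0 := eta0; rewrite (min_idPl yle) in u1; rewrite (min_idPl yge) in v1.
  have [y0|/ltW y0] := leP 0 (y r).
    have -> : dn r = 0 by apply: v4; lra.
    by have := u5 y0; move=> ?; rewrite ler_norml; apply/andP; split; lra.
  have -> : up r = 0 by exact: u4.
  have : dn r <= - y r + eta by apply: v5; lra.
  by move=> ?; rewrite ler_norml; apply/andP; split; lra.
have -> : rounded_deviation j (bin_pattern w) = ((up true - dn true) + (up false - dn false)) / 2.
  rewrite /rounded_deviation.
  under eq_bigr => i _ do rewrite /bin_coef -mulrA.
  rewrite sum_bin /up /dn -!mulrBr -mulrDr mulrAC -!sumrB -big_split /= mulr_sumr.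
  apply: eq_bigr => k _; rewrite big_bool /= /bin_pattern !ffunE /E /=.
  have upB r : (w \in side_event j (k%:R * eta) (r, true)) = (k%:R * eta < y (~~ r)).
    by apply/idP/idP; rewrite inE -upE /y ltrBrDl.
  have dnB r : (w \in side_event j (k%:R * eta) (r, false)) = (k%:R * eta < - y r).
    by apply/idP/idP; rewrite inE -dnE /y; lra.
  by rewrite !upB !dnB; field.
(* The upper index [s./2] in [median] is [uphalf s.-1]. *)
have -> : bin_median (fun i => Y i w) j - mu j = (y true + y false) / 2.
  rewrite /bin_median -/(bin_seq R n j) -/ys /median sys -!/(z _).
  by rewrite /y /= uphalfE prednK //; field.
have := approx true; have := approx false; rewrite !ler_norml.
by move=> /andP[? ?] /andP[? ?]; apply/andP; split; lra.
Qed.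

End BinMedians.

(** * Taylor approximation in the Hoelder class *)

Section Derivative01.
Variable R : realType.
Implicit Types (f g : R -> R) (x y t e u M : R).

Lemma derive01_near f x e : derivable01 f x -> 0 < e ->
  exists2 r : R, 0 < r & forall y, y \in `[0, 1] -> y != x -> `|x - y| < r ->
    `|f y - f x - derive01 f x * (y - x)| <= e * `|y - x|.
Proof.
move=> df e0.
have {}df : diff_quotient01 f x --> derive01 f x by exact: df.
have H : \forall y \near within `[0, 1] x^',
    `|derive01 f x - (f y - f x) / (y - x)| < e by move: e e0; apply/cvgrPdist_lt.
have [r r0 rP] := (nbhs_ballP x (fun y => y != x -> y \in `[0, 1] ->
  `|derive01 f x - (f y - f x) / (y - x)| < e)).1 H.
exists r => // y y01 yx xyr.
have /(_ yx y01) := rP y xyr.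
have yx0 : y - x != 0 by rewrite subr_eq0.
rewrite -(ltr_pM2r (_ : 0 < `|y - x|)) ?normr_gt0 // -normrM mulrBl divfK //.
by rewrite distrC => /ltW.
Qed.

Lemma derive01_continuous f x : derivable01 f x ->
  f @ within `[0%R, 1%R]%classic (nbhs x) --> f x.
Proof.
move=> df; have [r r0 H] := derive01_near df ltr01.
set D := derive01 f x in H.
apply/cvgrPdist_lt => e e0; apply/nbhs_ballP.
exists (Num.min r (e / (1 + `|D|))) => /=.
  by rewrite lt_min r0 divr_gt0 // ltr_pwDl.
move=> y; rewrite /ball /= lt_min => /andP[yr ye] y01.
have [->|yx] := eqVneq y x; first by rewrite subrr normr0.
have {}H := H y y01 yx yr.
rewrite distrC; apply: (@le_lt_trans _ _ ((1 + `|D|) * `|y - x|)).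
  have -> : f y - f x = (f y - f x - D * (y - x)) + D * (y - x) by rewrite subrK.
  by rewrite (le_trans (ler_normD _ _)) // normrM mulrDl lerD.
by rewrite distrC mulrC -ltr_pdivlMr // ltr_pwDl.
Qed.

Lemma derive01_interior f x : 0 < x -> x < 1 -> derivable01 f x ->
  is_derive x 1 f (derive01 f x).
Proof.
move=> x0 x1 df.
suff H : h^-1 *: ((f \o shift x) (h *: 1) - f x) @[h --> 0^'] --> derive01 f x.
  by apply: DeriveDef; [apply: cvgP H|apply: cvg_lim H].
apply/cvgrPdist_le => e e0.
have [r r0 H] := derive01_near df e0.
apply/nbhs_ballP; exists (Num.min r (Num.min x (1 - x))) => /=.
  by rewrite !lt_min r0 x0 subr_gt0.
move=> h; rewrite /ball /= sub0r normrN !lt_min => /and3P[hr hx hx1] h0.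
rewrite ltr_norml in hx; rewrite ltr_norml in hx1.
move/andP: hx => [hx _]; move/andP: hx1 => [_ hx1].
have := H (h + x); rewrite addrK distrC addrK => /(_ _ _ hr) H'.
rewrite scaler1 /GRing.scale /=.
rewrite -(ler_pM2r (_ : 0 < `|h|)) ?normr_gt0 // -normrM mulrBl mulrAC mulVf // mul1r distrC.
apply: H'; first by rewrite in_itv /=; apply/andP; split; lra.
by rewrite -subr_eq0 addrK.
Qed.

(** The polynomial is subtracted within the mean value theorem so that the Taylor induction can
    apply it to the remainder of each derivative. *)
Lemma mean_value01 f (p : {poly R}) x u M : x \in `[0, 1] -> u \in `[0, 1] ->
  (forall t, t \in `[0, 1] -> derivable01 f t) ->
  (forall t, t \in `[0, 1] -> `|t - x| <= `|u - x| ->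
     `|derive01 f t - p^`().[t]| <= M) ->
  `|(f u - p.[u]) - (f x - p.[x])| <= M * `|u - x|.
Proof.
rewrite !in_itv /= => /andP[x0 x1] /andP[u0 u1] df dM.
have der a b : 0 <= a -> a < b -> b <= 1 ->
    exists2 c, a < c < b & (f b - p.[b]) - (f a - p.[a]) =
      (derive01 f c - p^`().[c]) * (b - a).
  move=> a0 ab b1.
  have [|||c] := @MVT R (f - horner p) (fun t => derive01 f t - p^`().[t]) a b.
  - by [].
  - move=> t; rewrite in_itv /= => /andP[at_ tb].
    apply: is_deriveB; apply: derive01_interior; [lra|lra|].
    by apply: df; rewrite in_itv /=; apply/andP; split; lra.
  - apply/subspace_continuousP => t /=; rewrite in_itv /= => /andP[at_ tb].
    apply: cvgB; last by apply: cvg_within_filter; exact: continuous_horner.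
    have t01 : t \in `[0, 1] by rewrite in_itv /=; apply/andP; split; lra.
    apply: cvg_trans (derive01_continuous (df t t01)).
    apply: cvg_app; apply: within_subset => z /=; rewrite !in_itv /=.
    by move=> /andP[? ?]; apply/andP; split; lra.
  by rewrite in_itv /= => cab ->; exists c.
have [xu|ux|->] := ltgtP x u; last by rewrite !subrr normr0 mulr0.
  have [c /andP[c1 c2] ->] := der _ _ x0 xu u1.
  rewrite normrM ler_wpM2r //; apply: dM.
    by rewrite in_itv /=; apply/andP; split; lra.
  by rewrite !ger0_norm; lra.
have [c /andP[c1 c2] E] := der _ _ u0 ux x1.
rewrite distrC E normrM [`|u - x|]distrC ler_wpM2r //; apply: dM.
  by rewrite in_itv /=; apply/andP; split; lra.
by rewrite -(distrC x c) -(distrC x u) !ger0_norm; lra.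
Qed.

End Derivative01.

Section HoelderTaylor.
Variables (R : realType) (beta L : R) (f : R -> R).
Hypotheses (beta1 : 1 < beta) (fH : hoelder_class beta L f).
Local Notation l := (Num.truncn beta).

Let l_bounds : l%:R <= beta /\ beta < l.+1%:R.
Proof.
have := beta1; have /andP[] := @truncn_itv R beta (ltW (lt_trans ltr01 beta1)).
by [].
Qed.

Let l_gt0 : (0 < l)%N.
Proof. by rewrite truncn_gt0 ltW. Qed.

Lemma hoelder_deriv_bound j x : (j <= l)%N -> x \in `[0, 1] -> `|derive01n j f x| <= L.
Proof.
move=> jl x01; have [_ H] := fH.
(* The class constrains pairs of distinct points only, so a partner for [x] has to be supplied. *)
have [x' x'01 xx'] : exists2 x' : R, x' \in `[0, 1] & x != x'.
  have [->|x0] := eqVneq x 0; last by exists 0; rewrite // in_itv /= lexx ler01.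
  by exists 1; rewrite ?in_itv /= ?ler01 ?lexx // eq_sym oner_eq0.
apply: le_trans (H x x' x01 x'01 xx').
rewrite big_mkord (bigD1 (Ordinal (jl : (j < l.+1)%N))) //= -addrA lerDl.
by rewrite addr_ge0 ?sumr_ge0 // divr_ge0 ?powR_ge0.
Qed.

Lemma hoelder_lipschitz x u : x \in `[0, 1] -> u \in `[0, 1] ->
  `|f u - f x| <= L * `|u - x|.
Proof.
move=> x01 u01; have [df _] := fH.
have := @mean_value01 R f 0 x u L x01 u01; rewrite deriv0 !horner0 !subr0.
apply=> [t t01|t t01 _]; first exact: (df 0%N t l_gt0 t01).
by rewrite horner0 subr0; exact: (hoelder_deriv_bound (j := 1%N)).
Qed.

(** The expansion of degree [N] of the derivative of order [k]; differentiating it shifts [k]. *)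
Let taylor (c : nat -> R) (x : R) (N k : nat) : {poly R} :=
  \sum_(j < N.+1) (c (k + j)%N / (j`!)%:R) *: ('X - x%:P) ^+ j.

Let taylor_deriv c x N k : (taylor c x N.+1 k)^`() = taylor c x N k.+1.
Proof.
have deriv1 : (1 : {poly R})^`() = 0 by exact: derivC.
rewrite /taylor raddf_sum big_ord_recl /= derivZ expr0 deriv1 scaler0 add0r.
apply: eq_bigr => j _.
rewrite derivZ deriv_exp /= derivB derivX derivC subr0 mul1r -scalerMnr scalerMnl -mulr_natr.
rewrite /bump /= add1n addnS addSn; congr (_ *: _).
rewrite factS natrM; field.
by rewrite pnatr_eq0 -lt0n fact_gt0 addrC natr1 pnatr_eq0.
Qed.

Let taylor_at c x N k : (taylor c x N k).[x] = c k.
Proof.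
rewrite /taylor horner_sum big_ord_recl /= big1 ?addr0.
  by rewrite expr0 hornerZ hornerC addn0 fact0 divr1 mulr1.
by move=> j _; rewrite hornerZ horner_exp hornerXsubC subrr expr0n /= mulr0.
Qed.

(** Descent on the order of the derivative: the top order is the Hoelder condition, and each
    application of [mean_value01] gains one factor [|u - x|]. *)
Let taylor_bound x N k u : (k + N = l)%N -> x \in `[0, 1] -> u \in `[0, 1] -> u != x ->
  `|derive01n k f u - (taylor (fun i => derive01n i f x) x N k).[u]| <=
  L * `|u - x| `^ (beta - k%:R).
Proof.
move=> + x01; have [df fl] := fH; have [lb bl] := l_bounds.
elim: N k u => [|N IH] k u kN u01 ux.
  rewrite addn0 in kN; rewrite kN /taylor big_ord1 expr0 hornerZ hornerC mulr1 addn0 fact0 divr1.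
  have := fl u x u01 x01 ux.
  have p0 : 0 < `|u - x| `^ (beta - l%:R) by rewrite powR_gt0 // normr_gt0 subr_eq0.
  rewrite -ler_pdivrMr // => H; apply: le_trans H.
  by rewrite lerDr sumr_ge0.
have kl : (k < l)%N by rewrite -kN addnS ltnS leq_addr.
have kb : k.+1%:R <= beta by apply: le_trans lb; rewrite ler_nat.
have := @mean_value01 R (derive01n k f) (taylor (fun i => derive01n i f x) x N.+1 k)
  x u (L * `|u - x| `^ (beta - k.+1%:R)) x01 u01.
rewrite taylor_at subrr subr0 taylor_deriv.
have -> : L * `|u - x| `^ (beta - k.+1%:R) * `|u - x| = L * `|u - x| `^ (beta - k%:R).
  rewrite -mulrA; congr (_ * _).
  rewrite -[X in _ * X](powRr1 (normr_ge0 _)) -powRD; first by rewrite -natr1; congr (_ `^ _); ring.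
  by rewrite normr_eq0 subr_eq0 ux implybT.
apply=> [t t01|t t01 tu]; first exact: df.
have L0 : 0 <= L := le_trans (normr_ge0 _) (hoelder_deriv_bound (leq0n l) x01).
have [->|tx] := eqVneq t x.
  rewrite taylor_at subrr normr0 mulr_ge0 ?powR_ge0 //.
apply: le_trans (IH k.+1 t _ t01 tx) _; first by rewrite addSnnS.
by rewrite ler_wpM2l // ge0_ler_powR ?nnegrE // subr_ge0.
Qed.

Lemma hoelder_taylor x : x \in `[0, 1] -> exists a : nat -> R,
  forall u, u \in `[0, 1] ->
    `|f u - f x - \sum_(k < l) a k * (u - x) ^+ k.+1| <= L * `|u - x| `^ beta.
Proof.
move=> x01; exists (fun k => derive01n k.+1 f x / (k.+1`!)%:R) => u u01.
have L0 : 0 <= L := le_trans (normr_ge0 _) (hoelder_deriv_bound (leq0n l) x01).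
have [->|ux] := eqVneq u x.
  rewrite subrr sub0r normrN big1 ?normr0 ?mulr_ge0 ?powR_ge0 //.
  by move=> k _; rewrite subrr expr0n mulr0.
have := taylor_bound (add0n l) x01 u01 ux.
rewrite subr0 /taylor big_ord_recl /= expr0 fact0 divr1.
rewrite hornerD hornerZ hornerC mulr1 horner_sum opprD addrA.
rewrite [X in `|_ - X| <= _ -> _](eq_bigr (fun k : 'I_l => derive01n k.+1 f x / (k.+1`!)%:R * (u - x) ^+ k.+1)) //.
by move=> k _; rewrite hornerZ horner_exp hornerXsubC.
Qed.

End HoelderTaylor.

(** * Kernel weights *)

Section Bins01.
Variable R : realType.
Local Notation mu := (@lebesgue_measure R).
Implicit Types (g : R -> R) (m : nat).

Lemma bin_sub01 m (j : 'I_m) : (`[j%:R / m%:R, j.+1%:R / m%:R] `<=` (`[0, 1] : set R))%classic.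
Proof.
have m0 : 0 < m%:R :> R by rewrite ltr0n (leq_ltn_trans _ (ltn_ord j)).
move=> x /=; rewrite !in_itv /= => /andP[a b]; apply/andP; split.
  by apply: le_trans a; rewrite divr_ge0.
by apply: (le_trans b); rewrite ler_pdivrMr // mul1r ler_nat.
Qed.

Lemma Rintegral_bins m g : (0 < m)%N -> mu.-integrable `[0, 1] (EFin \o g) ->
  \int[mu]_(u in `[0, 1]) g u =
  \sum_(j < m) \int[mu]_(u in `[j%:R / m%:R, j.+1%:R / m%:R]) g u.
Proof.
move=> m0 ig; have mR : 0 < m%:R :> R by rewrite ltr0n.
suff H k : (k <= m)%N -> \int[mu]_(u in `[0, k%:R / m%:R]) g u =
    \sum_(j < k) \int[mu]_(u in `[j%:R / m%:R, j.+1%:R / m%:R]) g u.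
  by rewrite -H // divff // gt_eqF.
elim: k => [_|k IH km]; first by rewrite mul0r set_itv1 Rintegral_set1 big_ord0.
rewrite big_ord_recr /= -IH; last exact: ltnW.
have sub : (`[0, k.+1%:R / m%:R] `<=` (`[0, 1] : set R))%classic.
  move=> x /=; rewrite !in_itv /= => /andP[-> b] /=.
  by apply: (le_trans b); rewrite ler_pdivrMr // mul1r ler_nat.
have ig' : mu.-integrable `[0, k.+1%:R / m%:R] (EFin \o g) by exact: integrableS ig.
have k0 : 0 <= k%:R / m%:R :> R by rewrite divr_ge0.
have kk : k%:R / m%:R <= k.+1%:R / m%:R :> R by rewrite ler_pM2r ?invr_gt0 // ler_nat.
have := @Rintegral_itvB R g (BLeft 0) (BRight (k.+1%:R / m%:R)) (k%:R / m%:R) ig'.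
rewrite !bnd_simp k0 kk => /(_ isT isT) /eqP; rewrite subr_eq => /eqP ->.
rewrite addrC; congr (_ + _); rewrite Rintegral_itv_obnd_cbnd //.
apply: integrableS ig' => //.
by move=> x /=; rewrite !in_itv /= => /andP[/ltW a ->]; rewrite (le_trans k0 a).
Qed.

(** Cauchy-Schwarz on an interval of length [1 / m], obtained by integrating [(g u - m * G)^2 >= 0],
    where [m * G] is the average of [g]. *)
Lemma Rintegral_sqr_le m (j : 'I_m) g :
  let D := `[j%:R / m%:R, j.+1%:R / m%:R]%classic in
  mu.-integrable D (EFin \o g) -> mu.-integrable D (EFin \o (fun u => g u ^+ 2)) ->
  (\int[mu]_(u in D) g u) ^+ 2 <= m%:R^-1 * \int[mu]_(u in D) (g u ^+ 2).
Proof.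
move=> D ig ig2.
have m0 : 0 < m%:R :> R by rewrite ltr0n (leq_ltn_trans _ (ltn_ord j)).
set G := \int[mu]_(u in D) g u; set G2 := \int[mu]_(u in D) (g u ^+ 2).
have mD : measurable D by exact: measurable_itv.
have muD : mu D = (m%:R^-1)%:E.
  rewrite /D lebesgue_measure_itv /= lte_fin ltr_pM2r ?invr_gt0 // ltr_nat ltnSn.
  by rewrite -EFinB -mulrBl -natrB ?subSnn // mul1r.
have icst c : mu.-integrable D (EFin \o (fun=> c)).
  apply: measurable_bounded_integrable => //.
    by apply: (le_lt_trans (y := (m%:R^-1)%:E)); [rewrite -muD|exact: ltry].
  exact: bounded_cst.
have icM c : mu.-integrable D (EFin \o (fun u => c * g u)).
  exact: (integrableZl _ c ig).
have Dm : \int[mu]_(u in D) (m%:R * G) ^+ 2 = m%:R * G ^+ 2.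
  rewrite Rintegral_cst // (_ : fine _ = m%:R^-1).
    by rewrite exprMn; field; rewrite gt_eqF.
  by rewrite -[RHS]/(fine (m%:R^-1)%:E) -muD.
have H : 0 <= \int[mu]_(u in D) ((g u ^+ 2 - 2 * (m%:R * G) * g u) + (m%:R * G) ^+ 2).
  apply: Rintegral_ge0 => u _.
  have -> : (g u ^+ 2 - 2 * (m%:R * G) * g u) + (m%:R * G) ^+ 2 = (g u - m%:R * G) ^+ 2 by ring.
  exact: sqr_ge0.
rewrite RintegralD // in H; last exact: (integrableB _ ig2 (icM _)).
rewrite RintegralB // RintegralZl // Dm -/G -/G2 in H.
by rewrite ler_pdivlMl //; move: H; rewrite !expr2; lra.
Qed.

End Bins01.

Section Kernel.
Variables (R : realType) (l : nat) (K : R -> R).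
Local Notation mu := (@lebesgue_measure R).
Hypothesis kerK : is_kernel l K.
Implicit Types (u v : R).

Let mK : measurable_fun setT K. Proof. by case: kerK. Qed.
Let K0 u : u \notin `[-1, 1] -> K u = 0. Proof. by case: kerK => _ H _ _ _; exact: H. Qed.

Let restrictE (g : R -> R) : (forall u, u \notin `[-1, 1] -> g u = 0) -> g \_ `[-1, 1] = g.
Proof.
move=> g0; apply/funext => u; rewrite patchE; case: ifPn => //.
by rewrite notin_setE => /negP/g0.
Qed.

Let integrable_sqr : mu.-integrable setT (EFin \o (fun u => K u ^+ 2)).
Proof.
have [_ _ _ _ H] := kerK.
apply/integrableP; split.
  by apply/measurable_EFinP; exact: measurable_funX.
have -> : (\int[mu]_x `|(EFin \o (fun u : R => (K u ^+ 2)%R)) x| =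
    \int[mu]_(u in `[(-1)%R, 1%R]) ((K u) ^+ 2)%:E)%E.
  rewrite [RHS]integral_mkcond; apply: eq_integral => u _.
  rewrite patchE /= ger0_norm ?sqr_ge0 //; case: ifPn => //.
  by rewrite notin_setE => /negP/K0 ->; rewrite expr0n.
exact: H.
Qed.

(** On the bounded support, [|K| <= 1 + K^2]. *)
Let integrable_ker : mu.-integrable setT (EFin \o K).
Proof.
have i1 : mu.-integrable setT (EFin \o (\1_(`[(-1)%R, 1%R]) : R -> R)).
  exact: integrable_indic_itv.
apply: (le_integrable measurableT _ _ (integrableD measurableT i1 integrable_sqr)).
  exact/measurable_EFinP.
move=> u _ /=; rewrite lee_fin [leRHS]ger0_norm; last by rewrite addr_ge0 ?sqr_ge0.
rewrite indicE; have [uI|/K0 ->] := boolP (u \in `[-1, 1]%R); last first.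
  by rewrite normr0 addr_ge0 ?sqr_ge0.
rewrite mem_set //= -[K u ^+ 2]real_normK ?num_real //.
by have := sqr_ge0 (`|K u| - 1); have := normr_ge0 (K u); rewrite !expr2; lra.
Qed.

Definition kernel_L1 : R := \int[mu]_u `|K u|.
Definition kernel_L2 : R := \int[mu]_u (K u ^+ 2).

Lemma kernel_L1_ge0 : 0 <= kernel_L1.
Proof. exact: Rintegral_ge0. Qed.

Lemma kernel_L2_ge0 : 0 <= kernel_L2.
Proof. by apply: Rintegral_ge0 => u _; exact: sqr_ge0. Qed.

Variables (h x : R).
Hypotheses (h0 : 0 < h) (hx : h < x) (xh : x < 1 - h).

Let Kx u : R := h^-1 * K ((x - u) / h).

Let affineE u : (x - u) / h = (- h^-1) * u + x / h.
Proof. by rewrite mulNr mulrBl addrC [u / h]mulrC. Qed.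

Let nh : - h^-1 != 0.
Proof. by rewrite oppr_eq0 invr_eq0 gt_eqF. Qed.

Let normh : `|- h^-1|^-1 = h.
Proof. by rewrite normrN gtr0_norm ?invr_gt0 // invrK. Qed.

Let integrable_comp (F : R -> R) : mu.-integrable setT (EFin \o F) ->
  mu.-integrable setT (EFin \o (fun u => F ((x - u) / h))).
Proof.
move=> iF; have := integrable_affine (x / h) nh iF.
by apply: eq_integrable => // u _ /=; rewrite affineE.
Qed.

Let Rintegral_comp (F : R -> R) : mu.-integrable setT (EFin \o F) ->
  \int[mu]_u F ((x - u) / h) = h * \int[mu]_u F u.
Proof.
move=> iF; rewrite /Rintegral.
have -> : (\int[mu]_u (F ((x - u) / h))%:E = \int[mu]_u (F ((- h^-1) * u + x / h))%:E)%E.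
  by apply: eq_integral => u _; rewrite affineE.
rewrite integral_affine // normh fineM //.
exact: integrable_fin_num iF.
Qed.

(** As [h < x < 1 - h], the rescaled kernel lives inside [[0, 1]]; sums of integrals over bins are
    integrals over the line, without boundary loss. *)
Let Kx0 u : u \notin `[0, 1] -> Kx u = 0.
Proof.
have h_gt0 := h0; have h_x := hx; have x_h := xh.
move=> u01; rewrite /Kx K0 ?mulr0 //; apply: contra u01.
rewrite !in_itv /= ler_pdivlMr // ler_pdivrMr // => /andP[a b].
by apply/andP; split; lra.
Qed.

Let Kx_supp u : h < `|u - x| -> Kx u = 0.
Proof.
have h_gt0 := h0.
move=> ux; rewrite /Kx K0 ?mulr0 //; apply: contraL ux.
rewrite in_itv /= ler_pdivlMr // ler_pdivrMr // => /andP[a b].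
by rewrite -leNgt ler_norml; apply/andP; split; lra.
Qed.

Let integrable_Kx : mu.-integrable setT (EFin \o Kx).
Proof. exact: (integrableZl measurableT h^-1 (integrable_comp integrable_ker)). Qed.

Let integrable_Kx_sqr : mu.-integrable setT (EFin \o (fun u => Kx u ^+ 2)).
Proof.
have := integrableZl measurableT (h^-1 ^+ 2) (integrable_comp integrable_sqr).
by apply: eq_integrable => // u _ /=; rewrite /Kx exprMn.
Qed.

Let Rintegral01 (g : R -> R) : (forall u, u \notin `[0, 1] -> g u = 0) ->
  \int[mu]_(u in `[0, 1]) g u = \int[mu]_u g u.
Proof.
move=> g0; rewrite Rintegral_mkcond; congr Rintegral; apply/funext => u.
by rewrite patchE; case: ifPn => //; rewrite notin_setE => /negP/g0.
Qed.

Let Kx_abs : \int[mu]_(u in `[0, 1]) `|Kx u| = kernel_L1.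
Proof.
rewrite Rintegral01; last by move=> u /Kx0 ->; rewrite normr0.
have -> : \int[mu]_u `|Kx u| = \int[mu]_u (h^-1 * `|K ((x - u) / h)|).
  by apply: eq_Rintegral => u _; rewrite /Kx normrM gtr0_norm // invr_gt0.
have iK := integrable_norm integrable_ker.
rewrite RintegralZl //; last exact: (integrable_comp iK).
by rewrite (Rintegral_comp iK) mulrA mulVf ?mul1r // gt_eqF.
Qed.

Let Kx_sqr : \int[mu]_(u in `[0, 1]) (Kx u ^+ 2) = kernel_L2 / h.
Proof.
rewrite Rintegral01; last by move=> u /Kx0 ->; rewrite expr0n.
have -> : \int[mu]_u (Kx u ^+ 2) = \int[mu]_u (h^-1 ^+ 2 * K ((x - u) / h) ^+ 2).
  by apply: eq_Rintegral => u _; rewrite /Kx exprMn.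
rewrite RintegralZl //; last exact: (integrable_comp integrable_sqr).
rewrite (Rintegral_comp integrable_sqr) -/kernel_L2; field.
by rewrite gt_eqF.
Qed.

Let integrable_Kx_pow k : mu.-integrable setT (EFin \o (fun u => Kx u * (u - x) ^+ k)).
Proof.
apply: (le_integrable measurableT _ _ (integrableZl measurableT (h ^+ k) (integrable_norm integrable_Kx))).
  apply/measurable_EFinP/measurable_funM.
    by apply/measurable_EFinP; exact: (measurable_int _ integrable_Kx).
  by apply: measurable_funX; exact: measurable_funB.
move=> u _ /=; rewrite lee_fin normrM normrX [leRHS]ger0_norm; last first.
  by rewrite mulr_ge0 // exprn_ge0 // ltW.
rewrite mulrC; have [ux|ux] := leP `|u - x| h; last by rewrite Kx_supp // normr0 !mulr0.
by rewrite ler_wpM2r // lerXn2r // ?nnegrE // ltW.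
Qed.

Let Kx_moment k : (k <= l)%N ->
  \int[mu]_(u in `[0, 1]) (Kx u * (u - x) ^+ k) = (k == 0%N)%:R.
Proof.
move=> kl; rewrite Rintegral01; last by move=> u /Kx0 ->; rewrite mul0r.
pose F v := K v * v ^+ k.
have F0 v : v \notin `[-1, 1] -> F v = 0 by move=> /K0; rewrite /F => ->; rewrite mul0r.
have iF : mu.-integrable setT (EFin \o F).
  apply: (le_integrable measurableT _ _ (integrable_norm integrable_ker)).
    by apply/measurable_EFinP/measurable_funM => //; exact: measurable_funX.
  move=> v _ /=; rewrite lee_fin normr_id.
  have [vI|/F0 ->] := boolP (v \in `[-1, 1]%R); last by rewrite normr0.
  rewrite /F normrM normrX ler_piMr // exprn_ile1 // ler_norml.
  by move: vI; rewrite in_itv.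
have -> : \int[mu]_u (Kx u * (u - x) ^+ k) = \int[mu]_u (h^-1 * (- h) ^+ k * F ((x - u) / h)).
  apply: eq_Rintegral => u _; rewrite /F /Kx.
  have -> : u - x = (- h) * ((x - u) / h) by field; rewrite gt_eqF.
  by rewrite exprMn; ring.
rewrite RintegralZl //; last exact: (integrable_comp iF).
rewrite (Rintegral_comp iF).
have -> : \int[mu]_u F u = (k == 0%N)%:R.
  have [_ _ K1 Km _] := kerK.
  rewrite -[F]restrictE // -Rintegral_mkcond.
  case: k kl @F F0 iF => [|k] kl F F0 iF /=.
    by rewrite -[RHS]K1; apply: eq_Rintegral => v _; rewrite /F expr0 mulr1.
  exact: (Km k.+1).
case: k {kl F F0 iF} => [|k] /=; last by rewrite !mulr0.
by rewrite expr0 !mulr1 mulVf // gt_eqF.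
Qed.

Variables (m : nat).
Hypothesis m0 : (0 < m)%N.
Implicit Type j : 'I_m.

Let bin j : set R := `[j%:R / m%:R, j.+1%:R / m%:R]%classic.

Let mbin j : measurable (bin j : set (measurableTypeR R)). Proof. exact: measurable_itv. Qed.

Let integrable_bin (g : R -> R) j : mu.-integrable setT (EFin \o g) ->
  mu.-integrable (bin j) (EFin \o g).
Proof. by move=> ig; apply: (@integrableS _ _ _ mu setT) => //; exact: mbin. Qed.

Let integrable_binZr (g : R -> R) c j : mu.-integrable setT (EFin \o g) ->
  mu.-integrable (bin j) (EFin \o (fun u => g u * c)).
Proof.
move=> ig; apply: integrable_bin; have := integrableZl measurableT c ig.
by apply: eq_integrable => // u _ /=; rewrite mulrC.
Qed.

Let integrable01 (g : R -> R) : mu.-integrable setT (EFin \o g) ->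
  mu.-integrable `[0, 1] (EFin \o g).
Proof. by move=> ig; apply: (@integrableS _ _ _ mu setT). Qed.

Lemma kernel_weight_sqr_sum : \sum_(j < m) kernel_weight K h j x ^+ 2 <= kernel_L2 / (m%:R * h).
Proof.
apply: (le_trans (y := \sum_(j < m) m%:R^-1 * \int[mu]_(u in bin j) (Kx u ^+ 2))).
  by apply: ler_sum => j _; apply: Rintegral_sqr_le; exact: integrable_bin.
rewrite -mulr_sumr -Rintegral_bins //; last exact: integrable01.
by rewrite Kx_sqr invfM mulrCA.
Qed.

Lemma kernel_weight_abs_sum : \sum_(j < m) `|kernel_weight K h j x| <= kernel_L1.
Proof.
rewrite -Kx_abs (Rintegral_bins m0); last exact/integrable01/integrable_norm.
by apply: ler_sum => j _; apply: le_normr_Rintegral => //; exact: integrable_bin.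
Qed.

(** The vanishing moments make the kernel integrate the Taylor polynomial [p] exactly to [f x]. What
    is left is the integral of the kernel against [mu_ j - p u]: at most [delta] from [mu_ j] to
    [f u], and at most [L * h^beta] from [f u] to [p u] on the support. *)
Lemma kernel_weight_bias (f : R -> R) (mu_ : 'I_m -> R) (a : nat -> R) (beta L delta : R) :
  0 <= beta -> 0 <= L -> 0 <= delta ->
  (forall j u, bin j u -> `|f u - mu_ j| <= delta) ->
  (forall u, u \in `[0, 1] ->
    `|f u - f x - \sum_(k < l) a k * (u - x) ^+ k.+1| <= L * `|u - x| `^ beta) ->
  `|\sum_(j < m) kernel_weight K h j x * mu_ j - f x| <=
  kernel_L1 * (delta + L * h `^ beta).
Proof.
move=> beta0 L0 delta0 fmu taylor.
pose p u : R := f x + \sum_(k < l) a k * (u - x) ^+ k.+1.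
pose Kp u : R := Kx u * p u.
have KpE u : (Kp u)%:E = ((f x)%:E * (Kx u * (u - x) ^+ 0)%:E +
     \sum_(k <- enum 'I_l) (a k)%:E * (Kx u * (u - x) ^+ k.+1)%:E)%E.
  rewrite /Kp /p expr0 mulr1 mulrDr EFinD mulrC EFinM; congr (_ + _)%E.
  rewrite mulr_sumr -sumEFin big_enum; apply: eq_bigr => k _.
  by rewrite mulrCA EFinM.
have ip : mu.-integrable setT (EFin \o Kp).
  have -> : EFin \o Kp = (fun u => (f x)%:E * (Kx u * (u - x) ^+ 0)%:E +
     \sum_(k <- enum 'I_l) (a k)%:E * (Kx u * (u - x) ^+ k.+1)%:E)%E.
    by apply/funext => u; rewrite -KpE.
  apply: integrableD => //; first exact: (integrableZl _ _ (integrable_Kx_pow 0)).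
  by apply: integrable_sum => // k _; exact: (integrableZl _ _ (integrable_Kx_pow _)).
have Kp1 : \int[mu]_(u in `[0, 1]) Kp u = f x.
  rewrite /Rintegral; under eq_integral => u _ do rewrite KpE.
  rewrite integralD //; first last.
  - by apply: integrable_sum => // k _; apply: integrableZl => //; exact/integrable01/integrable_Kx_pow.
  - by apply: integrableZl => //; exact/integrable01/integrable_Kx_pow.
  rewrite integralZl //; last exact/integrable01/integrable_Kx_pow.
  rewrite integral_sum //; last first.
    by move=> k; apply: integrableZl => //; exact/integrable01/integrable_Kx_pow.
  have mom k : (k <= l)%N -> (\int[mu]_(u in `[0%R, 1%R]) (Kx u * (u - x) ^+ k)%:E = ((k == 0%N)%:R)%:E)%E.
    move=> kl; rewrite -(Kx_moment kl) fineK //.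
    exact/integrable_fin_num/integrable01/integrable_Kx_pow.
  rewrite mom // mule1 big1 ?adde0 // => k _.
  by rewrite integralZl ?mom ?mule0 //; exact/integrable01/integrable_Kx_pow.
rewrite -{1}Kp1 (Rintegral_bins m0); last exact: integrable01.
rewrite -sumrB; apply: le_trans (ler_norm_sum _ _ _) _.
have iKx := integrable_Kx; have ink := integrable_norm iKx.
rewrite -Kx_abs (Rintegral_bins m0); last exact: integrable01.
rewrite mulr_suml; apply: ler_sum => j _.
rewrite /kernel_weight -/(bin j) -[\int[mu]_(u in bin j) (_ * K _)]/(\int[mu]_(u in bin j) Kx u).
have imu : mu.-integrable (bin j) (EFin \o (fun u => Kx u * mu_ j)).
  exact: integrable_binZr.
have mj := mbin j.
rewrite -RintegralZr //; last exact: integrable_bin.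
rewrite -RintegralB //; last exact: integrable_bin.
have idf : mu.-integrable (bin j) (EFin \o (fun u => Kx u * mu_ j - Kp u)).
  by have := integrableB mj imu (integrable_bin j ip).
apply: le_trans (le_normr_Rintegral mj idf) _.
rewrite -RintegralZr //; last exact: integrable_bin.
apply: le_Rintegral => //; first exact: integrable_norm.
  exact: integrable_binZr.
move=> u ju; rewrite /Kp -mulrBr normrM.
have [ux|ux] := leP `|u - x| h; last by rewrite Kx_supp // normr0 !mul0r.
rewrite ler_wpM2l //.
have u01 : u \in `[0, 1] by exact: bin_sub01 ju.
have -> : mu_ j - p u = - (f u - mu_ j) + (f u - f x - \sum_(k < l) a k * (u - x) ^+ k.+1).
  by rewrite /p; ring.
apply: (le_trans (ler_normD _ _)); rewrite normrN lerD ?fmu //.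
apply: le_trans (taylor u u01) _; rewrite ler_wpM2l //.
by rewrite ge0_ler_powR // ?nnegrE // ltW.
Qed.

End Kernel.

(** * Measurability of the estimator and of its integrated error *)

Section Measurability.
Variable R : realType.
Local Notation mu := (@lebesgue_measure R).

(** A signed integral with a parameter: Tonelli is applied to the positive and negative parts
    separately. *)
Lemma measurable_kernel_weight (K : R -> R) (h : R) m (j : 'I_m) :
  measurable_fun setT K -> measurable_fun setT (kernel_weight K h j).
Proof.
move=> mK; pose D : set R := `[j%:R / m%:R, j.+1%:R / m%:R]%classic.
pose G (z : R * R) : R := h^-1 * K ((z.1 - z.2) / h) * \1_D z.2.
have mD : measurable_fun setT (\1_D : R -> R).
  by apply: measurable_indic; exact: measurable_itv.
have mG : measurable_fun setT G.
  apply: measurable_funM; last exact: (measurableT_comp mD measurable_snd).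
  apply: measurable_funM => //; apply: (measurableT_comp mK).
  apply: measurable_funM => //; apply: measurable_funB => //.
have mGE : measurable_fun setT (EFin \o G) by exact/measurable_EFinP.
have E x : kernel_weight K h j x =
    fine (\int[mu]_u ((EFin \o G)^\+ (x, u)) - \int[mu]_u ((EFin \o G)^\- (x, u)))%E.
  rewrite /kernel_weight /Rintegral -/D integral_mkcond integralE.
  congr (fine (_ - _)%E); apply: eq_integral => u _.
    rewrite !funeposE patchE /G /= indicE; case: ifP => _; rewrite ?mulr1 ?mulr0 //.
  by rewrite !funenegE patchE /G /= indicE; case: ifP => _; rewrite ?mulr1 ?mulr0 //.
rewrite (funext E); apply: measurableT_comp; first exact: fine_measurable.
apply: emeasurable_funB.
  have := @measurable_fun_fubini_tonelli_F _ _ (measurableTypeR R) (measurableTypeR R) R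
    mu (EFin \o G)^\+%E (measurable_funepos mGE).
  by apply => z; exact: funepos_ge0.
have := @measurable_fun_fubini_tonelli_F _ _ (measurableTypeR R) (measurableTypeR R) R
  mu (EFin \o G)^\-%E (measurable_funeneg mGE).
by apply => z; exact: funeneg_ge0.
Qed.

Lemma measurable_integral_sqr_error d (T : measurableType d) (I : finType)
    (W : I -> R -> R) (z : I -> T -> R) (f : R -> R) (D : set R) :
  measurable D -> (forall i, measurable_fun setT (W i)) ->
  (forall i, measurable_fun setT (z i)) -> measurable_fun D f ->
  measurable_fun setT (fun w =>
    (\int[mu]_(x in D) (`|\sum_i W i x * z i w - f x| ^+ 2)%:E)%E).
Proof.
move=> mD mW mz mf.
have m1 : measurable_fun setT (\1_D : R -> R) by exact: measurable_indic.
have mf' : measurable_fun setT (f \_ D) by apply/(measurable_restrictT _ _).1.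
pose G (p : T * R) : R := `|\sum_i W i p.2 * z i p.1 - (f \_ D) p.2| ^+ 2 * \1_D p.2.
have mG : measurable_fun setT (EFin \o G).
  apply/measurable_EFinP; apply: measurable_funM; last first.
    exact: (measurableT_comp m1 measurable_snd).
  apply: measurable_funX; apply: measurableT_comp => //; apply: measurable_funB.
    by apply: measurable_sum => i; apply: measurable_funM; apply: measurableT_comp.
  by apply: measurableT_comp.
have G0 p : (0 <= (EFin \o G) p)%E by rewrite lee_fin mulr_ge0 // sqr_ge0.
have := @measurable_fun_fubini_tonelli_F _ _ T _ R mu _ mG G0.
congr (measurable_fun _ _); apply/funext => w; rewrite [RHS]integral_mkcond.
apply: eq_integral => x _; rewrite patchE /G /= patchE indicE.
by case: ifP => _; rewrite ?mulr1 ?mulr0.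
Qed.

Lemma lipschitz_measurable (f : R -> R) (L a b : R) : 0 <= L ->
  (forall x y, x \in `[a, b] -> y \in `[a, b] -> `|f x - f y| <= L * `|x - y|) ->
  measurable_fun `[a, b] f.
Proof.
move=> L0 fL; apply: subspace_continuous_measurable_fun => //.
apply/subspace_continuousP => x xab; apply/cvgrPdist_lt => e e0.
have L1 : 0 < L + 1 by rewrite ltr_wpDl.
apply/nbhs_ballP; exists (e / (L + 1)) => /=; first by rewrite divr_gt0.
move=> y; rewrite /ball /= ltr_pdivlMr // mulrC => xy yab.
apply: le_lt_trans (fL x y xab yab) _; apply: le_lt_trans xy.
by rewrite ler_wpM2r // lerDl.
Qed.

(** Preimages of upper rays under an order statistic are count events, measurable by induction on
    the bin. *)
Lemma measurable_median d (T : measurableType d) n (y : 'I_n -> T -> R) (B : seq 'I_n) :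
  (forall i, measurable_fun setT (y i)) ->
  measurable_fun setT (fun w => median [seq y i w | i <- B]).
Proof.
move=> my; rewrite /median; apply: measurable_funM => //.
have H k : measurable_fun setT (fun w => (sort <=%R [seq y i w | i <- B])`_k).
  have [kB|kB] := ltnP k (size B); last first.
    rewrite (_ : (fun w => _) = cst 0) //; apply/funext => w.
    by rewrite nth_default // size_sort size_map.
  apply: (measurability _ (RGenOInfty.measurableE R)).
  move=> _ [_ [v ->] <-]; rewrite setTI.
  have -> : (fun w => (sort <=%R [seq y i w | i <- B])`_k) @^-1` `]v, +oo[%classic =
      [set w | (size B - k <= count (fun i => v < y i w)%R B)%N].
    apply/seteqP; split => w /=; rewrite in_itv /= andbT lt_nth_sort ?size_map // count_map //.
  elim: B (size B - k)%N {kB} => [|i B IH] r.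
    by case: r => [|r]; [rewrite (_ : [set _ | _] = setT)|rewrite (_ : [set _ | _] = set0)] => //; apply/seteqP; split.
  have -> : [set w | (r <= count (fun i0 => v < y i0 w)%R (i :: B))%N] =
     (y i @^-1` `]v, +oo[%classic `&` [set w | (r.-1 <= count (fun i => v < y i w)%R B)%N]) `|`
     [set w | (r <= count (fun i => v < y i w)%R B)%N].
    apply/seteqP; split => w /=; rewrite in_itv /= andbT.
      by case: ltP => _ H; [left; split => //; lia|right; lia].
    by case: ltP => _ [[? ?]|?] //; lia.
  apply: measurableU => //; apply: measurableI => //.
  by rewrite -[X in measurable X]setTI; exact: my.
by apply: measurable_funD; rewrite ?size_map; under eq_fun do rewrite size_map; exact: H.
Qed.

End Measurability.

(** * Rates and constants *)

Section Rates.
Variable R : realType.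
Implicit Types (A L beta h N M s : R).

Lemma powRD_gt0 (x a b : R) : 0 < x -> x `^ (a + b) = x `^ a * x `^ b.
Proof. by move=> x0; rewrite powRD //; apply/implyP => _; exact: lt0r_neq0. Qed.

Lemma powRB_gt0 (x a b : R) : 0 < x -> x `^ (a - b) = x `^ a / x `^ b.
Proof. by move=> x0; rewrite powRD_gt0 // powRN. Qed.

Definition rate N beta : R := N `^ (- (2 * beta / (2 * beta + 1))).

Lemma rateE N beta : 0 < N -> 0 < beta ->
  rate N beta = N `^ (1 / (2 * beta + 1)) / N.
Proof.
move=> N0 b0; rewrite /rate.
have -> : - (2 * beta / (2 * beta + 1)) = 1 / (2 * beta + 1) - 1.
  by field; apply: lt0r_neq0; lra.
by rewrite powRB_gt0 // powRr1 // ltW.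
Qed.

Lemma rate_ge N beta : 1 <= N -> 0 < beta -> N^-1 <= rate N beta.
Proof.
move=> N1 b0; have N0 : 0 < N by exact: lt_le_trans N1.
rewrite rateE // ler_peMl ?invr_ge0 ?(ltW N0) //.
rewrite -[leLHS](powRr0 N) ler_powR // divr_ge0 //; lra.
Qed.

(** With [a = 1 / (2 * beta + 1)], [ln y <= y] at [y = N^(2a)] costs a factor [(2 * beta + 1) / 2],
    replaced by one in [l] to be uniform in [beta]. *)
Lemma sqrt_ln_le N beta (l : nat) : 1 <= N -> 1 < beta -> beta < l.+1%:R ->
  Num.sqrt (ln N) / N <= (2 * l%:R + 3) * rate N beta.
Proof.
move=> N1 b1 bl; have N0 : 0 < N by exact: lt_le_trans N1.
rewrite rateE //; last by lra.
rewrite mulrA ler_pM2r ?invr_gt0 //.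
set a := 1 / (2 * beta + 1).
have lb : beta < l%:R + 1 by rewrite natr1.
have a0 : 0 < a by rewrite divr_gt0 //; lra.
have p0 := powR_ge0 N a.
have H : 2 * a * ln N <= (N `^ a) ^+ 2.
  have -> : (N `^ a) ^+ 2 = N `^ (2 * a).
    by rewrite -powR_mulrn // -powRrM mulrC.
  by rewrite -ln_powR; apply/ltW/ln_sublinear; exact: powR_gt0.
have l3 : 1 <= 2 * l%:R + 3 :> R by have := ler0n R l; lra.
have c0 : 0 <= (2 * l%:R + 3) * N `^ a by rewrite mulr_ge0 //; lra.
rewrite -[leRHS](ger0_norm c0) -sqrtr_sqr ler_wsqrtr //.
have -> : ln N = (2 * beta + 1) / 2 * (2 * a * ln N).
  by rewrite /a; field; apply: lt0r_neq0; lra.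
have q0 : 0 <= 2 * a * ln N by rewrite mulr_ge0 ?ln_ge0 // mulr_ge0 // ltW.
rewrite exprMn; apply: ler_pM => //; first by lra.
by nra.
Qed.

(** Trades an exponent depending on [beta] for a uniform bound, as [CL] is chosen before [beta]. *)
Lemma powR_sqr_le L a : 0 < L -> 0 <= a -> a <= 1 -> (L ^+ 2) `^ a <= 1 + L ^+ 2.
Proof.
move=> L0 a0 a1; have L2 : 0 <= L ^+ 2 by exact: sqr_ge0.
apply: (le_trans (y := (1 + L ^+ 2) `^ a)).
  by rewrite ge0_ler_powR ?nnegrE ?lerDr ?addr_ge0.
by rewrite ler1_powR // lerDl.
Qed.

Lemma inv_bandwidth_le A L N beta h : 1 <= A -> 0 < L -> 1 <= N -> 0 < beta -> 0 < h ->
  A^-1 * (N * L ^+ 2) `^ (- (1 / (2 * beta + 1))) <= h ->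
  h^-1 <= A * (1 + L ^+ 2) * N `^ (1 / (2 * beta + 1)).
Proof.
move=> A1 L0 N1 b0 h0; set a := 1 / (2 * beta + 1).
have a0 : 0 <= a by rewrite divr_ge0 //; lra.
have a1 : a <= 1 by rewrite ler_pdivrMr; lra.
have N0 : 0 < N by exact: lt_le_trans N1.
have NL : 0 < N * L ^+ 2 by rewrite mulr_gt0 // exprn_gt0.
rewrite powRN -invfM => H.
have p0 : 0 < (N * L ^+ 2) `^ a by rewrite powR_gt0.
have {}H : h^-1 <= A * (N * L ^+ 2) `^ a.
  rewrite -[leRHS]invrK lef_pV2 ?posrE // ?invr_gt0 mulr_gt0 //; lra.
apply: le_trans H _; rewrite powRM ?sqr_ge0 ?(ltW N0) //.
rewrite -mulrA ler_wpM2l ?(le_trans ler01 A1) //.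
by rewrite mulrC ler_wpM2r ?powR_ge0 // powR_sqr_le.
Qed.

Lemma bandwidth_bias_le A L N beta h (l : nat) : 1 <= A -> 0 < L -> 1 <= N -> 0 < beta -> 0 < h ->
  beta < l.+1%:R ->
  h <= A * (N * L ^+ 2) `^ (- (1 / (2 * beta + 1))) ->
  (L * h `^ beta) ^+ 2 <= A ^+ (l.+1).*2 * (1 + L ^+ 2) * rate N beta.
Proof.
move=> A1 L0 N1 b0 h0 bl hA; set a := 1 / (2 * beta + 1).
have a0 : 0 <= a by rewrite divr_ge0 //; lra.
have a1 : a <= 1 by rewrite ler_pdivrMr; lra.
have N0 : 0 < N by exact: lt_le_trans N1.
have L2 : 0 < L ^+ 2 by rewrite exprn_gt0.
have NL : 0 < N * L ^+ 2 by rewrite mulr_gt0.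
have A0 : 0 <= A by lra.
have E1 : (h `^ beta) ^+ 2 = h `^ (2 * beta).
  by rewrite -powR_mulrn ?powR_ge0 // -powRrM mulrC.
have E2 : h `^ (2 * beta) <= A `^ (2 * beta) * (N `^ (- (2 * beta * a)) * (L ^+ 2) `^ (- (2 * beta * a))).
  apply: (le_trans (y := (A * (N * L ^+ 2) `^ (- a)) `^ (2 * beta))).
    by rewrite ge0_ler_powR ?nnegrE ?mulr_ge0 ?powR_ge0 ?(ltW h0) ?(ltW b0).
  rewrite powRM ?powR_ge0 // -powRrM powRM ?(ltW N0) ?(ltW L2) //.
  by rewrite (_ : - a * (2 * beta) = - (2 * beta * a)) // ; ring.
(* The exponents balance: [1 - 2 * beta * a = a]. *)
have E3 : L ^+ 2 * (L ^+ 2) `^ (- (2 * beta * a)) = (L ^+ 2) `^ a.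
  rewrite -[X in X * _](powRr1 (ltW L2)) -powRD_gt0 //.
  by congr (_ `^ _); rewrite /a; field; apply: lt0r_neq0; lra.
have E4 : A `^ (2 * beta) <= A ^+ (l.+1).*2.
  by rewrite -powR_mulrn // ler_powR // -muln2 natrM mulrC ler_wpM2r // ltW.
have E5 : N `^ (- (2 * beta * a)) = rate N beta by rewrite /rate /a mulrA mulr1.
rewrite exprMn E1; apply: (le_trans (ler_wpM2l (ltW L2) E2)).
have -> : L ^+ 2 * (A `^ (2 * beta) * (N `^ (- (2 * beta * a)) * (L ^+ 2) `^ (- (2 * beta * a)))) =
   A `^ (2 * beta) * (L ^+ 2 * (L ^+ 2) `^ (- (2 * beta * a))) * N `^ (- (2 * beta * a)) by ring.
rewrite E3 E5 ler_wpM2r ?powR_ge0 // ler_pM ?powR_ge0 //.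
exact: powR_sqr_le.
Qed.

(** The exponent 1/12 is half of the margin 1/6 available in [bin_bandwidth_le]. *)
Lemma ln_root_le N : 1 <= N -> (ln N) `^ (1 / 4) <= 3 * N `^ (1 / 12).
Proof.
move=> N1; have N0 : 0 < N by exact: lt_le_trans N1.
have ln0 := ln_ge0 N1.
have p0 := powR_ge0 N (1 / 12).
have H : ln N <= (3 * N `^ (1 / 12)) `^ 4.
  have E : N `^ (1 / 12) `^ 4 = N `^ (1 / 3) by rewrite -powRrM; congr (_ `^ _); field.
  rewrite powRM // E.
  have H1 : 1 / 3 * ln N <= N `^ (1 / 3).
    by rewrite -ln_powR; apply/ltW/ln_sublinear; exact: powR_gt0.
  have H2 : 3 <= 3 `^ 4 :> R by rewrite le1r_powR //; lra.
  by have := powR_ge0 N (1 / 3); nra.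
have -> : 3 * N `^ (1 / 12) = ((3 * N `^ (1 / 12)) `^ 4) `^ (1 / 4).
  by rewrite -powRrM (_ : 4 * (1 / 4) = 1) ?powRr1 //; [rewrite mulr_ge0|field].
by rewrite ge0_ler_powR ?nnegrE ?powR_ge0 //; lra.
Qed.

(* [y := 3 A^2 (1 + L^2) N^(-1/12)] bounds the left-hand side, and
   [y <= 1 + y^12]. The constant in front of [1] must not depend on [L], since it
   multiplies [eps^2] in the final bound. *)
Lemma bin_bandwidth_le A L N M beta h : 1 <= A -> 0 < L -> 1 < N -> 1 < beta -> 0 < h ->
  0 < M ->
  A^-1 * (Num.sqrt N / (ln N) `^ (1 / 4)) <= M ->
  A^-1 * (N * L ^+ 2) `^ (- (1 / (2 * beta + 1))) <= h ->
  (M * h)^-1 <= 1 + (3 * A ^+ 2 * (1 + L ^+ 2)) ^+ 12 / N.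
Proof.
move=> A1 L0 N1 b1 h0 M0 HM Hh.
have N0 : 0 < N by exact: lt_trans N1.
have A0 : 0 < A by lra.
have Hi := inv_bandwidth_le A1 L0 (ltW N1) (lt_trans ltr01 b1) h0 Hh.
set a := 1 / (2 * beta + 1) in Hi.
have ln0 : 0 < (ln N) `^ (1 / 4) by rewrite powR_gt0 // ln_gt0.
have S0 : 0 < Num.sqrt N by rewrite sqrtr_gt0.
have Mi : M^-1 <= A * ((ln N) `^ (1 / 4) / Num.sqrt N).
  rewrite -[leRHS]invrK lef_pV2 ?posrE ?invr_gt0 ?mulr_gt0 ?invr_gt0 //.
  by rewrite invfM invf_div.
have c0 : 0 < 1 + L ^+ 2 by rewrite ltr_pwDl // sqr_ge0.
pose B := 3 * A ^+ 2 * (1 + L ^+ 2).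
pose y := B * N `^ (- (1 / 12)).
have B0 : 0 < B by rewrite !mulr_gt0 // exprn_gt0.
have H : (M * h)^-1 <= y.
  rewrite invfM; apply: (le_trans (ler_pM _ _ Mi Hi)); rewrite ?invr_ge0 ?(ltW M0) ?(ltW h0) //.
  (* [beta > 1] gives [a <= 1 / 3], hence the exponent [1 / 3 - 1 / 2 = - 1 / 6]; half of it pays
     for the logarithm. *)
  have E : N `^ a / Num.sqrt N <= N `^ (- (1 / 6)).
    rewrite -powR12_sqrt ?(ltW N0) // -powRB_gt0 //.
    rewrite ler_powR ?(ltW N1) //.
    have : a <= 1 / 3 by rewrite ler_pdivrMr; lra.
    by lra.
  have E2 : N `^ (1 / 12) * N `^ (- (1 / 6)) = N `^ (- (1 / 12)).
    by rewrite -powRD_gt0 //; congr (_ `^ _); field.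
  have -> : A * ((ln N) `^ (1 / 4) / Num.sqrt N) * (A * (1 + L ^+ 2) * N `^ a) =
     A ^+ 2 * (1 + L ^+ 2) * ((ln N) `^ (1 / 4) * (N `^ a / Num.sqrt N)) by ring.
  have -> : y = A ^+ 2 * (1 + L ^+ 2) * (3 * N `^ (1 / 12) * N `^ (- (1 / 6))).
    by rewrite /y /B -E2; ring.
  rewrite ler_wpM2l ?mulr_ge0 ?(ltW A0) ?(ltW c0) //.
  by rewrite ler_pM ?mulr_ge0 ?powR_ge0 ?invr_ge0 ?(ltW S0) ?(ltW ln0) // ln_root_le // ltW.
apply: le_trans H _; rewrite -/B.
have y12 : y ^+ 12 = B ^+ 12 / N.
  rewrite exprMn -[X in _ * X = _]powR_mulrn ?powR_ge0 // -powRrM.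
  by rewrite (_ : - (1 / 12) * 12%:R = -1) ?powR_inv1 ?(ltW N0) //; field.
have [y1|y1] := leP y 1.
  by apply: (le_trans y1); rewrite lerDl divr_ge0 ?exprn_ge0 ?(ltW N0) ?(ltW B0).
rewrite -y12; apply: (le_trans (y := y ^+ 12)); last by rewrite lerDr.
by rewrite ler_eXnr // ltW.
Qed.

(** Squaring turns the fourth root of the logarithm into the square root that [sqrt_ln_le]
    absorbs. *)
Lemma bin_width_le A L N M beta (l : nat) : 1 <= A -> 0 < L -> 1 < N -> 1 < beta ->
  beta < l.+1%:R -> 0 < M ->
  A^-1 * (Num.sqrt N / (ln N) `^ (1 / 4)) <= M ->
  (L / M) ^+ 2 <= L ^+ 2 * A ^+ 2 * (2 * l%:R + 3) * rate N beta.
Proof.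
move=> A1 L0 N1 b1 bl M0 HM.
have N0 : 0 < N by exact: lt_trans N1.
have A0 : 0 < A by lra.
have ln0 : 0 < (ln N) `^ (1 / 4) by rewrite powR_gt0 // ln_gt0.
have S0 : 0 < Num.sqrt N by rewrite sqrtr_gt0.
have Mi : M^-1 <= A * ((ln N) `^ (1 / 4) / Num.sqrt N).
  rewrite -[leRHS]invrK lef_pV2 ?posrE ?invr_gt0 ?mulr_gt0 ?invr_gt0 //.
  by rewrite invfM invf_div.
have {}Mi : M^-1 ^+ 2 <= A ^+ 2 * (Num.sqrt (ln N) / N).
  have -> : A ^+ 2 * (Num.sqrt (ln N) / N) = (A * ((ln N) `^ (1 / 4) / Num.sqrt N)) ^+ 2.
    rewrite !exprMn exprVn sqr_sqrtr ?(ltW N0) //; congr (_ * (_ / _)).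
    rewrite -powR_mulrn ?powR_ge0 // -powRrM -powR12_sqrt ?ln_ge0 ?ltW //.
    by congr (_ `^ _); field.
  rewrite ler_pXn2r // ?nnegrE ?invr_ge0 ?(ltW M0) //.
  by rewrite !mulr_ge0 ?invr_ge0 ?(ltW A0) ?(ltW ln0) ?(ltW S0).
have H := sqrt_ln_le (ltW N1) b1 bl.
have -> : L ^+ 2 * A ^+ 2 * (2 * l%:R + 3) * rate N beta =
    L ^+ 2 * (A ^+ 2 * ((2 * l%:R + 3) * rate N beta)) by ring.
rewrite exprMn ler_wpM2l ?sqr_ge0 //; apply: le_trans Mi _.
by rewrite ler_wpM2l ?sqr_ge0.
Qed.

Lemma expR_opp_le (y : R) : 0 < y -> expR (- y) <= 4 / y ^+ 2.
Proof.
move=> y0; rewrite expRN -[leRHS]invrK invf_div lef_pV2 ?posrE ?expR_gt0 ?divr_gt0 ?exprn_gt0 //.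
have -> : y ^+ 2 / 4 = (y / 2) ^+ 2 by field.
have -> : expR y = expR (y / 2) ^+ 2 by rewrite -expRM_natr; congr expR; field.
rewrite ler_pXn2r ?nnegrE ?expR_ge0 ?divr_ge0 ?(ltW y0) //.
by apply: le_trans (expR_ge1Dx _); lra.
Qed.

(** With [s >= sqrt n / A] and [m <= A * sqrt n], the bound [exp (- y) <= 4 / y^2] leaves at most
    [16 * A^3 * c^2 / sqrt n]. The first summand of the threshold makes this [1 / 20], the second
    makes [s >= 3]. *)
Lemma bin_count_bounds A (n m : nat) : 1 <= A -> (0 < m)%N -> (m %| n)%N -> (4 <= n)%N ->
  m%:R <= A * (Num.sqrt n%:R / (ln n%:R) `^ (1 / 4)) ->
  let c := 200 * 400 : R in
  320 * c ^+ 2 * A ^+ 3 + 3 * A <= Num.sqrt n%:R ->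
  (3 <= n %/ m)%N /\ (4 * m)%:R * expR (- ((n %/ m)%:R / c)) <= 1 / 20.
Proof.
move=> A1 m0 mn n4 mA c nA.
have A0 : 0 < A by lra.
have c0 : 0 < c by rewrite /c; lra.
clearbody c.
have n0 : 0 < n%:R :> R by rewrite ltr0n; lia.
have S0 : 0 < Num.sqrt n%:R :> R by rewrite sqrtr_gt0.
set S := Num.sqrt n%:R in mA nA S0.
have S2 : S ^+ 2 = n%:R by rewrite sqr_sqrtr // ltW.
have ln1 : 1 <= ln n%:R :> R.
  rewrite -[leLHS](expRK 1) ler_ln ?posrE ?expR_gt0 //.
  apply: (le_trans (y := 4)); last by rewrite ler_nat.
  have H : 1 / 2 <= expR (- (1 / 2)) :> R by apply: le_trans (expR_ge1Dx _); lra.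
  have g0 := expR_gt0 (1 / 2 : R).
  have := ler_wpM2r (ltW g0) H; rewrite expRN mulVf ?gt_eqF // => {}H.
  have -> : expR 1 = expR (1 / 2) ^+ 2 :> R by rewrite -expRM_natr; congr expR; field.
  by rewrite expr2; nra.
have mS : m%:R <= A * S.
  apply: (le_trans mA); rewrite ler_pM2l // ler_pdivrMr ?powR_gt0 ?(lt_le_trans ltr01) //.
  rewrite ler_peMr ?(ltW S0) // -[leLHS](powRr0 (ln n%:R)) ler_powR //.
have sm : (n %/ m)%:R * m%:R = n%:R :> R by rewrite -natrM divnK.
have mR : 0 < m%:R :> R by rewrite ltr0n.
have sS : S <= A * (n %/ m)%:R.
  rewrite -(ler_pM2r S0) -expr2 S2 -sm.
  have -> : A * (n %/ m)%:R * S = (n %/ m)%:R * (A * S) by ring.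
  by rewrite ler_wpM2l.
have cA : 0 <= 320 * c ^+ 2 * A ^+ 3.
  by rewrite mulr_ge0 ?mulr_ge0 ?ler0n ?exprn_ge0 ?(ltW c0) ?(ltW A0).
have s3 : (3 <= n %/ m)%N.
  rewrite -(ler_nat R) -(ler_pM2l A0); lra.
split => //.
have s0 : 0 < (n %/ m)%:R :> R by rewrite ltr0n; exact: leq_trans s3.
set s := (n %/ m)%:R in sm sS s0 *.
have H := @expR_opp_le (s / c) (divr_gt0 s0 c0).
rewrite natrM; apply: (le_trans (y := 4 * (A * S) * (4 / (s / c) ^+ 2))).
  by rewrite ler_pM ?mulr_ge0 ?expR_ge0 // ler_pM2l.
have -> : 4 * (A * S) * (4 / (s / c) ^+ 2) = 16 * A * c ^+ 2 * S / s ^+ 2.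
  by field; rewrite (gt_eqF s0) (gt_eqF c0).
rewrite ler_pdivrMr ?exprn_gt0 //.
have H2 : S ^+ 2 <= A ^+ 2 * s ^+ 2.
  by rewrite -exprMn lerXn2r ?nnegrE ?mulr_ge0 ?(ltW S0) ?(ltW A0) ?(ltW s0).
rewrite -(ler_pM2l (_ : 0 < A ^+ 2)) ?exprn_gt0 //.
have H3 : 320 * c ^+ 2 * A ^+ 3 * S <= S ^+ 2.
  by rewrite [leRHS]expr2 ler_wpM2r ?(ltW S0) //; lra.
have -> : A ^+ 2 * (16 * A * c ^+ 2 * S) = (320 * c ^+ 2 * A ^+ 3 * S) / 20.
  by rewrite !exprS expr0; field.
by lra.
Qed.

End Rates.

(** * From moments to the integrated squared error *)

Section IntegratedError.
Variable R : realType.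
Local Notation leb := (@lebesgue_measure R).

(** Exchange of a finite mean and an integral. The bound [b x] ensures finite integrals, so that
    passing to real-valued ones is faithful. *)
Lemma law_mean_Rintegral_le d (T : measurableType d) (P : probability T R)
    (F : finType) (X : T -> F) (D : set R) (g : F -> R -> R) (b : F -> R) (V : R) :
  measurable D -> (leb D <= 1)%E -> 0 <= V ->
  (forall x, measurable_fun D (g x)) ->
  (forall x t, D t -> 0 <= g x t <= b x) ->
  (forall t, D t -> law_mean P X (fun x => g x t) <= V) ->
  (forall x, (\int[leb]_(t in D) (g x t)%:E = (\int[leb]_(t in D) g x t)%R%:E)%E) /\
  law_mean P X (fun x => \int[leb]_(t in D) g x t) <= V.
Proof.
move=> mD D1 V0 mg g0b gV.
have mgE x : measurable_fun D (EFin \o g x) by exact/measurable_EFinP.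
have g0 x t : D t -> (0 <= (g x t)%:E)%E by move=> /(g0b x)/andP[? _]; rewrite lee_fin.
have le_cst (h : R -> \bar R) c : 0 <= c -> measurable_fun D h ->
    (forall t, D t -> (0 <= h t)%E) -> (forall t, D t -> (h t <= c%:E)%E) ->
    (\int[leb]_(t in D) h t <= c%:E)%E.
  move=> c0 mh h0 hc; apply: (le_trans (y := (\int[leb]_(t in D) cst c%:E t)%E)).
    by apply: ge0_le_integral.
  by rewrite integral_cst // -[leRHS]mule1 lee_wpmul2l // lee_fin.
have fin x : (\int[leb]_(t in D) (g x t)%:E = (\int[leb]_(t in D) g x t)%R%:E)%E.
  rewrite /Rintegral fineK // ge0_fin_numE; last by apply: integral_ge0 => t; exact: g0.
  have [b0|b0] := leP 0 (b x).
    apply: le_lt_trans (le_cst _ _ b0 (mgE x) (g0 x) _) (ltry _) => t Dt.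
    by rewrite lee_fin; have /andP[] := g0b x t Dt.
  rewrite (_ : D = set0) ?integral_set0 ?ltry //.
  apply/seteqP; split => // t Dt; have /andP[h1 h2] := g0b x t Dt.
  by have := le_trans h1 h2; rewrite leNgt b0.
split=> //; rewrite -lee_fin /law_mean -sumEFin.
have -> : (\sum_(x : F) (prob P (X @^-1` [set x]) * \int[leb]_(t in D) g x t)%:E)%E =
    (\int[leb]_(t in D) \sum_(x <- enum F) (prob P (X @^-1` [set x]) * g x t)%:E)%E.
  rewrite ge0_integral_sum //; first last.
  - by move=> x t Dt; rewrite EFinM mule_ge0 ?g0 // lee_fin prob_ge0.
  - by move=> x; apply/measurable_EFinP; apply: measurable_funM => //; exact: mg.
  rewrite big_enum; apply: eq_bigr => x _; rewrite EFinM -fin -ge0_integralZl //.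
  - exact: mgE.
  - by move=> t Dt; exact: g0.
  - by rewrite lee_fin prob_ge0.
have sumE t : (\sum_(x <- enum F) (prob P (X @^-1` [set x]) * g x t)%:E)%E =
    (law_mean P X (fun x => g x t))%:E by rewrite sumEFin big_enum.
under eq_integral => t _ do rewrite sumE.
apply: le_cst => //.
- apply/measurable_EFinP; apply: measurable_sum => x; apply: measurable_funM => //; exact: mg.
- move=> t Dt; rewrite lee_fin; apply: sumr_ge0 => x _; rewrite mulr_ge0 ?prob_ge0 //.
  by have /andP[] := g0b x t Dt.
Qed.

(** [40 * V + 2 / n] is twice the Markov level [20 * V + 1 / n]; this factor 2 and the one before
    [Z ^+ 2] come from [(a + b)^2 <= 2 a^2 + 2 b^2]. *)
Lemma smoothed_median_error (l : nat) (K : R -> R) (beta L c eps h delta V Z bound : R) (n m : nat)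
    (f : R -> R) (Q : 'I_n -> probability R R)
    d (T : measurableType d) (P : probability T R) (Y : 'I_n -> {RV P >-> R}) :
  is_kernel l K -> 1 < beta -> Num.truncn beta = l -> 0 < L ->
  0 <= eps -> eps <= 1 / 4 -> hoelder_class beta L f -> huber_model eps f Q Y ->
  (0 < n)%N -> (0 < m)%N -> (m %| n)%N -> (3 <= n %/ m)%N ->
  0 < h -> h < c -> c < 1 / 2 ->
  (4 * m)%:R * expR (- ((n %/ m)%:R / (200 * 400))) <= 1 / 20 :> R ->
  delta = L / m%:R ->
  V = kernel_L2 K / (m%:R * h) *
    (2 * (25 * (eps + delta) + 2 / n%:R + 50 / Num.sqrt (n %/ m)%:R)) ^+ 2 ->
  Z = kernel_L1 K * (229 * (eps + delta) + 2 / n%:R + delta + L * h `^ beta) ->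
  40 * V + 2 / n%:R + 2 * Z ^+ 2 <= bound ->
  ((9 / 10)%:E <= P [set w | (\int[leb]_(x in `[c, (1 - c)%R])
      (`|smoothed_median K m h (fun i => Y i w) x - f x| ^+ 2)%:E
      <= bound%:E)%E])%E.
Proof.
move=> kerK b1 bl L0 eps0 eps14 fH hub n0 m0 mn s3 h0 hc c12 out deltaE VE ZE VZB.
have mR : 0 < m%:R :> R by rewrite ltr0n.
have nR : 0 < n%:R :> R by rewrite ltr0n.
have delta0 : 0 <= delta by rewrite deltaE divr_ge0 // ltW.
pose mu (j : 'I_m) : R := f (j.+1%:R / m%:R).
have mu_near (j : 'I_m) u : j%:R / m%:R <= u -> u <= j.+1%:R / m%:R -> `|f u - mu j| <= delta.
  move=> ju uj.
  have u01 : u \in `[0, 1] by apply: (@bin_sub01 R m j); rewrite /= in_itv /= ju.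
  have j01 : j.+1%:R / m%:R \in `[0, 1 : R].
    by apply: (@bin_sub01 R m j); rewrite /= in_itv /= lexx (le_trans ju).
  apply: le_trans (hoelder_lipschitz b1 fH j01 u01) _.
  rewrite deltaE ler_wpM2l ?(ltW L0) // distrC ger0_norm ?subr_ge0 //.
  have mE : m%:R^-1 = j.+1%:R / m%:R - j%:R / m%:R :> R by rewrite -mulrBl -natrB // subSnn mul1r.
  by rewrite [leRHS]mE lerD2l lerN2.
have fmu (j : 'I_m) (i : 'I_n) : i \in bin_seq R n j -> `|f (design R i) - mu j| <= delta.
  by move=> /(bin_seq_near m0 n0)[_ _ []]; exact: mu_near.
(* [N] exceeds [(1 + delta) * n], so the mesh is at most [1 / n], while the grid ends exactly at the
   level [1 + delta] of [outlying_bins]. *)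
pose N := ((Num.truncn (1 + delta)).+1 * n)%N.
pose eta := (1 + delta) / N%:R.
have N0 : 0 < N%:R :> R by rewrite ltr0n /N muln_gt0.
have eta0 : 0 <= eta by rewrite divr_ge0 ?addr_ge0 // ltW.
have Neta : N%:R * eta = 1 + delta by rewrite mulrC divfK // gt_eqF.
have eta_n : eta <= n%:R^-1.
  rewrite /eta ler_pdivrMr // /N natrM mulrCA mulVf ?mulr1 ?gt_eqF //.
  by apply/ltW; rewrite truncnS_gt.
pose s := (n %/ m)%N.
have etas : eta * Num.sqrt s%:R <= 1.
  have sn : Num.sqrt s%:R <= n%:R :> R.
    rewrite -(ger0_norm (ler0n R n)) -sqrtr_sqr ler_wsqrtr // -natrX ler_nat.
    by apply: leq_trans (leq_div n m) _; rewrite -[X in (X <= _)%N]muln1 leq_mul2l n0 orbT.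
  apply: (le_trans (y := n%:R^-1 * n%:R)); last by rewrite mulVf // gt_eqF.
  by rewrite ler_pM // sqrtr_ge0.
pose X := bin_pattern Y mu eta N.
have mX x : measurable (X @^-1` [set x]) by exact: measurable_bin_pattern.
pose D (j : 'I_m) := rounded_deviation (R := R) eta (N := N) j.
pose dj j := law_mean P X (D j).
pose W (j : 'I_m) (x : R) : R := kernel_weight K h j x.
pose g x t := (\sum_j W j t * (D j x - dj j)) ^+ 2.
pose dom : set R := `[c, (1 - c)%R]%classic.
have dom_h t : dom t -> h < t /\ t < 1 - h.
  by rewrite /dom /= in_itv /= => /andP[H1 H2]; clear - H1 H2 hc; split; lra.
have mD : measurable dom by exact: measurable_itv.
have D1 : (leb dom <= 1)%E.
  rewrite /dom lebesgue_measure_itv /= lte_fin; case: ifP => _; last exact: lee01.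
  by rewrite -EFinB lee_fin; lra.
have M0 := kernel_L1_ge0 K; have L20 := kernel_L2_ge0 K.
have mh0 : 0 < m%:R * h by rewrite mulr_gt0.
have V0 : 0 <= V by rewrite VE mulr_ge0 ?sqr_ge0 // divr_ge0 // ltW.
have mW j : measurable_fun setT (W j) by apply: measurable_kernel_weight; case: kerK.
have mg x : measurable_fun dom (g x).
  apply: measurable_funX; apply: measurable_sum => j.
  by apply: measurable_funM => //; exact: measurable_funTS.
have rho0 : 0 <= eps + delta by rewrite addr_ge0.
have Wabs t (y : 'I_m -> R) (B : R) : dom t -> (forall j, `|y j| <= B) ->
    `|\sum_j W j t * y j| <= kernel_L1 K * B.
  move=> /dom_h[ht th] yB.
  have B0 : 0 <= B.
    by apply: le_trans (yB (Ordinal m0)); exact: normr_ge0.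
  apply: le_trans (ler_norm_sum _ _ _) _.
  apply: (le_trans (y := \sum_j `|W j t| * B)).
    by apply: ler_sum => j _; rewrite normrM ler_wpM2l.
  by rewrite -mulr_suml ler_wpM2r //; exact: (kernel_weight_abs_sum kerK h0 ht th).
pose b x := (kernel_L1 K * \sum_j `|D j x - dj j|) ^+ 2.
have g0b x t : dom t -> 0 <= g x t <= b x.
  move=> Dt; rewrite sqr_ge0 /= /g /b -[leLHS]real_normK ?num_real //.
  rewrite lerXn2r ?nnegrE ?mulr_ge0 ?sumr_ge0 //.
  apply: Wabs => // j; rewrite (bigD1 j) //= lerDl sumr_ge0 //.
have gV t : dom t -> law_mean P X (fun x => g x t) <= V.
  move=> /dom_h[ht th].
  apply: le_trans (law_variance_sum mX (fun j => W j t) _) _.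
    by move=> i j ij; apply: (rounded_deviation_uncorrelated eps0 eps14 hub m0 mn s3 _ _ delta0 eta0 ij).
  apply: (le_trans (y := (\sum_j W j t ^+ 2) *
     (2 * (25 * (eps + delta) + 2 / n%:R + 50 / Num.sqrt s%:R)) ^+ 2)).
    rewrite mulr_suml; apply: ler_sum => j _; rewrite ler_wpM2l ?sqr_ge0 //.
    apply: le_trans (rounded_deviation_second_moment eps0 eps14 hub m0 mn s3 delta0 eta0 Neta fmu j) _.
    have q0 : 0 <= 50 / Num.sqrt s%:R :> R by rewrite divr_ge0 ?sqrtr_ge0.
    have ni : 0 <= n%:R^-1 :> R by rewrite invr_ge0.
    rewrite -/s; move: (50 / _) q0 => q q0; clearbody eta; clear - rho0 ni q0 eta0 eta_n.
    by rewrite ler_pXn2r // ?nnegrE; lra.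
  rewrite VE ler_wpM2r ?sqr_ge0 //.
  exact: (kernel_weight_sqr_sum kerK h0 ht th m0).
have [gfin gmean] := law_mean_Rintegral_le mD D1 V0 mg g0b gV.
pose I x := \int[leb]_(t in dom) g x t.
(* The factor 20 makes Markov's inequality yield [1 / 20], half of the failure probability; [1 / n]
   keeps [a] positive even if [V] vanishes. *)
pose a := 20 * V + n%:R^-1.
have ni0 : 0 < n%:R^-1 :> R by rewrite invr_gt0.
have a0 : 0 < a by rewrite ltr_wpDl ?mulr_ge0 ?ler0n.
have I0 x : 0 <= I x by apply: Rintegral_ge0 => t /(g0b x)/andP[].
have [mI _] := prob_law P mX (fun x => a < I x).
have Ia : prob P [set w | a < I (X w)] <= 1 / 20.
  apply: le_trans (law_markov P mX I0 a0) _.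
  by rewrite ler_pdivrMr //; apply: (le_trans gmean); rewrite /a; clear - V0 ni0; lra.
have [mO Oa] := prob_outlying_bins eps0 eps14 hub m0 mn s3 delta0 eta0 fmu.
pose z (j : 'I_m) w : R := bin_median (fun i => Y i w) j.
have mz j : measurable_fun setT (z j).
  exact: (measurable_median (bin_seq R n j) (fun i => measurable_funP (Y i))).
have L0' := ltW L0.
have mf : measurable_fun dom f.
  apply: (lipschitz_measurable L0') => x y; rewrite !in_itv /= => /andP[x0 x1] /andP[y0 y1].
  by apply: (hoelder_lipschitz b1 fH); rewrite in_itv /=; clear - h0 hc c12 x0 x1 y0 y1; apply/andP; split; lra.
pose F w : \bar R := (\int[leb]_(x in dom) (`|\sum_j W j x * z j w - f x| ^+ 2)%:E)%E.
have mF : measurable_fun setT F by exact: measurable_integral_sqr_error.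
rewrite -[X in (_ <= P X)%E]/[set w | (F w <= bound%:E)%E].
set target := [set w | _].
have mT : measurable target.
  by rewrite -[target]setTI; apply: emeasurable_fun_infty_c.
pose bad := outlying_bins Y mu delta `|` [set w | a < I (X w)].
have mbad : measurable bad by exact: measurableU.
have badP : prob P bad <= 1 / 10.
  apply: le_trans (probU_le P mO mI) _; clear - out Ia Oa; lra.
have good w : ~ bad w -> target w.
  move=> nbad; have nout : ~ outlying_bins Y mu delta w by move=> ?; apply: nbad; left.
  have Iw : I (X w) <= a by rewrite leNgt; apply/negP => ?; apply: nbad; right.
  rewrite /target /=.
  have pw t : dom t -> `|\sum_j W j t * z j w - f t| ^+ 2 <= 2 * g (X w) t + 2 * Z ^+ 2.
    move=> Dt; have [ht th] := dom_h t Dt.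
    (* [x0] is the fluctuation, controlled through its integral; [r1] is the rounding error, [r2]
       the mean of the rounded medians, [r3] the kernel bias. The last three together are at most
       [Z] at every point. *)
    pose r1 := \sum_j W j t * (z j w - mu j - D j (X w)).
    pose r2 := \sum_j W j t * dj j.
    pose r3 := \sum_j W j t * mu j - f t.
    pose x0 := \sum_j W j t * (D j (X w) - dj j).
    have -> : \sum_j W j t * z j w - f t = x0 + (r1 + r2 + r3).
      rewrite /x0 /r1 /r2 /r3 2!addrA; congr (_ - _); rewrite -!big_split /=.
      by apply: eq_bigr => j _; ring.
    have e1 : `|r1| <= kernel_L1 K * eta.
      apply: Wabs => // j; exact: (bin_median_approx eps0 eps14 m0 mn s3 delta0 eta0 Neta j nout).
    have e2 : `|r2| <= kernel_L1 K * (229 * (eps + delta) + eta).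
      apply: Wabs => // j; exact: (rounded_deviation_mean eps0 eps14 hub m0 mn s3 delta0 eta0 Neta fmu j etas).
    have e3 : `|r3| <= kernel_L1 K * (delta + L * h `^ beta).
      have t01 : t \in `[0, 1] by rewrite in_itv /=; clear - h0 ht th; apply/andP; split; lra.
      have [co] := hoelder_taylor b1 fH t01; rewrite bl => co_taylor.
      apply: (kernel_weight_bias kerK h0 ht th m0 _ L0' delta0 _ co_taylor); first by rewrite ltW // (lt_trans ltr01).
      by move=> j u /=; rewrite in_itv /= => /andP[? ?]; exact: mu_near.
    have e : `|r1 + r2 + r3| <= Z.
      have t3 : `|r1 + r2 + r3| <= `|r1| + `|r2| + `|r3|.
        by apply: le_trans (ler_normD _ _) _; rewrite lerD2r ler_normD.
      apply: (le_trans t3); apply: le_trans (lerD (lerD e1 e2) e3) _.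
      by rewrite -!mulrDr ZE ler_wpM2l //; clearbody eta; clear - eta_n; lra.
    rewrite real_normK ?num_real // /g -/x0.
    have eZ : (r1 + r2 + r3) ^+ 2 <= Z ^+ 2.
      rewrite -[leLHS]real_normK ?num_real // lerXn2r ?nnegrE //.
      exact: le_trans e.
    by have := sqr_ge0 (x0 - (r1 + r2 + r3)); move: (x0) (r1 + _ + _) eZ => y1 y2; clear; rewrite !expr2; lra.
  have mg2 : measurable_fun dom (fun t => 2 * g (X w) t).
    by apply: measurable_funM; [exact: measurable_cst|exact: mg].
  apply: (le_trans (y := (\int[leb]_(t in dom) ((2 * g (X w) t)%:E + (2 * Z ^+ 2)%:E))%E)).
    apply: ge0_le_integral => //.
    - apply/measurable_EFinP; apply: measurable_funX; apply: measurableT_comp => //.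
      apply: measurable_funB => //; apply: measurable_sum => j.
      by apply: measurable_funM; [exact: measurable_funTS (mW j)|exact: measurable_cst].
    - by apply: emeasurable_funD; apply/measurable_EFinP; [exact: mg2|exact: measurable_cst].
  rewrite ge0_integralD //; first last.
  - by move=> t _; rewrite lee_fin mulr_ge0 // sqr_ge0.
  - by apply/measurable_EFinP; exact: mg2.
  - by move=> t _; rewrite lee_fin mulr_ge0 // sqr_ge0.
  rewrite integral_cst //; under eq_integral do rewrite EFinM.
  rewrite ge0_integralZl //; first last.
  - by move=> t _; rewrite lee_fin sqr_ge0.
  - by apply/measurable_EFinP; exact: mg.
  rewrite gfin -/(I _).
  apply: (le_trans (y := (2%:E * (I (X w))%:E + (2 * Z ^+ 2)%:E * 1%:E)%E)).
    by rewrite leeD2l // lee_wpmul2l // lee_fin mulr_ge0 // sqr_ge0.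
  rewrite mule1 -EFinM -EFinD lee_fin; apply: le_trans VZB; clear - Iw; move: Iw; rewrite /a; lra.
have mCbad : measurable (~` bad) by exact: measurableC.
apply: (le_trans (y := P (~` bad))); last first.
  by apply: le_measure; rewrite ?inE.
rewrite probE // lee_fin.
by rewrite probC //; clear - badP; lra.
Qed.

End IntegratedError.

(** * Assembling the rate *)

Section ErrorTerms.
Variable R : realType.

Lemma sqr_sum4_le (a b c d : R) :
  (a + b + c + d) ^+ 2 <= 4 * (a ^+ 2 + b ^+ 2 + c ^+ 2 + d ^+ 2).
Proof.
have := sqr_ge0 (a - b); have := sqr_ge0 (a - c); have := sqr_ge0 (a - d).
have := sqr_ge0 (b - c); have := sqr_ge0 (b - d); have := sqr_ge0 (c - d).
by rewrite !expr2; lra.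
Qed.

(** The weight [w = 1 / (M * h)] is bounded term by term. Against [eps^2] it is [1 + B / N], whose
    second part goes to the rate, so [B] never multiplies [eps^2]; against [delta^2] and [1 / N^2]
    it is the crude [1 + B]; against [1 / S] the identity [S * M = N] gives [1 / (N * h)]. *)
Lemma variance_term_le (kap eps delta N M S h r B D F : R) :
  0 <= kap -> 0 <= eps -> eps <= 1 -> 0 <= delta -> 1 <= N -> 0 < M -> 0 < h -> 0 < S ->
  S * M = N -> 0 <= B -> N^-1 <= r -> delta ^+ 2 <= D * r -> (N * h)^-1 <= F * r ->
  (M * h)^-1 <= 1 + B / N ->
  kap / (M * h) * (2 * (25 * (eps + delta) + 2 / N + 50 / Num.sqrt S)) ^+ 2 <=
  100 ^+ 2 * 4 * kap * (eps ^+ 2 + (B + (D + 1) * (1 + B) + F) * r).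
Proof.
move=> kap0 eps0 eps1 delta0 N1 M0 h0 S0 SMN B0 Nr Dr Fr w1.
have N0 : 0 < N by exact: lt_le_trans N1.
have i0 : 0 <= N^-1 by rewrite invr_ge0 ltW.
have i1 : N^-1 <= 1 by rewrite invf_le1.
set q := (Num.sqrt S)^-1; have q0 : 0 <= q by rewrite invr_ge0 sqrtr_ge0.
have q2 : q ^+ 2 = S^-1 by rewrite exprVn sqr_sqrtr // ltW.
set w := (M * h)^-1 in w1 *; have w0 : 0 <= w by rewrite invr_ge0 mulr_ge0 // ltW.
have wq : w * q ^+ 2 <= F * r.
  by rewrite q2 /w -invfM (_ : M * h * S = N * h) // -SMN; ring.
have {}w1 : w <= 1 + B * N^-1 by exact: w1.
clearbody q w; move: (N^-1) i0 i1 Nr w1 => i i0 i1 ir w1.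
have H1 : (2 * (25 * (eps + delta) + 2 * i + 50 * q)) ^+ 2 <=
    100 ^+ 2 * 4 * (eps ^+ 2 + delta ^+ 2 + i ^+ 2 + q ^+ 2).
  apply: (le_trans (y := (100 * (eps + delta + i + q)) ^+ 2)).
    by rewrite lerXn2r ?nnegrE; clear - eps0 delta0 i0 q0; lra.
  by rewrite exprMn -mulrA ler_wpM2l ?sqr_ge0 ?sqr_sum4_le.
have wB : w <= 1 + B by apply: (le_trans w1); rewrite lerD2l ler_piMr.
have H2 : w * eps ^+ 2 <= eps ^+ 2 + B * r.
  apply: le_trans (ler_wpM2r (sqr_ge0 _) w1) _; rewrite mulrDl mul1r lerD2l -mulrA.
  by rewrite ler_wpM2l // (le_trans _ ir) // ler_piMr // exprn_ile1.
have H3 : w * delta ^+ 2 <= D * (1 + B) * r.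
  by rewrite [D * _]mulrC -mulrA ler_pM ?sqr_ge0.
have H4 : w * i ^+ 2 <= (1 + B) * r.
  by apply: ler_pM => //; rewrite ?sqr_ge0 // (le_trans _ ir) // expr2 ler_piMl.
apply: (le_trans (y := kap * w * (100 ^+ 2 * 4 * (eps ^+ 2 + delta ^+ 2 + i ^+ 2 + q ^+ 2)))).
  by rewrite ler_wpM2l // mulr_ge0.
have -> : kap * w * (100 ^+ 2 * 4 * (eps ^+ 2 + delta ^+ 2 + i ^+ 2 + q ^+ 2)) =
    100 ^+ 2 * 4 * kap * (w * eps ^+ 2 + w * delta ^+ 2 + w * i ^+ 2 + w * q ^+ 2).
  by move: (100 ^+ 2 * 4) => k; ring.
rewrite ler_wpM2l //; first by rewrite mulr_ge0 // mulr_ge0 // sqr_ge0.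
have -> : eps ^+ 2 + (B + (D + 1) * (1 + B) + F) * r =
   eps ^+ 2 + B * r + D * (1 + B) * r + (1 + B) * r + F * r by ring.
by rewrite !lerD.
Qed.

(** [230] is [229] from the mean of the rounded medians plus 1 from the bin width, as [delta] enters
    through both. *)
Lemma bias_term_le (M1 eps delta N b r D E : R) :
  0 <= M1 -> 0 <= eps -> 0 <= delta -> 1 <= N -> 0 <= b ->
  N^-1 <= r -> delta ^+ 2 <= D * r -> b ^+ 2 <= E * r ->
  (M1 * (229 * (eps + delta) + 2 / N + delta + b)) ^+ 2 <=
  230 ^+ 2 * 4 * M1 ^+ 2 * (eps ^+ 2 + (D + 1 + E) * r).
Proof.
move=> M10 eps0 delta0 N1 b0 Nr Dr Er.
have N0 : 0 < N by exact: lt_le_trans N1.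
have i0 : 0 <= N^-1 by rewrite invr_ge0 ltW.
have i1 : N^-1 <= 1 by rewrite invf_le1.
move: (N^-1) i0 i1 Nr => i i0 i1 ir.
rewrite exprMn [leRHS](_ : _ = M1 ^+ 2 * (230 ^+ 2 * (4 * (eps ^+ 2 + (D + 1 + E) * r)))); last first.
  by move: (230 ^+ 2) => k; ring.
rewrite ler_wpM2l ?sqr_ge0 //.
apply: (le_trans (y := (230 * (eps + delta + i + b)) ^+ 2)).
  by rewrite lerXn2r ?nnegrE; clear - eps0 delta0 i0 b0; lra.
rewrite exprMn ler_wpM2l ?sqr_ge0 //; apply: le_trans (sqr_sum4_le _ _ _ _) _.
rewrite ler_wpM2l //.
have -> : eps ^+ 2 + (D + 1 + E) * r = eps ^+ 2 + D * r + r + E * r by ring.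
by rewrite !lerD // (le_trans _ ir) // expr2 ler_piMl.
Qed.

End ErrorTerms.

Theorem theorem2 (R : realType) (l : nat) (K : R -> R) (A : R) :
  is_kernel l K -> 0 < A ->
  exists (C : R) (n0 : nat), 0 < C /\
  forall L : R, 0 < L ->
  exists CL : R, 0 < CL /\
  forall (beta c eps h : R) (n m : nat) (f : R -> R)
    (Q : 'I_n -> probability R R)
    (d : measure_display) (T : measurableType d) (P : probability T R)
    (Y : 'I_n -> {RV P >-> R}),
  1 < beta -> Num.truncn beta = l ->
  0 < c -> c < 1 / 2 ->
  0 <= eps -> eps <= 1 / 4 ->
  hoelder_class beta L f ->
  huber_model eps f Q Y ->
  (n0 <= n)%N -> (0 < m)%N -> (m %| n)%N ->
  asymp_up_to A m%:R (Num.sqrt n%:R / (ln n%:R) `^ (1 / 4)) ->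
  asymp_up_to A h ((n%:R * L ^+ 2) `^ (- (1 / (2 * beta + 1)))) ->
  0 < h -> h < c ->
  ((9 / 10)%:E <=
   P [set w | (\int[lebesgue_measure]_(x in `[c, (1 - c)%R])
                 (`|smoothed_median K m h (fun i => Y i w) x - f x| ^+ 2)%:E
               <= (C * (CL * n%:R `^ (- (2 * beta / (2 * beta + 1)))
                        + eps ^+ 2))%:E)%E])%E.
Proof.
move=> kerK A0.
have M0 := kernel_L1_ge0 K; have L20 := kernel_L2_ge0 K.
(* 40 and 2 are the coefficients of [V] and [Z ^+ 2] in [smoothed_median_error]; the other factors
   come from [variance_term_le] and [bias_term_le] and do not involve [L]. *)
pose k1 : R := 40 * (100 ^+ 2 * 4 * kernel_L2 K).
pose k2 : R := 2 * (230 ^+ 2 * 4 * kernel_L1 K ^+ 2).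
have pos (a x : R) : 0 <= x -> 0 <= a ^+ 2 * 4 * x.
  by move=> x0; apply: mulr_ge0 => //; apply: mulr_ge0 => //; exact: sqr_ge0.
have k10 : 0 <= k1 by apply: mulr_ge0; [exact: ler0n|exact: pos].
have k20 : 0 <= k2 by apply: mulr_ge0; [exact: ler0n|apply: pos; exact: sqr_ge0].
(* The lower bound on [sqrt n] required by [bin_count_bounds]; it depends on [A] only. *)
pose M : R := 320 * (200 * 400) ^+ 2 * A ^+ 3 + 3 * A.
have MM : 0 <= M.
  apply: addr_ge0; apply: mulr_ge0; try exact: ler0n; last exact: ltW.
    by apply: mulr_ge0; [exact: ler0n|exact: sqr_ge0].
  by apply: exprn_ge0; exact: ltW.
exists (k1 + k2 + 2), ((Num.truncn (M ^+ 2)).+1 + 4)%N; split.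
  by rewrite ltr_wpDl ?addr_ge0.
move=> L L0; have L1 : 0 < 1 + L ^+ 2 by rewrite ltr_pwDl // sqr_ge0.
pose D : R := L ^+ 2 * A ^+ 2 * (2 * l%:R + 3).
pose B : R := (3 * A ^+ 2 * (1 + L ^+ 2)) ^+ 12.
pose E : R := A ^+ (l.+1).*2 * (1 + L ^+ 2).
pose F : R := A * (1 + L ^+ 2).
have D0 : 0 <= D.
  by apply: mulr_ge0; [apply: mulr_ge0; exact: sqr_ge0|apply: addr_ge0 => //; exact: mulr_ge0].
have B0 : 0 <= B by rewrite exprn_ge0 // !mulr_ge0 ?sqr_ge0 // ltW.
have E0 : 0 <= E by rewrite mulr_ge0 ?exprn_ge0 // ltW.
have F0 : 0 <= F by rewrite mulr_ge0 // ltW.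
pose G1 := B + (D + 1) * (1 + B) + F.
pose G2 := D + 1 + E.
have G10 : 0 <= G1 by rewrite addr_ge0 // addr_ge0 // mulr_ge0 // addr_ge0.
have G20 : 0 <= G2 by rewrite addr_ge0 // addr_ge0.
exists (G1 + G2 + 1); split; first by rewrite ltr_wpDl // addr_ge0.
move=> beta c eps h n m f Q d T P Y b1 bl c0 c12 eps0 eps14 fH hub nn m0 mn [mA mA'] [hA hA'] h0 hc.
have n4 : (4 <= n)%N by apply: leq_trans nn; rewrite leq_addl.
have n0 : (0 < n)%N by exact: leq_trans n4.
have N1 : 1 < n%:R :> R by rewrite ltr1n; exact: leq_trans n4.
have b0 : 0 < beta by exact: lt_trans b1.
have bS : beta < l.+1%:R by rewrite -bl truncnS_gt.
(* Two-sided comparison with a positive quantity forces [A^-1 <= A]. *)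
have A1 : 1 <= A.
  have r0 : 0 < Num.sqrt n%:R / (ln n%:R) `^ (1 / 4) :> R.
    by rewrite divr_gt0 ?sqrtr_gt0 ?ltr0n // powR_gt0 // ln_gt0.
  have := le_trans mA mA'; rewrite ler_pM2r // => AA.
  rewrite leNgt; apply/negP => A1; move: AA.
  by rewrite leNgt (lt_trans A1) // invf_gt1.
have Mn : M <= Num.sqrt n%:R.
  rewrite -[leLHS](ger0_norm MM) -sqrtr_sqr ler_wsqrtr // (le_trans (ltW (truncnS_gt _))) //.
  by rewrite ler_nat; apply: leq_trans nn; rewrite leq_addr.
have [s3 out] := bin_count_bounds A1 m0 mn n4 mA' Mn.
have mR : 0 < m%:R :> R by rewrite ltr0n.
have delta0 : 0 <= L / m%:R by rewrite divr_ge0 // ltW.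
have sm : (n %/ m)%:R * m%:R = n%:R :> R by rewrite -natrM divnK.
have s0 : 0 < (n %/ m)%:R :> R by rewrite ltr0n (leq_trans _ s3).
have r1 := rate_ge (ltW N1) b0.
have r2 : (L / m%:R) ^+ 2 <= D * rate n%:R beta := bin_width_le A1 L0 N1 b1 bS mR mA.
have r3 : (L * h `^ beta) ^+ 2 <= E * rate n%:R beta :=
  bandwidth_bias_le A1 L0 (ltW N1) b0 h0 bS hA'.
have r4 : (m%:R * h)^-1 <= 1 + B / n%:R := bin_bandwidth_le A1 L0 N1 b1 h0 mR mA hA.
have r5 : (n%:R * h)^-1 <= F * rate n%:R beta.
  rewrite rateE ?(lt_trans ltr01) // invfM mulrC mulrA ler_wpM2r ?invr_ge0 ?ler0n //.
  exact: inv_bandwidth_le A1 L0 (ltW N1) b0 h0 hA.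
have eps1 : eps <= 1 by apply: (le_trans eps14); clear; lra.
have Vle := variance_term_le L20 eps0 eps1 delta0 (ltW N1) mR h0 s0 sm B0 r1 r2 r5 r4.
have b0' : 0 <= L * h `^ beta by rewrite mulr_ge0 ?powR_ge0 // ltW.
have Zle := bias_term_le M0 eps0 delta0 (ltW N1) b0' r1 r2 r3.
apply: (smoothed_median_error kerK b1 bl L0 eps0 eps14 fH hub n0 m0 mn s3 h0 hc c12 out
  erefl erefl erefl).
rewrite -/(rate _ _).
have e0 := sqr_ge0 eps; have ni0 : 0 <= n%:R^-1 :> R by rewrite invr_ge0.
move: (eps ^+ 2) e0 (rate _ _) r1 Vle Zle => e e0 r r1 Vle Zle.
have rr0 : 0 <= r by exact: le_trans r1.
apply: (le_trans (y := k1 * (e + G1 * r) + 2 * r + k2 * (e + G2 * r))).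
  rewrite lerD // ?lerD //.
  - by apply: le_trans (ler_wpM2l (ler0n R 40) Vle) _; rewrite mulrA -/k1.
  - by rewrite ler_wpM2l.
  - by apply: le_trans (ler_wpM2l (ler0n R 2) Zle) _; rewrite mulrA -/k2.
have -> : (k1 + k2 + 2) * ((G1 + G2 + 1) * r + e) =
  k1 * (e + G1 * r) + 2 * r + k2 * (e + G2 * r) +
  (k1 * ((G2 + 1) * r) + k2 * ((G1 + 1) * r) + 2 * ((G1 + G2) * r) + 2 * e) by ring.
clearbody k1 k2 G1 G2; rewrite lerDl; do !(apply: addr_ge0 || apply: mulr_ge0) => //.
Qed.
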